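(* Let $k\ge0$ be an integer and let $\{\mathcal T_h\}$ be a family of conforming, (uniformly) shape-regular simplicial triangulations of $\Omega$. Below, $x\lesssim y$ means $x\le cy$ with a constant $c>0$ independent of $h$, and $x\sim y$ means $x\lesssim y\lesssim x$. Assume: (i) the inner product $d_h(\cdot,\cdot)$ on $\mathbb M_{h,k}$ satisfies $d_h(\mu_h,\mu_h)\sim|\mu_h|_h^2$ for all $\mu_h\in\mathbb M_{h,k}$, and $D_h:\mathbb M_{h,k}\to\mathbb M_{h,k}$ is defined by $\langle D_h\lambda_h,\mu_h\rangle_h=d_h(\lambda_h,\mu_h)$ for all $\lambda_h,\mu_h\in\mathbb M_{h,k}$; (ii) $S_h:\mathbb M_{h,k}\to\mathbb M_{h,k}$ is symmetric positive definite with respect to $\langle\cdot,\cdot\rangle_h$ and, for all $\mu_h\in\mathbb M_{h,k}$, $$\langle S_h\mu_h,\mu_h\rangle_h\lesssim\langle D_h^{-1}\mu_h,\mu_h\rangle_h,\qquad \langle S_h^{-1}\mu_h,\mu_h\rangle_h\lesssim\sum_{T\in\mathcal T_h}h_T^{-2}\|\mu_h\|_{h,\partial T}^2;$$ (iii) $\widetilde B_h:V_h^c\to V_h^c$ is symmetric positive definite with respect to the $L^2(\Omega)$ inner product $(\cdot,\cdot)$ and $(\widetilde B_h^{-1}v_h,v_h)\sim|v_h|_{1,\Omega}^2$ for all $v_h\in V_h^c$. Let $\Pi_h$ be either $\Pi_h^1$ or $\Pi_h^2$ and define $B_h^G:=S_h+\Pi_h\widetilde B_h\Pi_h^t:\mathbb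 M_{h,k}\to\mathbb M_{h,k}$. Then $$\kappa(B_h^GD_h):=\frac{\lambda_{\max}(B_h^GD_h)}{\lambda_{\min}(B_h^GD_h)}\lesssim1,$$ where $\lambda_{\max}$ and $\lambda_{\min}$ denote the maximum and minimum eigenvalues.
   Context: $\Omega\subset\mathbb R^d$ ($d=2,3$) is a bounded polyhedral domain. For a triangulation $\mathcal T_h$, $h_T$ is the diameter of $T\in\mathcal T_h$ and $h=\max_Th_T$. The triangulations are not assumed quasi-uniform. $\mathcal F_h$ is the set of all faces ($(d-1)$-dimensional; edges if $d=2$) of $\mathcal T_h$, $\mathcal F_T$ the set of the $d+1$ faces of $T$, $|F|$ the $(d-1)$-dimensional measure of $F$, $P_k(D)$ the polynomials of degree $\le k$ on $D$, and $|\cdot|_{1,\Omega}$ the $H^1(\Omega)$-seminorm. $$\mathbb M_{h,k}:=\{\mu_h\in L^2(\cup_{F\in\mathcal F_h}F):\ \mu_h|_F\in P_k(F)\ \forall F\in\mathcal F_h,\ \mu_h|_{\partial\Omega}=0\}.$$ Inner product on $\mathbb M_{h,k}$: $\langle\lambda_h,\mu_h\rangle_h:=\sum_{T\in\mathcal T_h}h_T\int_{\partial T}\lambda_h\mu_h$. For $\mu\in L^2(\partial T)$: $\|\mu\|_{h,\partial T}:=h_T^{1/2}\|\mu\|_{L^2(\partial T)}$; $|\mu|_{h,\partial T}:=h_T^{-1/2}\|\mu-m_T(\mu)\|_{L^2(\partial T)}$ with $m_T(\mu):=\frac1{d+1}\sum_{F\in\mathcal F_T}\frac1{|F|}\int_F\mu$;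 and $|\mu|_h:=(\sum_{T\in\mathcal T_h}|\mu|_{h,\partial T}^2)^{1/2}$. $V_h^c:=\{v_h\in H_0^1(\Omega):v_h|_T\in P_1(T)\ \forall T\in\mathcal T_h\}$. Prolongations $V_h^c\to\mathbb M_{h,k}$: $\Pi_h^1v_h|_F:=\frac1{|F|}\int_Fv_h$ for all $F\in\mathcal F_h$; and $\Pi_h^2$ defined by $\int_F(\Pi_h^2v_h)q=\int_Fv_hq$ for all $F\in\mathcal F_h$, $q\in P_k(F)$. The adjoint $\Pi_h^t:\mathbb M_{h,k}\to V_h^c$ is defined by $(\Pi_h^t\mu_h,v_h)=\langle\mu_h,\Pi_hv_h\rangle_h$ for all $\mu_h\in\mathbb M_{h,k}$, $v_h\in V_h^c$. *)

(* Defs.v *)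
From HB Require Import structures.
From mathcomp Require Import all_boot all_order all_algebra.
From mathcomp Require Import all_classical all_reals all_analysis measurable_realfun.
From mathcomp Require Import ring.
Set Implicit Arguments.
Unset Strict Implicit.
Unset Printing Implicit Defensive.
Import Order.TTheory GRing.Theory Num.Theory.
Import numFieldNormedType.Exports.
Local Open Scope classical_set_scope.
Local Open Scope ring_scope.

Section lebesgue_tuple.
Context {R : realType}.
Notation RR := (measurableTypeR R).

Definition consT n (p : RR * n.-tuple RR) : n.+1.-tuple RR :=
  [tuple of p.1 :: p.2].

Lemma measurable_consT n : measurable_fun setT (@consT n).
Proof. exact: measurable_cons. Qed.

Section step.
Variables (n : nat) (mu : {sigma_finite_measure set (n.-tuple RR) -> \bar R}).

Definition lebesgue_cons : set (n.+1.-tuple RR) -> \bar R :=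
  pushforward (@lebesgue_measure R \x mu)%E (@consT n).

Let m0 : lebesgue_cons set0 = 0%E.
Proof. by rewrite /lebesgue_cons /pushforward preimage_set0 measure0. Qed.

Let m_ge0 A : (0 <= lebesgue_cons A)%E.
Proof. by rewrite /lebesgue_cons /pushforward. Qed.

Let m_additive : semi_sigma_additive lebesgue_cons.
Proof.
exact: (@measure_semi_sigma_additive _ _ _
  (measure_function_pushforward__canonical__measure_function_Measure
    (lebesgue_measure \x mu)%E (@measurable_consT n))).
Qed.

HB.instance Definition _ :=
  isMeasure.Build _ _ _ lebesgue_cons m0 m_ge0 m_additive.

Let unconsT (t : n.+1.-tuple RR) : RR * n.-tuple RR :=
  (thead t, [tuple of behead t]).

Let measurable_unconsT : measurable_fun setT unconsT.
Proof.
apply/measurable_fun_pairP; split; first exact: measurable_tnth.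
exact: measurable_behead.
Qed.

Let consTK p : unconsT (consT p) = p.
Proof.
by case: p => x t; rewrite /unconsT /consT theadE; congr pair; exact: val_inj.
Qed.

Let m_sigma_finite : sigma_finite setT lebesgue_cons.
Proof.
have /sigma_finiteP[F [TF ndF Foo]] := sigma_finiteT (@lebesgue_measure R).
have /sigma_finiteP[G [TG ndG Goo]] := sigma_finiteT mu.
exists (fun k => unconsT @^-1` (F k `*` G k)).
  rewrite predeqE => t; split=> // _.
  have [i _ Fi] : (\bigcup_i F i) (thead t) by rewrite -TF.
  have [j _ Gj] : (\bigcup_i G i) [tuple of behead t] by rewrite -TG.
  exists (maxn i j) => //; split => /=.
  - by move: Fi; exact/subsetPset/ndF/leq_maxl.
  - by move: Gj; exact/subsetPset/ndG/leq_maxr.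
move=> k; have [mF Fk] := Foo k; have [mG Gk] := Goo k; split.
  by rewrite -[X in measurable X]setTI; apply: measurable_unconsT => //;
    exact: measurableX.
rewrite /lebesgue_cons /pushforward (_ : _ @^-1` _ = F k `*` G k); last first.
  by apply/funext => p; rewrite /preimage /mkset consTK.
by rewrite product_measure1E// lte_mul_pinfty// ge0_fin_numE.
Qed.

HB.instance Definition _ :=
  Measure_isSigmaFinite.Build _ _ _ lebesgue_cons m_sigma_finite.

End step.

HB.instance Definition _ := SigmaFiniteMeasure.on (@dirac _ (0.-tuple RR) [tuple] R).

(* Lebesgue measure on n-tuples: the n-fold product of the one on R. *)
Fixpoint lebesgue_tuple n : {sigma_finite_measure set (n.-tuple RR) -> \bar R} :=
  if n is m.+1 then lebesgue_cons (lebesgue_tuple m) else \d_([tuple]).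

End lebesgue_tuple.

Section lebesgue_Rn.
Context {R : realType} (n : nat).

(* 'rV[R]_n with its Borel sigma-algebra. *)
Definition borelRn := g_sigma_algebraType (@open 'rV[R]_n).

Definition row_of_tuple (t : n.-tuple (measurableTypeR R)) : borelRn :=
  (\row_i tnth t i : 'rV[R]_n).

Lemma measurable_row_of_tuple : measurable_fun setT row_of_tuple.
Proof.
apply: (@measurability _ _ _ borelRn setT row_of_tuple (@open 'rV[R]_n)) => //.
move=> _ [U oU <-]; rewrite setTI.
pose box (q : 'rV[rat]_n * nat) : set (n.-tuple (measurableTypeR R)) :=
  \bigcap_(i in [set: 'I_n])
    (@tnth _ _ ^~ i) @^-1` (ball (ratr (q.1 0 i) : R) q.2.+1%:R^-1).
have mbox q : measurable (box q).
  apply: fin_bigcap_measurable => // i _.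
  rewrite -[X in measurable X]setTI; apply: measurable_tnth => //.
  exact: measurable_ball.
rewrite (_ : _ @^-1` U =
  \bigcup_(q in [set q | box q `<=` row_of_tuple @^-1` U]) box q); last first.
  apply/seteqP; split=> [t Ut|t [q /= qU]]; last exact: qU.
  have /nbhs_ballP[e /= e0 eU] : nbhs (row_of_tuple t : 'rV[R]_n) U.
    exact: open_nbhs_nbhs.
  have [k ke] : exists k : nat, k.+1%:R^-1 < e / 2.
    have [k] := ltr_add_invr (divr_gt0 e0 (ltr0Sn R 1)).
    by rewrite add0r; exists k.
  have q_ i : exists q : rat, ball (ratr q : R) k.+1%:R^-1 (tnth t i).
    have [|q] := @rat_in_itvoo R (tnth t i) (tnth t i + k.+1%:R^-1).
      by rewrite ltrDl.
    rewrite in_itv/= => /andP[tq qt]; exists q.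
    by rewrite /ball/= ger0_norm ?subr_ge0 ?(ltW tq)// ltrBlDl.
  have [q qP] := choice q_.
  exists (\row_i q i, k) => [|i _]; last by rewrite /= mxE.
  move=> s bs; apply: eU; split=> // a i; rewrite ord1 !mxE.
  apply: (@le_ball _ _ _ (k.+1%:R^-1 + k.+1%:R^-1)).
    by rewrite (le_trans (lerD (ltW ke) (ltW ke)))// -splitr.
  have /ball_sym h1 := qP i.
  have := bs i I; rewrite /preimage /mkset /= mxE => h2.
  exact: ball_triangle h1 h2.
rewrite bigcup_mkcond; apply: countable_bigcupT_measurable => // q.
by case: ifP.
Qed.

Definition lebesgueRn : set borelRn -> \bar R :=
  pushforward (lebesgue_tuple n) row_of_tuple.

Let lebesgueRn0 : lebesgueRn set0 = 0%E.
Proof. by rewrite /lebesgueRn /pushforward preimage_set0 measure0. Qed.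

Let lebesgueRn_ge0 A : (0 <= lebesgueRn A)%E.
Proof. by rewrite /lebesgueRn /pushforward. Qed.

Let lebesgueRn_additive : semi_sigma_additive lebesgueRn.
Proof.
exact: (@measure_semi_sigma_additive _ _ _
  (measure_function_pushforward__canonical__measure_function_Measure
    (lebesgue_tuple n) measurable_row_of_tuple)).
Qed.

HB.instance Definition _ :=
  isMeasure.Build _ _ _ lebesgueRn lebesgueRn0 lebesgueRn_ge0 lebesgueRn_additive.

Lemma continuous_measurable_Rn (f : 'rV[R]_n -> R) :
  continuous f -> measurable_fun setT (f : borelRn -> R).
Proof.
move=> /continuousP cf; apply: (measurability _ (RGenOpens.measurableE R)).
move=> _ [_ [a [b ->] <-]]; rewrite setTI; apply: sub_sigma_algebra.
exact/cf/interval_open.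
Qed.

End lebesgue_Rn.

Arguments borelRn {R} n.
Arguments lebesgueRn {R n}.

Section spaces.
Context {R : realType}.

(* The library norm on 'rV[R]_d is the sup norm; diameters are Euclidean. *)
Definition enorm d (x : 'rV[R]_d) : R := Num.sqrt (\sum_i x 0 i ^+ 2).

Definition diameter d (A : set 'rV[R]_d) : R :=
  sup [set r | exists x y, [/\ A x, A y & r = enorm (x - y)]].

(* Supremum of the diameters of the Euclidean balls contained in A. *)
Definition indiameter d (A : set 'rV[R]_d) : R :=
  sup [set r *+ 2 | r in [set r | 0 <= r /\
    exists x, [set y | enorm (y - x) <= r] `<=` A]].

Definition hull d n (p : 'I_n -> 'rV[R]_d) (F : {set 'I_n}) : set 'rV[R]_d :=
  [set x | exists a : 'I_n -> R,
    [/\ forall v, 0 <= a v, \sum_(v in F) a v = 1 &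
        x = \sum_(v in F) a v *: p v]].

Definition affinely_independent d n (p : 'I_n -> 'rV[R]_d) (F : {set 'I_n}) :=
  forall a : 'I_n -> R, \sum_(v in F) a v = 0 ->
    \sum_(v in F) a v *: p v = 0 -> forall v, v \in F -> a v = 0.

(* dom_regular excludes slits and missing lower-dimensional pieces: the domain
   lies on one side of its boundary. *)
Record polyhedral_domain d := PolyhedralDomain {
  dom :> set 'rV[R]_d;
  dom_neq0 : dom !=set0;
  dom_open : open dom;
  dom_connected : connected dom;
  dom_bounded : bounded_set dom;
  dom_regular : (closure dom)^° = dom;
  dom_polyhedral : exists N (q : 'I_N -> 'I_d.+1 -> 'rV[R]_d),
    closure dom = \bigcup_i hull (q i) [set: 'I_d.+1]%SET
}.

(* Elements are given by their vertex sets; distinct elements meet in the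
   simplex spanned by their common vertices (possibly empty). *)
Record triangulation d (Omega : polyhedral_domain d) := Triangulation {
  nvert : nat;
  vert : 'I_nvert -> 'rV[R]_d;
  elts : {set {set 'I_nvert}};
  card_elt : forall T, T \in elts -> #|T| = d.+1;
  elt_nondegenerate : forall T, T \in elts -> affinely_independent vert T;
  elt_conforming : forall T T', T \in elts -> T' \in elts ->
    hull vert T `&` hull vert T' = hull vert (T :&: T')%SET;
  elt_cover : closure Omega = \bigcup_(T in [set` elts]) hull vert T
}.

Definition polyfun d k : set ('rV[R]_d -> R) :=
  [set f | exists c : {ffun 'I_d -> 'I_k.+1} -> R,
    forall x : 'rV[R]_d,
      f x = \sum_(a : {ffun 'I_d -> 'I_k.+1} | (\sum_i a i <= k)%N)
              c a * \prod_i x 0 i ^+ a i].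

Definition refsimplex m : set 'rV[R]_m :=
  [set t | (forall j, 0 <= t 0 j) /\ \sum_j t 0 j <= 1].

(* Integral over the m-simplex of R^d with vertex list s, of size m.+1, with
   respect to its m-dimensional surface measure: pull back by the affine
   parametrization t |-> s_0 + \sum_j t_j (s_(j+1) - s_0) of the reference
   simplex, with Gram factor sqrt (det (E E^T)). The value does not depend on
   the ordering of s. *)
Definition simplex_int d m (s : seq 'rV[R]_d) (f : 'rV[R]_d -> R) : R :=
  let E := \matrix_(j < m) (s`_j.+1 - s`_0) in
  Num.sqrt (\det (E *m E^T)) *
  \int[lebesgueRn]_(t in @refsimplex m) f (s`_0 + t *m E).

Definition C1c d (Omega : set 'rV[R]_d) (phi : 'rV[R]_d -> R) :=
  [/\ exists C, [/\ compact C, C `<=` Omega & forall x, ~ C x -> phi x = 0],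
      continuous phi,
      forall i x, derivable phi x (delta_mx 0 i) &
      forall i, continuous ('D_(delta_mx 0 i) phi)].

Definition L2_on d (Omega : set 'rV[R]_d) (u : 'rV[R]_d -> R) :=
  measurable_fun (Omega : set (borelRn d)) (u : borelRn d -> R) /\
  (\int[lebesgueRn]_(x in Omega) ((u x) ^+ 2)%:E < +oo)%E.

Definition L2_cvg d (Omega : set 'rV[R]_d) (f : nat -> 'rV[R]_d -> R)
    (u : 'rV[R]_d -> R) :=
  (fun n => \int[lebesgueRn]_(x in Omega) ((f n x - u x) ^+ 2)%:E)%E
    @ \oo --> 0%:E.

(* H^1_0(Omega): closure, in the H^1 norm, of the C^1 functions with compact
   support in Omega (Gilbarg-Trudinger, Section 7.5); the L^2 limit g i of the
   i-th partial derivatives is the weak derivative of u. *)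
Definition H10 d (Omega : set 'rV[R]_d) (u : 'rV[R]_d -> R) :=
  L2_on Omega u /\ exists (phi : nat -> 'rV[R]_d -> R) (g : 'I_d -> 'rV[R]_d -> R),
    [/\ forall n, C1c Omega (phi n), L2_cvg Omega phi u,
        forall i, L2_on Omega (g i) &
        forall i, L2_cvg Omega (fun n => 'D_(delta_mx 0 i) (phi n)) (g i)].

Lemma polyfun_lin d k a (f g : 'rV[R]_d -> R) : polyfun k f -> polyfun k g ->
  polyfun k (fun x => a * f x + g x).
Proof.
move=> [c fc] [c' gc]; exists (fun b => a * c b + c' b) => x.
rewrite fc gc mulr_sumr -big_split; apply: eq_bigr => b _.
by rewrite mulrDl mulrA.
Qed.

Lemma polyfun0 d k : polyfun k (fun=> 0 : R) (d := d).
Proof. by exists (fun=> 0) => x; rewrite big1// => b _; rewrite mul0r. Qed.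

Lemma measurable_test d (Omega : set 'rV[R]_d) f :
  measurable (Omega : set (borelRn d)) -> continuous f ->
  measurable_fun (Omega : set (borelRn d)) (f : borelRn d -> R).
Proof.
by move=> mO cf; apply: measurable_funTS; exact: continuous_measurable_Rn.
Qed.

Lemma sqr_lin_le (a x y : R) : (a * x + y) ^+ 2 <= (2 * a ^+ 2) * x ^+ 2 + 2 * y ^+ 2.
Proof.
rewrite -subr_ge0 (_ : _ - _ = (a * x - y) ^+ 2) ?sqr_ge0//.
by ring.
Qed.

Section L2_lin.
Variables (d : nat) (Omega : set 'rV[R]_d).
Hypothesis mO : measurable (Omega : set (borelRn d)).

Lemma int_sqr_lin_le a (u v : 'rV[R]_d -> R) :
  measurable_fun (Omega : set (borelRn d)) (u : borelRn d -> R) ->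
  measurable_fun (Omega : set (borelRn d)) (v : borelRn d -> R) ->
  (\int[lebesgueRn]_(x in Omega) ((a * u x + v x) ^+ 2)%:E <=
   (2 * a ^+ 2)%:E * \int[lebesgueRn]_(x in Omega) ((u x) ^+ 2)%:E +
   2%:E * \int[lebesgueRn]_(x in Omega) ((v x) ^+ 2)%:E)%E.
Proof.
move=> mu mv.
have mu2 : measurable_fun (Omega : set (borelRn d)) (fun x : borelRn d => ((u x) ^+ 2)%:E).
  by apply/measurable_EFinP; exact: measurable_funX.
have mv2 : measurable_fun (Omega : set (borelRn d)) (fun x : borelRn d => ((v x) ^+ 2)%:E).
  by apply/measurable_EFinP; exact: measurable_funX.
have a20 : 0 <= 2 * a ^+ 2 :> R by rewrite mulr_ge0// sqr_ge0.
rewrite -!ge0_integralZl//; try by move=> x _; rewrite lee_fin sqr_ge0.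
- rewrite -ge0_integralD//.
  + apply: ge0_le_integral => //.
    * by move=> x _; rewrite lee_fin sqr_ge0.
    * apply/measurable_EFinP/measurable_funX/measurable_funD => //.
      exact: measurable_funM.
    * by apply: emeasurable_funD; apply: measurable_funeM.
    * by move=> x _; rewrite -!EFinM -EFinD lee_fin sqr_lin_le.
  + by move=> x _; rewrite -EFinM lee_fin mulr_ge0// sqr_ge0.
  + exact: measurable_funeM.
  + by move=> x _; rewrite -EFinM lee_fin mulr_ge0// sqr_ge0.
  + exact: measurable_funeM.
Qed.

Lemma L2_lin a u v : L2_on Omega u -> L2_on Omega v -> L2_on Omega (fun x => a * u x + v x).
Proof.
move=> [mu iu] [mv iv]; split.
  by apply: measurable_funD => //; exact: measurable_funM.
apply: le_lt_trans (int_sqr_lin_le a mu mv) _.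
by rewrite lte_add_pinfty// lte_mul_pinfty// lee_fin mulr_ge0// sqr_ge0.
Qed.

Lemma L2_cvg_lin a f g u v :
  (forall n, measurable_fun (Omega : set (borelRn d)) (f n : borelRn d -> R)) ->
  (forall n, measurable_fun (Omega : set (borelRn d)) (g n : borelRn d -> R)) ->
  L2_on Omega u -> L2_on Omega v -> L2_cvg Omega f u -> L2_cvg Omega g v ->
  L2_cvg Omega (fun n x => a * f n x + g n x) (fun x => a * u x + v x).
Proof.
move=> mf mg [mu _] [mv _] fu gv.
apply: (@squeeze_cvge _ _ _ _ (cst 0%E) _ (fun n =>
   (2 * a ^+ 2)%:E * \int[lebesgueRn]_(x in Omega) ((f n x - u x) ^+ 2)%:E +
   2%:E * \int[lebesgueRn]_(x in Omega) ((g n x - v x) ^+ 2)%:E)%E).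
- apply: nearW => n; apply/andP; split.
    by apply: integral_ge0 => x _; rewrite lee_fin sqr_ge0.
  rewrite (_ : (fun x => ((a * f n x + g n x - (a * u x + v x)) ^+ 2)%:E) =
     (fun x => ((a * (f n x - u x) + (g n x - v x)) ^+ 2)%:E)).
    by apply: int_sqr_lin_le; exact: measurable_funB.
  by apply/funext => x; congr ((_ ^+ 2)%:E); ring.
- exact: cvg_cst.
- rewrite [X in _ --> X](_ : _ = (2 * a ^+ 2)%:E * 0 + 2%:E * 0)%E; last first.
    by rewrite !mule0 adde0.
  by apply: cvgeD; [rewrite !mule0| exact: cvgeZl|exact: cvgeZl].
Qed.

Lemma continuous_lin a (f g : 'rV[R]_d -> R) : continuous f -> continuous g ->
  continuous (fun x => a * f x + g x).
Proof.
move=> cf cg x; apply: (continuousD (f := a \*: f)); last exact: cg.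
by apply: continuousZl_tmp; exact: cf.
Qed.

Lemma H10_lin a u v : H10 Omega u -> H10 Omega v -> H10 Omega (fun x => a * u x + v x).
Proof.
move=> [Lu [f [g [tf fu Lg fg]]]] [Lv [f' [g' [tf' fu' Lg' fg']]]].
split; first exact: L2_lin.
exists (fun n x => a * f n x + f' n x), (fun i x => a * g i x + g' i x).
have dE n i : 'D_(delta_mx 0 i) (fun x => a * f n x + f' n x) =
    (fun x => a * 'D_(delta_mx 0 i) (f n) x + 'D_(delta_mx 0 i) (f' n) x).
  have [_ _ df _] := tf n; have [_ _ df' _] := tf' n.
  apply/funext => x.
  have dZ : derivable (a \*: f n) x (delta_mx 0 i) by exact: derivableZ.
  by rewrite (deriveD dZ (df' i x)) (deriveZ _ (df i x)).
split.
- move=> n; have [[C [cC CO C0]] cf df cdf] := tf n.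
  have [[C' [cC' CO' C0']] cf' df' cdf'] := tf' n.
  split.
  + exists (C `|` C'); split; first exact: compactU.
      by rewrite subUset.
    by move=> x /not_orP[xC xC']; rewrite C0// C0'// mulr0 addr0.
  + exact: continuous_lin.
  + move=> i x; apply: (derivableD (f := a \*: f n)) => //.
    exact: derivableZ.
  + by move=> i; rewrite dE; exact: continuous_lin.
- apply: L2_cvg_lin => // n; apply: measurable_test => //.
    by have [] := tf n.
  by have [] := tf' n.
- by move=> i; exact: L2_lin.
- move=> i; rewrite (_ : (fun n => _) = (fun n x => a * 'D_(delta_mx 0 i) (f n) x
    + 'D_(delta_mx 0 i) (f' n) x)); last by apply/funext => n; exact: dE.
  apply: L2_cvg_lin => // n; apply: measurable_test => //.
    by have [] := tf n.
  by have [] := tf' n.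
Qed.

Lemma H100 : H10 Omega (fun=> 0).
Proof.
have L0 : L2_on Omega (fun=> 0).
  split; first exact: measurable_cst.
  by rewrite integral0_eq ?ltry// => x _; rewrite expr0n.
have I0 : L2_cvg Omega (fun _ _ => 0) (fun=> 0).
  rewrite /L2_cvg (_ : (fun n => _) = cst 0%E); first exact: cvg_cst.
  by apply/funext => n; rewrite integral0_eq// => x _; rewrite subr0 expr0n.
have D0 i : 'D_(delta_mx 0 i) (fun=> 0 : R) = (fun=> 0 : R) :> ('rV[R]_d -> R).
  by apply/funext => x; rewrite derive_cst.
split=> //; exists (fun _ _ => 0), (fun _ _ => 0); split=> //.
- move=> n; split.
  + by exists set0; split=> //; exact: compact0.
  + exact: cst_continuous.
  + by move=> i x; exact: derivable_cst.
  + by move=> i; rewrite D0; exact: cst_continuous.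
- move=> i; rewrite (_ : (fun n => _) = fun _ _ => 0)//.
  by apply/funext => n; exact: D0.
Qed.

End L2_lin.
End spaces.
Arguments polyhedral_domain : clear implicits.

Section mesh.
Context {R : realType} {d : nat} {Omega : polyhedral_domain R d}.
Implicit Type K : triangulation Omega.

Definition face_of K (T F : {set 'I_(nvert K)}) := (F \subset T) && (#|F| == d).

Definition is_face K (F : {set 'I_(nvert K)}) :=
  [exists T in elts K, face_of T F].

Definition elt_diameter K (T : {set 'I_(nvert K)}) : R :=
  diameter (hull (@vert _ _ _ K) T).

Definition face_int K (F : {set 'I_(nvert K)}) (f : 'rV[R]_d -> R) : R :=
  simplex_int d.-1 [seq vert v | v <- enum F] f.

Definition face_measure K (F : {set 'I_(nvert K)}) : R := face_int F (fun=> 1).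

Definition shape_regular (I : Type) (K : I -> triangulation Omega) :=
  exists2 sigma : R, 0 < sigma & forall i T, T \in elts (K i) ->
    elt_diameter T <= sigma * indiameter (hull (@vert _ _ _ (K i)) T).

Section conforming_space.
Variable K : triangulation Omega.

(* The elements are closed, so a class of H^1_0(Omega) whose restriction to each
   element is in P_1 is represented by its continuous representative, extended
   by 0 outside the closure of Omega. *)
Definition in_V (v : 'rV[R]_d -> R) :=
  [/\ H10 Omega v,
      forall T, T \in elts K ->
        exists2 p, polyfun 1 p & forall x, hull (@vert _ _ _ K) T x -> v x = p x &
      forall x, ~ closure Omega x -> v x = 0].

Definition V_pred : {pred 'rV[R]_d -> R^o} := fun v => `[< in_V v >].

Record Vspace := MkVspace { V_fun :> 'rV[R]_d -> R^o; V_funP : V_fun \in V_pred }.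

HB.instance Definition _ := [isSub for V_fun].
HB.instance Definition _ := [Choice of Vspace by <:].

Lemma V_submod_closed : submod_closed V_pred.
Proof.
split.
  apply/asboolP; split=> //; first exact: H100.
  by move=> T _; exists (fun=> 0) => //; exact: polyfun0.
move=> a u v /asboolP[Hu Pu Zu] /asboolP[Hv Pv Zv]; apply/asboolP; split.
- apply: H10_lin => //; apply: sub_sigma_algebra; exact: dom_open.
- move=> T TK; have [p pP pE] := Pu T TK; have [q qP qE] := Pv T TK.
  exists (fun x => a * p x + q x); first exact: polyfun_lin.
  by move=> x Tx; rewrite -pE// -qE.
- move=> x xO; rewrite /= !fctE Zu// Zv// scaler0 addr0//.
Qed.

HB.instance Definition _ :=
  GRing.isSubmodClosed.Build _ _ V_pred V_submod_closed.
HB.instance Definition _ := [SubChoice_isSubLmodule of Vspace by <:].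

End conforming_space.

Section skeleton_space.
Variables (K : triangulation Omega) (k : nat).

(* Faces overlap in null sets, so a function in L^2 of the skeleton is a family
   of functions on the faces; mu F is the restriction to F, extended by 0. *)
Definition in_M (mu : {set 'I_(nvert K)} -> 'rV[R]_d -> R) :=
  [/\ forall F, is_face F ->
        exists2 p, polyfun k p & forall x, hull (@vert _ _ _ K) F x -> mu F x = p x,
      forall F x, ~ (is_face F /\ hull (@vert _ _ _ K) F x) -> mu F x = 0 &
      forall F, is_face F -> hull (@vert _ _ _ K) F `<=` closure Omega `\` Omega ->
        forall x, mu F x = 0].

Definition M_pred : {pred {set 'I_(nvert K)} -> 'rV[R]_d -> R^o} :=
  fun mu => `[< in_M mu >].

Record Mspace := MkMspace {
  M_fun :> {set 'I_(nvert K)} -> 'rV[R]_d -> R^o;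
  M_funP : M_fun \in M_pred
}.

HB.instance Definition _ := [isSub for M_fun].
HB.instance Definition _ := [Choice of Mspace by <:].

Lemma M_submod_closed : submod_closed M_pred.
Proof.
split.
  by apply/asboolP; split=> // F FK; exists (fun=> 0) => //; exact: polyfun0.
move=> a u v /asboolP[Pu Zu Bu] /asboolP[Pv Zv Bv]; apply/asboolP; split.
- move=> F FK; have [p pP pE] := Pu F FK; have [q qP qE] := Pv F FK.
  exists (fun x => a * p x + q x); first exact: polyfun_lin.
  by move=> x Fx; rewrite -pE// -qE.
- by move=> F x xF; rewrite /= !fctE Zu// Zv// scaler0 addr0.
- by move=> F FK FO x; rewrite /= !fctE Bu// Bv// scaler0 addr0.
Qed.

HB.instance Definition _ := GRing.isSubmodClosed.Build _ _ M_pred M_submod_closed.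
HB.instance Definition _ := [SubChoice_isSubLmodule of Mspace by <:].

End skeleton_space.

Section forms.
Variables (K : triangulation Omega) (k : nat).
Implicit Types (lambda mu : Mspace K k) (u v : Vspace K) (T : {set 'I_(nvert K)}).

Definition ipL2 u v : R := \int[lebesgueRn]_(x in Omega) (u x * v x).

(* The weak gradient of a continuous piecewise P_1 function is, a.e., its
   classical gradient in the interior of the elements. *)
Definition h1_semi v : R :=
  Num.sqrt (\sum_(T in elts K) \int[lebesgueRn]_(x in (hull (@vert _ _ _ K) T)^°)
    \sum_i ('D_(delta_mx 0 i) v x) ^+ 2).

Definition bdry_int T (f : {set 'I_(nvert K)} -> 'rV[R]_d -> R) : R :=
  \sum_(F | face_of T F) face_int F (f F).

Definition ip_h lambda mu : R :=
  \sum_(T in elts K)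
    elt_diameter T * bdry_int T (fun F x => lambda F x * mu F x).

Definition norm_hT T mu : R :=
  Num.sqrt (elt_diameter T) * Num.sqrt (bdry_int T (fun F x => mu F x ^+ 2)).

Definition mean_T T mu : R :=
  d.+1%:R^-1 *
    \sum_(F | face_of T F) (face_measure F)^-1 * face_int F (mu F).

Definition semi_hT T mu : R :=
  (Num.sqrt (elt_diameter T))^-1 *
  Num.sqrt (bdry_int T (fun F x => (mu F x - mean_T T mu) ^+ 2)).

Definition semi_h mu : R := Num.sqrt (\sum_(T in elts K) semi_hT T mu ^+ 2).

Definition is_Pi1 (P : Vspace K -> Mspace K k) := forall v F, is_face F ->
  forall x, hull (@vert _ _ _ K) F x -> P v F x = (face_measure F)^-1 * face_int F v.

Definition is_Pi2 (P : Vspace K -> Mspace K k) := forall v F, is_face F ->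
  forall q, polyfun k q ->
    face_int F (fun x => P v F x * q x) = face_int F (fun x => v x * q x).

End forms.
End mesh.

Section operators.
Context {R : realType} {V : lmodType R}.
Implicit Types (b : V -> V -> R) (A : V -> V).

Definition inner_product b :=
  [/\ forall a u v w, b (a *: u + v) w = a * b u w + b v w,
      forall u v, b u v = b v u &
      forall u, u != 0 -> 0 < b u u].

Definition sym_posdef b A :=
  (forall u v, b (A u) v = b u (A v)) /\ (forall u, u != 0 -> 0 < b (A u) u).

Definition eigenvalue_of A (l : R) := exists2 v, v != 0 & A v = l *: v.

Definition max_eigenvalue A l :=
  eigenvalue_of A l /\ forall l', eigenvalue_of A l' -> l' <= l.

Definition min_eigenvalue A l :=
  eigenvalue_of A l /\ forall l', eigenvalue_of A l' -> l <= l'.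

End operators.

Definition lesssim {R : realType} {I : Type} {X : I -> Type}
    (x y : forall i, X i -> R) :=
  exists2 c : R, 0 < c & forall i z, x i z <= c * y i z.

Definition equiv_unif {R : realType} {I : Type} {X : I -> Type}
    (x y : forall i, X i -> R) :=
  lesssim x y /\ lesssim y x.

(* Main.v *)
(* Auxiliary space argument. With [A = BG D], both [dh (A u) v] and [dh] are
   symmetric forms, so the extreme eigenvalues of [A] are extrema of the
   Rayleigh quotient [dh (A u) u / dh u u]. It is bounded above because the
   prolongations are stable, [semi_h (Pi v) <= C h1_semi v], and below because
   every [mu] splits as [mu = (mu - Pi v) + Pi v] with
   [\sum_t h_t^-2 norm_hT t (mu - Pi v)^2 + h1_semi v^2 <= C semi_h mu^2].
   The function [v] is the nodal one whose value at an interior vertex [a] is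
   the mean [mean_T] over some element containing [a], and [0] at boundary
   vertices. The means of two elements sharing a face differ by the oscillation
   of [mu] on them, and the elements around a vertex are connected through
   faces containing it (up to a boundary face, where [mu] vanishes, when the
   vertex is on the boundary). Shape regularity bounds the number of elements
   around a vertex, hence the length of such chains and the variation of the
   diameters along them, without quasi-uniformity. *)
Require Import Defs.
From HB Require Import structures.
From mathcomp Require Import all_boot all_order all_algebra.
From mathcomp Require Import all_classical all_reals all_analysis measurable_realfun.
From mathcomp Require Import ring lra.
Set Implicit Arguments.
Unset Strict Implicit.
Unset Printing Implicit Defensive.
Import Order.TTheory GRing.Theory Num.Theory.
Import numFieldNormedType.Exports.
Local Open Scope classical_set_scope.
Local Open Scope ring_scope.

(** * Quadratic forms and extreme eigenvalues *)

(** Two obstacles shape the development. Around a vertex only conformity and [dom_regular] are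
    available, so connectivity through faces is proved topologically: a generic segment issued from
    an element can leave it only through the relative interior of a face. And [H10] is a closure of
    compactly supported C^1 functions, so the hat functions must be approximated: each is lowered by
    a small amount, cut at 0, then averaged over a short interval in every coordinate direction,
    which yields C^1 functions without a mollifier. All scaling goes through one number [tau >= 1]:
    every element T contains a ball of radius h_T / tau, hence its barycentric coordinates are
    Lipschitz with constant tau / h_T. Elements are never mapped to a reference element, and no
    trace or Poincare inequality occurs: functions of [Vspace] are affine on elements, and the
    corrector sees [mu] only through its face averages. Oscillations are compared with the weight
    h_T^(d-2), the order of the energy of an affine function with unit oscillation on T. *)

Lemma continuous_mul {R : realType} (T : topologicalType) (f g : T -> R) :
  continuous f -> continuous g -> continuous (fun x => f x * g x).
Proof. by move=> cf cg x; exact: (continuousM (cf x) (cg x)). Qed.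

Lemma continuous_add {R : realType} (T : topologicalType) (f g : T -> R) :
  continuous f -> continuous g -> continuous (fun x => f x + g x).
Proof. by move=> cf cg x; exact: (continuousD (cf x) (cg x)). Qed.

Lemma continuous_bigsum {R : realType} (T : topologicalType) (I : Type) (r : seq I)
    (P : pred I) (F : I -> T -> R) :
  (forall i, P i -> continuous (F i)) -> continuous (fun x => \sum_(i <- r | P i) F i x).
Proof. by apply: continuous_big; exact: add_continuous. Qed.

Section bilinear.
Context {R : realType} {V : lmodType R}.
Implicit Types (b : V -> V -> R).

Definition sym_bilinear b :=
  (forall a u v w, b (a *: u + v) w = a * b u w + b v w) /\
  (forall u v, b u v = b v u).

Lemma sym_bilinear0 b w : sym_bilinear b -> b 0 w = 0.
Proof. by move=> [hl _]; have := hl 1 0 0 w; rewrite scale1r addr0 => h; lra. Qed.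

Lemma sym_bilinearZ b a u w : sym_bilinear b -> b (a *: u) w = a * b u w.
Proof. by move=> hb; rewrite -[a *: u]addr0 hb.1 sym_bilinear0// addr0. Qed.

Lemma bilinear_comb2 b (hb : sym_bilinear b) s t u v :
  b (s *: u + t *: v) (s *: u + t *: v) =
  s ^+ 2 * b u u + 2 * s * t * b u v + t ^+ 2 * b v v.
Proof.
have [hl hs] := hb.
have hr w : b (s *: u + t *: v) w = s * b u w + t * b v w.
  by rewrite hl sym_bilinearZ.
by rewrite hr (hs u) (hs v) !hr (hs v u); ring.
Qed.

(** Semidefiniteness must suffice, because the inequality is also used for a form that vanishes at
    an eigenvector. *)
Lemma psd_cauchy_schwarz b u v : sym_bilinear b -> (forall w, 0 <= b w w) ->
  b u v ^+ 2 <= b u u * b v v.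
Proof.
move=> hb hp; have [hl hs] := hb.
have H s t : 0 <= s ^+ 2 * b u u + 2 * s * t * b u v + t ^+ 2 * b v v.
  by rewrite -bilinear_comb2.
have := hp u; rewrite le_eqVlt => /predU1P[u0|u0].
  rewrite -u0 mul0r; have [->|x0] := eqVneq (b u v) 0; first by rewrite expr0n.
  (* With [b u u = 0] the form is affine in s, and this s gives it the value -1. *)
  have := H (- (b v v + 1) / (2 * b u v)) 1; rewrite -u0 mulr0 add0r.
  rewrite (_ : 2 * _ * 1 * _ = - (b v v + 1)); first lra.
  by field.
have := H (- b u v) (b u u).
have -> : (- b u v) ^+ 2 * b u u + 2 * - b u v * b u u * b u v + b u u ^+ 2 * b v v
  = b u u * (b u u * b v v - b u v ^+ 2) by ring.
by rewrite pmulr_rge0// subr_ge0.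
Qed.

Lemma psd_eq0 b u v : sym_bilinear b -> (forall w, 0 <= b w w) -> b u u = 0 ->
  b u v = 0.
Proof.
move=> hb hp u0; have := psd_cauchy_schwarz u v hb hp; rewrite u0 mul0r.
by move=> h; apply/eqP; rewrite -sqrf_eq0 eq_le h sqr_ge0.
Qed.

End bilinear.

Section finite_dimension.
Context {R : realType} {V : lmodType R}.

(** Finite dimension as a property of a bare [lmodType], so that it applies to the function space
    [Mspace] with no basis chosen. *)
Definition rank_le N := forall e : 'I_N.+1 -> V,
  exists2 c : 'I_N.+1 -> R, exists i, c i != 0 & \sum_i c i *: e i = 0.

Definition indep n (e : 'I_n -> V) :=
  forall c : 'I_n -> R, \sum_i c i *: e i = 0 -> forall i, c i = 0.

Lemma rank_le_indep N n (e : 'I_n -> V) : rank_le N -> indep e -> (n <= N)%N.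
Proof.
move=> hN he; rewrite leqNgt; apply/negP => Nn.
have [c [i ci] cE] := hN (fun i => e (widen_ord Nn i)).
pose c' (j : 'I_n) := if insub (j : nat) is Some i then c i else 0.
have c'w j : c' (widen_ord Nn j) = c j.
  by rewrite /c' /=; case: insubP => [k _ kj|]; [congr c; apply: val_inj|rewrite ltn_ord].
move/eqP: ci; rewrite -c'w; apply; apply: he.
rewrite -[RHS]cE; under [RHS]eq_bigr do rewrite -c'w.
rewrite -(big_ord_narrow (F := fun j => c' j *: e j) Nn) [RHS]big_mkcond.
apply: eq_bigr => j _ /=; case: ifPn => // jN.
by rewrite /c' insubF ?(negbTE jN)// scale0r.
Qed.

(** The basis is an independent family of maximal size. Adjoining v gives a nontrivial relation, in
    which the coefficient of v cannot vanish. *)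
Lemma rank_le_basis N : rank_le N -> exists n (e : 'I_n -> V),
  indep e /\ forall v, exists c : 'I_n -> R, v = \sum_i c i *: e i.
Proof.
move=> hN; pose P n := `[< exists e : 'I_n -> V, indep e >].
have exP : exists n, P n by exists 0%N; apply/asboolP; exists (fun=> 0) => c _ [].
have ubP n : P n -> (n <= N)%N by move=> /asboolP[e]; exact: rank_le_indep.
case: (ex_maxnP exP ubP) => n /asboolP[e he] nmax; exists n, e; split=> // v.
pose e' (i : 'I_n.+1) := if unlift ord_max i is Some j then e j else v.
have e'l j : e' (widen_ord (leqnSn n) j) = e j.
  rewrite /e' (_ : widen_ord _ j = lift ord_max j) ?liftK//.
  by apply: val_inj; rewrite /= /bump leqNgt ltn_ord.
have e'm : e' ord_max = v by rewrite /e' unlift_none.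
have : ~ indep e'.
  move=> ie'; have /nmax : P n.+1 by apply/asboolP; exists e'.
  by rewrite ltnn.
move=> /existsNP[c]; rewrite not_implyE => -[cE /existsNP[i /eqP ci]].
move: cE; rewrite big_ord_recr/= e'm.
under eq_bigr do rewrite e'l.
have [cm|cm] := eqVneq (c ord_max) 0.
  rewrite cm scale0r addr0 => /he c0; case/negP: ci.
  case: (unliftP ord_max i) => [j ->|->]; last by rewrite cm.
  have -> : lift ord_max j = widen_ord (leqnSn n) j.
    by apply: val_inj; rewrite /= /bump leqNgt ltn_ord.
  by rewrite c0.
move=> /eqP; rewrite addrC addr_eq0 => /eqP cv.
exists (fun i => - (c ord_max)^-1 * c (widen_ord (leqnSn n) i)).
rewrite -[v]scale1r -(mulVf cm) -scalerA cv scalerN -scaleNr scaler_sumr.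
by apply: eq_bigr => j _; rewrite scalerA.
Qed.

(** The quotient is homogeneous of degree 0, so it is enough to maximise it over the unit sphere of
    the coordinate space, which is compact. *)
Lemma rayleigh_max N (a b : V -> V -> R) : rank_le N ->
  sym_bilinear a -> inner_product b -> (exists v : V, v != 0) ->
  exists2 v, v != 0 & exists l, a v v = l * b v v /\ forall u, a u u <= l * b u u.
Proof.
move=> hN ha [bl bs bp] [v0 v0n0]; have hb : sym_bilinear b by [].
have [n [e [he span]]] := rank_le_basis hN.
pose lin (x : 'rV[R]_n) := \sum_i x 0 i *: e i.
have linZ t x : lin (t *: x) = t *: lin x.
  by rewrite /lin scaler_sumr; apply: eq_bigr => i _; rewrite mxE scalerA.
have lin_sur v : exists x, lin x = v.
  have [c ->] := span v; exists (\row_i c i); apply: eq_bigr => i _.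
  by rewrite mxE.
have form_sum g (hg : sym_bilinear g) x :
    g (lin x) (lin x) = \sum_i \sum_j x 0 i * x 0 j * g (e i) (e j).
  have [gl gs] := hg.
  have gsum w : g (lin x) w = \sum_i x 0 i * g (e i) w.
    rewrite /lin; elim/big_rec2: _ => [|i y z _ <-]; first exact: sym_bilinear0.
    by rewrite gl.
  rewrite gsum; apply: eq_bigr => i _; rewrite gs gsum mulr_sumr.
  by apply: eq_bigr => j _; rewrite gs mulrA.
have form_cont g (hg : sym_bilinear g) : continuous (fun x => g (lin x) (lin x)).
  rewrite (_ : (fun x => _) = fun x : 'rV_n => \sum_i \sum_j x 0 i * x 0 j * g (e i) (e j)).
    apply: continuous_bigsum => i _; apply: continuous_bigsum => j _.
    apply: continuous_mul; last exact: cst_continuous.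
    by apply: continuous_mul; exact: coord_continuous.
  by apply/funext => x; exact: form_sum.
pose S := [set x : 'rV[R]_n | `|x| = 1].
have Sn0 x : lin x != 0 -> S (`|x|^-1 *: x).
  move=> lx; have x0 : `|x| != 0.
    rewrite normr_eq0; apply: contraNneq lx => ->.
    by rewrite -(scale0r (0 : 'rV_n)) linZ scale0r.
  by rewrite /S /= normrZ normfV normr_id mulVf.
have S0 : S !=set0.
  by have [x xv] := lin_sur v0; exists (`|x|^-1 *: x); apply: Sn0; rewrite xv.
have Spos x : S x -> 0 < b (lin x) (lin x).
  move=> Sx; apply: bp; apply: contra_eq_neq Sx => lx0.
  suff -> : x = 0 by rewrite normr0 eq_sym oner_eq0.
  by apply/rowP => i; rewrite mxE; apply: (he (fun i => x 0 i)).
have cS : compact S.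
  apply: bounded_closed_compact.
    by exists 1; split => // M M1 x /= ->; exact: ltW.
  apply: (@closed_comp _ _ (fun x : 'rV[R]_n => `|x|) [set 1]).
    by move=> x _; exact: norm_continuous.
  exact: closed_eq.
pose r x := a (lin x) (lin x) / b (lin x) (lin x).
have cr : {within S, continuous r}.
  apply: continuous_in_subspaceT => x /set_mem Sx.
  have bx0 : b (lin x) (lin x) != 0 by rewrite gt_eqF// Spos.
  exact: (continuousM (form_cont _ ha x) (continuousV bx0 (form_cont _ hb x))).
have [c /set_mem Sc rc] := EVT_max_rV S0 cS cr.
exists (lin c).
  apply: contraTneq (Spos _ Sc) => ->.
  by rewrite sym_bilinear0// ltxx.
exists (r c); split; first by rewrite /r divfK// gt_eqF// Spos.
move=> u; have [->|u0] := eqVneq u 0.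
  by rewrite !sym_bilinear0// mulr0.
have [x xu] := lin_sur u.
have lx : lin x != 0 by rewrite xu.
have := rc _ (mem_set (Sn0 _ lx)); rewrite /r linZ.
have sq g (hg : sym_bilinear g) t w : g (t *: w) (t *: w) = t ^+ 2 * g w w.
  by rewrite sym_bilinearZ// hg.2 sym_bilinearZ// mulrA.
rewrite !sq// xu.
have x0 : `|x| != 0.
  rewrite normr_eq0; apply: contraNneq lx => ->.
  by rewrite -(scale0r (0 : 'rV_n)) linZ scale0r.
rewrite -mulf_div divff ?sqrf_eq0 ?invr_eq0// mul1r.
by rewrite ler_pdivrMr// bp.
Qed.

(** At a maximiser of the Rayleigh quotient with value l, the semidefinite form
    [l * b u w - b (A u) w] vanishes on the diagonal, hence the maximiser lies in its kernel and is
    an eigenvector. The smallest eigenvalue is found in the same way from -A; the sign s in [eigen]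
    treats both cases at once. *)
Lemma self_adjoint_spectrum N (b : V -> V -> R) (A : V -> V) (c0 c1 : R) :
  rank_le N -> inner_product b -> sym_bilinear (fun u v => b (A u) v) ->
  0 < c0 -> (forall u, c0 * b u u <= b (A u) u) -> (forall u, b (A u) u <= c1 * b u u) ->
  (exists v : V, v != 0) ->
  exists lmin lmax, [/\ min_eigenvalue A lmin, max_eigenvalue A lmax, 0 < lmin &
    lmax / lmin <= c1 / c0].
Proof.
move=> hN hb hA c00 Hc0 Hc1 exV; have [bl bs bp] := hb.
have hb' : sym_bilinear b by [].
have [al as_] := hA.
have nondeg w : (forall v, b w v = 0) -> w = 0.
  by move=> h; apply/eqP; apply: contraT => /bp; rewrite h ltxx.
have eigen (s l : R) v : s != 0 -> (forall u, s * b (A u) u <= s * l * b u u) ->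
    s * b (A v) v = s * l * b v v -> A v = l *: v.
  move=> s0 sl sv; pose g u w := s * l * b u w - s * b (A u) w.
  have hg : sym_bilinear g.
    split=> [t u w z|u w]; first by rewrite /g bl al; ring.
    by rewrite /g bs as_.
  have g0 w : 0 <= g w w by rewrite subr_ge0.
  have gv : g v v = 0 by rewrite /g sv subrr.
  apply/eqP; rewrite -subr_eq0; apply/eqP/nondeg => w.
  have h := psd_eq0 w hg g0 gv; rewrite addrC -scaleNr bl; move: h; rewrite /g.
  move=> /eqP; rewrite -mulrA -mulrBr mulf_eq0 (negbTE s0)/= subr_eq0 => /eqP <-; ring.
have [v v0 [l [lv lu]]] := rayleigh_max hN hA hb exV.
have hA' : sym_bilinear (fun u v => - b (A u) v).
  by split=> [t u w z|u w]; [rewrite al; ring|rewrite as_].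
have [v' v'0 [l' [lv' lu']]] := rayleigh_max hN hA' hb exV.
have pv := bp _ v0; have pv' := bp _ v'0.
have eigle m w : w != 0 -> A w = m *: w -> - l' <= m /\ m <= l.
  move=> /bp w0 Aw; have := lu w; have := lu' w; rewrite Aw sym_bilinearZ//.
  by rewrite -mulNr !ler_pM2r// => h1 h2; split => //; lra.
have lmin0 : c0 <= - l'.
  by have h := Hc0 v'; rewrite -(ler_pM2r pv') mulNr -lv' opprK.
exists (- l'), l; split.
- split; last by move=> m [w w0 /(eigle _ _ w0)[]].
  exists v' => //; apply: (eigen (-1)); first by rewrite oppr_eq0 oner_eq0.
  + by move=> u; have := lu' u; lra.
  + lra.
- split; last by move=> m [w w0 /(eigle _ _ w0)[]].
  by exists v => //; apply: (eigen 1); [exact: oner_neq0|move=> u; rewrite !mul1r|rewrite !mul1r].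
- exact: lt_le_trans lmin0.
- have lc1 : l <= c1 by have h := Hc1 v; rewrite -(ler_pM2r pv) -lv.
  have lp : 0 < - l' by exact: lt_le_trans lmin0.
  have c1p : 0 <= c1.
    rewrite -(pmulr_lge0 _ pv) ?(le_trans _ (Hc1 v))// (le_trans _ (Hc0 v))//.
    by rewrite mulr_ge0 ?ltW.
  rewrite ler_pdivrMr// (le_trans lc1)// -mulrA ler_peMr//.
  by rewrite mulrC ler_pdivlMr// mul1r.
Qed.

End finite_dimension.

(** * Lebesgue measure on row vectors *)

Section lebesgue_Rn_theory.
Context {R : realType}.

Lemma lebesgue_tuple_box n (a : 'I_n -> R) (r : R) : 0 < r ->
  lebesgue_tuple n [set t | forall i, ball (a i) r (tnth t i)] = ((2 * r) ^+ n)%:E.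
Proof.
move=> r0; elim: n a => [|n IHn] a.
  rewrite expr0 (_ : [set t | _] = setT); last by apply/seteqP; split=> // t _ [].
  by rewrite /= diracE in_setT.
rewrite /= /lebesgue_cons /pushforward.
set A := (X in (_ \x _)%E X).
have -> : A = ball (a ord0) r `*`
    [set t | forall i, ball (a (lift ord0 i)) r (tnth t i)].
  apply/seteqP; split=> [[x t] /= h|[x t] /= [h0 h] i].
    split; first by have := h ord0; rewrite tnth0.
    by move=> i; have := h (lift ord0 i); rewrite tnthS.
  by case: (unliftP ord0 i) => [j ->|->]; rewrite ?tnth0 ?tnthS.
rewrite product_measure1E.
- rewrite IHn exprS EFinM mulr_natl; congr (_ * _)%E.
  exact: (lebesgue_measure_ball (a ord0) (ltW r0)).
- exact: measurable_ball.
- rewrite (_ : [set t | _] = \bigcap_(i in [set: 'I_n])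
      (@tnth _ _ ^~ i) @^-1` ball (a (lift ord0 i)) r).
    apply: fin_bigcap_measurable => // i _.
    rewrite -[X in measurable X]setTI; apply: measurable_tnth => //.
    exact: measurable_ball.
  by apply/seteqP; split=> t /= h i => [_|]; exact: h.
Qed.

Lemma measurable_open_Rn n (A : set 'rV[R]_n) : open A -> measurable (A : set (borelRn n)).
Proof. exact: sub_sigma_algebra. Qed.

Lemma measurable_closed_Rn n (A : set 'rV[R]_n) : closed A -> measurable (A : set (borelRn n)).
Proof.
move=> cA; rewrite -[A]setCK; apply: measurableC; apply: measurable_open_Rn.
exact: closed_openC.
Qed.

Lemma lebesgueRn_ball n (a : 'rV[R]_n) (r : R) : 0 < r ->
  lebesgueRn (ball a r) = ((2 * r) ^+ n)%:E.
Proof.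
move=> r0; rewrite /lebesgueRn /pushforward -(lebesgue_tuple_box (a 0))//.
congr (lebesgue_tuple n _); apply/seteqP; split=> t /=.
  by move=> [_ h] i; have := h 0 i; rewrite mxE.
by move=> h; split=> // j i; rewrite ord1 mxE; exact: h.
Qed.

Lemma lebesgueRn_bounded n (A : set 'rV[R]_n) (r : R) :
  measurable (A : set (borelRn n)) -> (forall x, A x -> `|x| <= r) ->
  (lebesgueRn A < +oo)%E.
Proof.
move=> mA Ar; have r1 : 0 < `|r| + 1 by rewrite ltr_wpDl.
apply: (@le_lt_trans _ _ (lebesgueRn (ball (0 : 'rV[R]_n) (`|r| + 1)))).
  apply: le_measure; rewrite ?inE//.
    by apply: measurable_open_Rn; exact: ball_open.
  move=> x /Ar xr; rewrite -ball_normE /= sub0r normrN.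
  by rewrite ltr_pwDr// (le_trans xr)// ler_norm.
by rewrite lebesgueRn_ball// ltry.
Qed.

(** Fubini in the first coordinate: if a later coefficient is nonzero, every slice is a hyperplane
    of lower dimension; otherwise the set is a point times the remaining factor. *)
Lemma lebesgue_tuple_hyperplane n (w : 'I_n -> R) (c : R) : (exists i, w i != 0) ->
  lebesgue_tuple n [set t | c + \sum_i w i * tnth t i = 0] = 0%E.
Proof.
have meas m (u : 'I_m -> R) e :
    measurable [set t : m.-tuple (measurableTypeR R) | e + \sum_i u i * tnth t i = 0].
  have mf : measurable_fun setT
      (fun t : m.-tuple (measurableTypeR R) => e + \sum_i u i * tnth t i).
    apply: measurable_funD => //; apply: measurable_sum => i.
    by apply: measurable_funM => //; exact: measurable_tnth.
  rewrite (_ : [set t | _] =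
      (fun t : m.-tuple (measurableTypeR R) => e + \sum_i u i * tnth t i) @^-1` [set 0])//.
  by rewrite -[X in measurable X]setTI; exact: mf.
elim: n w c => [w c [[]//]|n IHn w c w0].
rewrite /= /lebesgue_cons /pushforward.
set A := (X in (_ \x _)%E X).
have AE : A = [set p | (c + w ord0 * p.1) +
    \sum_(i < n) w (lift ord0 i) * tnth p.2 i = 0].
  have E x t : c + \sum_i w i * tnth (consT (x, t)) i =
      c + w ord0 * x + \sum_(i < n) w (lift ord0 i) * tnth t i.
    rewrite big_ord_recl addrA tnth0; congr (_ + _).
    by apply: eq_bigr => i _; rewrite tnthS.
  by apply/seteqP; split=> [[x t]|[x t]]; rewrite /A /preimage /mkset E.
have [w0'|] := pselect (exists i, w (lift ord0 i) != 0).
  rewrite AE /product_measure1 integral0_eq// => x _ /=.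
  rewrite (_ : xsection _ _ = [set t | (c + w ord0 * x) +
    \sum_(i < n) w (lift ord0 i) * tnth t i = 0]); first exact: IHn.
  by apply/seteqP; split=> t; rewrite /xsection /= ?inE.
move=> /forallNP w'0.
have {}w'0 i : w (lift ord0 i) = 0 by apply/eqP/negPn/negP; exact: w'0.
have w00 : w ord0 != 0.
  by case: w0 => i; case: (unliftP ord0 i) => [j ->|-> //]; rewrite w'0 eqxx.
have -> : A = [set - c / w ord0] `*` setT.
  rewrite AE; apply/seteqP; split=> [[x t]|[x t]] /=;
    (rewrite big1 ?addr0; last by move=> i _; rewrite w'0 mul0r).
  - move=> h; split=> //; apply: (mulIf w00); rewrite divfK//.
    by apply/eqP; rewrite -subr_eq0 opprK mulrC addrC h.
  - by move=> [-> _]; rewrite mulrC divfK// subrr.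
rewrite product_measure1E// [X in (X * _)%E](_ : _ = 0%E) ?mul0e//.
exact: lebesgue_measure_set1.
Qed.

Lemma lebesgueRn_hyperplane n (w : 'I_n -> R) (c : R) : (exists i, w i != 0) ->
  lebesgueRn [set x : 'rV[R]_n | c + \sum_i w i * x 0 i = 0] = 0%E.
Proof.
move=> w0; rewrite /lebesgueRn /pushforward -(lebesgue_tuple_hyperplane c w0).
congr (lebesgue_tuple n _); apply/seteqP.
split=> t /= h; rewrite -[RHS]h; congr (_ + _);
  by apply: eq_bigr => i _; rewrite /row_of_tuple mxE.
Qed.

Lemma continuous_bounded_integrable n (A : set 'rV[R]_n) (f : 'rV[R]_n -> R) :
  compact A -> continuous f -> (lebesgueRn (n := n)).-integrable A (EFin \o f).
Proof.
move=> cA cf.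
have mA : measurable (A : set (borelRn n)).
  by apply: measurable_closed_Rn; apply: compact_closed => //; exact: norm_hausdorff.
have [M [_ MA]] := compact_bounded cA.
have [N [_ NA]] := compact_bounded (continuous_compact (continuous_subspaceT cf) cA).
apply: measurable_bounded_integrable => //.
- apply: (lebesgueRn_bounded (r := `|M| + 1)) => // x Ax; apply: MA => //.
  by rewrite ltr_pwDr// ler_norm.
- by apply: measurable_funTS; exact: continuous_measurable_Rn.
- exists N; split; first by rewrite num_real.
  by move=> y Ny x Ax; apply: NA => //; exists x.
Qed.

End lebesgue_Rn_theory.

(** * Affine functions and integrals over simplices *)

Lemma le_of_sqr {R : realDomainType} (x y : R) : 0 <= y -> x ^+ 2 <= y ^+ 2 -> x <= y.
Proof. by move=> y0 h; rewrite leNgt; apply/negP => xy; nra. Qed.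

Section euclidean.
Context {R : realType} {d : nat}.
Implicit Types x y w : 'rV[R]_d.

Lemma enorm_ge0 x : 0 <= enorm x.
Proof. exact: sqrtr_ge0. Qed.

Lemma sqr_enorm x : enorm x ^+ 2 = \sum_i x 0 i ^+ 2.
Proof. by rewrite sqr_sqrtr// sumr_ge0// => i _; exact: sqr_ge0. Qed.

Lemma enormZ (t : R) x : enorm (t *: x) = `|t| * enorm x.
Proof.
apply/eqP; rewrite -(@eqrXn2 _ 2) ?mulr_ge0 ?enorm_ge0//.
rewrite exprMn !sqr_enorm mulr_sumr real_normK ?num_real//; apply/eqP.
by apply: eq_bigr => i _; rewrite mxE exprMn.
Qed.

Lemma enormN x : enorm (- x) = enorm x.
Proof. by rewrite -scaleN1r enormZ normrN1 mul1r. Qed.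

Lemma enormB x y : enorm (x - y) = enorm (y - x).
Proof. by rewrite -enormN opprB. Qed.

Lemma coord_le_enorm x i : `|x 0 i| <= enorm x.
Proof.
apply: le_of_sqr; rewrite ?enorm_ge0// sqr_enorm real_normK ?num_real//.
by rewrite (bigD1 i)//= lerDl sumr_ge0// => j _; exact: sqr_ge0.
Qed.

Lemma enorm_eq0 x : enorm x = 0 -> x = 0.
Proof.
move=> x0; apply/rowP => i; rewrite mxE; apply/eqP; rewrite -normr_le0 -x0.
exact: coord_le_enorm.
Qed.

Lemma enorm_le x (r : R) : (forall i, `|x 0 i| <= r) -> 0 <= r -> enorm x <= d%:R * r.
Proof.
move=> xr r0; apply: le_of_sqr; rewrite ?mulr_ge0// sqr_enorm.
apply: (@le_trans _ _ (\sum_(i < d) r ^+ 2)).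
  apply: ler_sum => i _; rewrite -real_normK ?num_real//.
  by rewrite lerXn2r ?nnegrE.
rewrite sumr_const card_ord exprMn -[X in X <= _]mulr_natl ler_wpM2r ?sqr_ge0//.
by rewrite -natrX ler_nat; case: (posnP d) => [->//|d0]; exact: leq_pmull.
Qed.

Lemma dot_le_enorm w x : `|\sum_i w 0 i * x 0 i| <= enorm w * enorm x.
Proof.
have hb : sym_bilinear (fun u v : 'rV[R]_d => \sum_i u 0 i * v 0 i).
  split=> [a u v z|u v]; last by apply: eq_bigr => i _; rewrite mulrC.
  rewrite mulr_sumr -big_split; apply: eq_bigr => i _; rewrite !mxE /=; ring.
have := psd_cauchy_schwarz w x hb (fun u => sumr_ge0 _ (fun i _ => sqr_ge0 (u 0 i))).
rewrite -[X in _ <= X * _]sqr_enorm -[X in _ <= _ * X]sqr_enorm -exprMn => h.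
by apply: le_of_sqr; rewrite ?mulr_ge0 ?enorm_ge0// real_normK ?num_real.
Qed.

End euclidean.

Section affine_functions.
Context {R : realType} {d : nat}.

Definition affine (f : 'rV[R]_d -> R) :=
  exists c (w : 'I_d -> R), forall x, f x = c + \sum_i w i * x 0 i.

Lemma affine_comb f x y (t : R) : affine f ->
  f (x + t *: (y - x)) = f x + t * (f y - f x).
Proof.
move=> [c [w fE]]; rewrite !fE opprD addrACA subrr add0r -sumrB mulr_sumr.
rewrite -addrA -big_split; congr (_ + _); apply: eq_bigr => i _; rewrite !mxE /=.
by rewrite -mulrBr mulrDr mulrCA.
Qed.

Lemma affine_sum (I : finType) (P : pred I) (a : I -> R) (p : I -> 'rV[R]_d) f :
  affine f -> \sum_(i | P i) a i = 1 ->
  f (\sum_(i | P i) a i *: p i) = \sum_(i | P i) a i * f (p i).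
Proof.
move=> [c [w fE]] a1; rewrite fE; under [RHS]eq_bigr do rewrite fE mulrDr.
rewrite big_split -mulr_suml a1 mul1r; congr (_ + _).
under [RHS]eq_bigr do rewrite mulr_sumr.
rewrite exchange_big; apply: eq_bigr => j _; rewrite summxE mulr_sumr.
by apply: eq_bigr => i _; rewrite mxE mulrCA.
Qed.

Lemma affine_cst c : affine (fun=> c).
Proof. by exists c, (fun=> 0) => x; rewrite big1 ?addr0// => i _; rewrite mul0r. Qed.

Lemma affine_lin a f g : affine f -> affine g -> affine (fun x => a * f x + g x).
Proof.
move=> [c [w fE]] [c' [w' gE]]; exists (a * c + c'), (fun i => a * w i + w' i) => x.
rewrite fE gE mulrDr addrACA; congr (_ + _); rewrite mulr_sumr -big_split.
by apply: eq_bigr => i _; rewrite mulrDl mulrA.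
Qed.

Lemma affine_bigsum (I : Type) (r : seq I) (P : pred I) (a : I -> R) (f : I -> 'rV[R]_d -> R) :
  (forall i, P i -> affine (f i)) -> affine (fun x => \sum_(i <- r | P i) a i * f i x).
Proof.
move=> af; elim: r => [|i r IHr].
  by rewrite (_ : (fun x => _) = fun=> 0); [exact: affine_cst|apply/funext => x; rewrite big_nil].
have [Pi|Pi] := boolP (P i).
  rewrite (_ : (fun x => _) = fun x => a i * f i x + \sum_(i <- r | P i) a i * f i x).
    by apply: affine_lin => //; exact: af.
  by apply/funext => x; rewrite big_cons Pi.
by rewrite (_ : (fun x => _) = fun x => \sum_(i <- r | P i) a i * f i x)//;
  apply/funext => x; rewrite big_cons (negbTE Pi).
Qed.

Lemma affine_continuous f : affine f -> continuous f.
Proof.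
move=> [c [w fE]]; rewrite (funext fE); apply: continuous_add.
  exact: cst_continuous.
apply: continuous_bigsum => i _; apply: continuous_mul; first exact: cst_continuous.
exact: coord_continuous.
Qed.

(** In a monomial of total degree at most 1 at most one exponent is 1, so it is either constant or a
    coordinate. *)
Lemma polyfun_affine f : polyfun 1 f <-> affine f.
Proof.
split=> [[c fE]|[c [w fE]]].
  have -> : f = fun x => \sum_(a : {ffun 'I_d -> 'I_2} | (\sum_i a i <= 1)%N)
      c a * \prod_i x 0 i ^+ a i by exact/funext.
  apply: affine_bigsum => a a1.
  have [a0|/forallPn[j aj]] := boolP [forall i, a i == ord0].
    rewrite (_ : (fun x => _) = fun=> 1); first exact: affine_cst.
    by apply/funext => x; rewrite big1// => i _; rewrite (eqP (forallP a0 i)).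
  exists 0, (fun i => (i == j)%:R) => x; rewrite add0r.
  rewrite (bigD1 j)//= [RHS](bigD1 j)//= eqxx mul1r [X in _ = _ + X]big1 ?addr0; last first.
    by move=> i /negbTE ->; rewrite mul0r.
  move: a1; rewrite (bigD1 j)//=.
  case: (a j) aj => [[|[|//]] //= _ _]; rewrite expr1 addSn ltnS add0n leqn0.
  rewrite sum_nat_eq0 => /forallP a0; rewrite big1 ?mulr1// => i ij.
  by have := a0 i; rewrite ij => /eqP ->.
have pc : polyfun 1 (fun=> c : R) (d := d).
  exists (fun a => c *+ (a == [ffun=> ord0])) => x.
  rewrite (bigD1 [ffun=> ord0])/=; last by rewrite big1// => i _; rewrite ffunE.
  rewrite eqxx big1 ?mulr1; last by move=> i _; rewrite ffunE.
  by rewrite big1 ?addr0// => a /andP[_ /negbTE->]; rewrite mul0r.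
have px i : polyfun 1 (fun x : 'rV[R]_d => x 0 i).
  pose e : {ffun 'I_d -> 'I_2} := [ffun j => if j == i then ord_max else ord0].
  exists (fun a => (a == e)%:R) => x; rewrite (bigD1 e)/=; last first.
    by rewrite (bigD1 i)//= ffunE eqxx big1// => j /negbTE ji; rewrite ffunE ji.
  rewrite eqxx mul1r (bigD1 i)//= ffunE eqxx expr1 !big1 ?mulr1 ?addr0//.
    by move=> a /andP[_ /negbTE->]; rewrite mul0r.
  by move=> j /negbTE ji; rewrite ffunE ji.
have -> : f = fun x => \sum_i w i * x 0 i + c by apply/funext => x; rewrite fE addrC.
elim: (index_enum 'I_d) => [|i r IHr].
  by under eq_fun do rewrite big_nil add0r.
by under eq_fun do rewrite big_cons -addrA; exact: polyfun_lin.
Qed.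

End affine_functions.

Lemma polyfun_continuous {R : realType} d k (f : 'rV[R]_d -> R) : polyfun k f -> continuous f.
Proof.
move=> [c fE]; rewrite (funext fE); apply: continuous_bigsum => a _.
apply: continuous_mul; first exact: cst_continuous.
apply: continuous_big => [|i _]; first exact: mul_continuous.
elim: (nat_of_ord (a i)) => [|n IHn].
  by under eq_fun do rewrite expr0; exact: cst_continuous.
under eq_fun do rewrite exprS.
by apply: continuous_mul => //; exact: coord_continuous.
Qed.

Lemma polyfun_cst {R : realType} d k (c : R) : polyfun k (fun=> c) (d := d).
Proof.
exists (fun a => c *+ (a == [ffun=> ord0])) => x.
rewrite (bigD1 [ffun=> ord0])/=; last by rewrite big1// => i _; rewrite ffunE.
rewrite eqxx big1 ?mulr1; last by move=> i _; rewrite ffunE.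
by rewrite big1 ?addr0// => a /andP[_ /negbTE->]; rewrite mul0r.
Qed.

Lemma continuous_row {R : realType} (T : topologicalType) n (f : T -> 'rV[R]_n) :
  (forall j, continuous (fun x => f x 0 j)) -> continuous f.
Proof.
move=> cf x; apply/cvg_ballP => e e0.
have : \forall y \near x, forall j, ball (f x 0 j) e (f y 0 j).
  apply: filter_forall => j; have /cvg_ballP := cf j x; exact.
by apply: filterS => y h; split=> // i j; rewrite ord1; exact: h.
Qed.

Section simplex_integral.
Context {R : realType}.

Lemma compact_refsimplex m : compact (@refsimplex R m).
Proof.
apply: bounded_closed_compact.
  exists 1; split; first exact: num_real.
  move=> M M1 t [t0 t1]; apply: le_trans (ltW M1).
  rewrite [X in X <= _]mx_normrE; apply: bigmax_le => // -[i j] _ /=.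
  rewrite ord1 ger0_norm// (le_trans _ t1)// (bigD1 j)//= lerDl.
  by apply: sumr_ge0.
rewrite (_ : @refsimplex R m = (\bigcap_(j in [set: 'I_m])
    ((fun t : 'rV[R]_m => t 0 j) @^-1` [set x | 0 <= x])) `&`
    (fun t : 'rV[R]_m => \sum_j t 0 j) @^-1` [set x | x <= 1]).
  apply: closedI.
    apply: closed_bigI => j _; apply: closed_comp; last exact: closed_ge.
    by move=> x _; exact: coord_continuous.
  apply: closed_comp; last exact: closed_le.
  by move=> x _; apply: continuous_bigsum => j _; exact: coord_continuous.
apply/seteqP; split=> [t [t0 t1]|t [t0 t1]]; split=> // j.
  by move=> _; exact: t0.
exact: (t0 j I).
Qed.

Lemma measurable_refsimplex m : measurable (@refsimplex R m : set (borelRn m)).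
Proof.
apply: measurable_closed_Rn; apply: compact_closed; first exact: norm_hausdorff.
exact: compact_refsimplex.
Qed.

Definition refvol m : R := fine (lebesgueRn (@refsimplex R m)).

Lemma refvol_gt0 m : 0 < refvol m.
Proof.
have b0 : 0 < (2 * m.+1%:R)^-1 :> R by rewrite invr_gt0 mulr_gt0.
have [M [_ MA]] := compact_bounded (@compact_refsimplex m).
have fin : (lebesgueRn (@refsimplex R m) < +oo)%E.
  apply: (lebesgueRn_bounded (r := `|M| + 1)); first exact: measurable_refsimplex.
  by move=> x Ax; apply: MA => //; rewrite ltr_pwDr// ler_norm.
apply: fine_gt0; rewrite fin andbT.
(* Balls are taken in the sup norm: this one is the cube with sides from 0 to 1/(m+1), contained in
   the reference simplex. *)
apply: (@lt_le_trans _ _ (lebesgueRn (ball (const_mx (2 * m.+1%:R)^-1 : 'rV[R]_m) (2 * m.+1%:R)^-1))).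
  by rewrite lebesgueRn_ball// lte_fin exprn_gt0// mulr_gt0.
apply: le_measure; rewrite ?inE; first by apply: measurable_open_Rn; exact: ball_open.
  exact: measurable_refsimplex.
move=> t [_ h].
have {}h j : 0 <= t 0 j <= m.+1%:R^-1.
  have := h 0 j; rewrite /ball/= mxE ltr_norml => /andP[h1 h2].
  have -> : m.+1%:R^-1 = 2 * (2 * m.+1%:R)^-1 :> R by field.
  move: (2 * _)^-1 b0 h1 h2 => q b0 h1 h2.
  by apply/andP; split; lra.
split=> [j|]; first by have /andP[] := h j.
apply: (@le_trans _ _ (\sum_(j < m) m.+1%:R^-1)).
  by apply: ler_sum => j _; have /andP[] := h j.
rewrite sumr_const card_ord -[X in X <= _]mulr_natl ler_pdivrMr// mul1r ler_nat.
exact: leqnSn.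
Qed.

Variables (d n : nat) (p : 'I_n -> 'rV[R]_d) (m : nat) (F : {set 'I_n}).
Hypothesis cardF : #|F| = m.+1.
Let s := [seq p v | v <- enum F].
Let E := \matrix_(j < m) (s`_j.+1 - s`_0).
Definition gram := Num.sqrt (\det (E *m E^T)).

Lemma simplex_int_param_hull t : refsimplex t -> hull p F (s`_0 + t *m E).
Proof.
move=> [t0 t1]; have szF : size (enum F) = m.+1 by rewrite -cardE.
(* The first enumerated vertex has weight 1 - sum t and the vertex of index j+1 has weight t_j.
   Since j is a plain natural number, t_j is written as a sum that is 0 when j is out of range. *)
pose a (v : 'I_n) := let i := index v (enum F) in
  if i is j.+1 then \sum_(l < m) (if l == j :> nat then t 0 l else 0)
  else 1 - \sum_j t 0 j.
have nz (v0 : 'I_n) G : \sum_(v in F) G v = \sum_(i < m.+1) G (nth v0 (enum F) i) :> 'rV[R]_d.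
  by rewrite -big_enum (big_nth v0) big_mkord szF.
have nzR (v0 : 'I_n) G : \sum_(v in F) G v = \sum_(i < m.+1) G (nth v0 (enum F) i) :> R.
  by rewrite -big_enum (big_nth v0) big_mkord szF.
have [v0 v0F] : exists v0, v0 \in F by apply/set0Pn; rewrite -card_gt0 cardF.
have a0 : a (nth v0 (enum F) 0) = 1 - \sum_j t 0 j by rewrite /a index_uniq ?szF ?enum_uniq.
have aS (j : 'I_m) : a (nth v0 (enum F) j.+1) = t 0 j.
  rewrite /a index_uniq ?szF ?enum_uniq ?ltnS//.
  rewrite (bigD1 j)//= eqxx big1 ?addr0// => l lj.
  by rewrite -[nat_of_ord l == _]/(l == j) (negbTE lj).
exists a; split.
- move=> v; rewrite /a; case: index => [|j]; first by rewrite subr_ge0.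
  by apply: sumr_ge0 => l _; case: ifP.
- rewrite (nzR v0) big_ord_recl a0; under [X in _ + X]eq_bigr do rewrite lift0 aS.
  by rewrite subrK.
- rewrite (nz v0) big_ord_recl a0.
  under [X in _ = _ + X]eq_bigr do rewrite lift0 aS.
  have sE i : (i < m.+1)%N -> s`_i = p (nth v0 (enum F) i).
    by move=> im; rewrite /s (nth_map v0) ?szF.
  rewrite -sE// scalerBl scale1r -addrA; congr (_ + _).
  rewrite scaler_suml addrC -sumrB; apply/rowP => i; rewrite !mxE summxE.
  apply: eq_bigr => j _; rewrite -sE ?ltnS//.
  by rewrite !mxE mulrBr.
Qed.

(** Members of [Mspace] are extended by 0 off each face, so they are not continuous on the whole
    space; integrals over the face only see a continuous representative there. *)
Definition hull_continuous (f : 'rV[R]_d -> R) :=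
  exists2 g : 'rV[R]_d -> R, continuous g & forall x, hull p F x -> f x = g x.

Let param_continuous : continuous (fun t : 'rV[R]_m => s`_0 + t *m E).
Proof.
apply: continuous_row => j.
rewrite (_ : (fun t => _) = fun t : 'rV[R]_m => s`_0 0 j + \sum_i t 0 i * E i j).
  apply: continuous_add; first exact: cst_continuous.
  apply: continuous_bigsum => i _; apply: continuous_mul; last exact: cst_continuous.
  exact: coord_continuous.
by apply/funext => t; rewrite !mxE.
Qed.

Let hull_continuous_integrable f : hull_continuous f ->
  (lebesgueRn (n := m)).-integrable (@refsimplex R m) (EFin \o (fun t => f (s`_0 + t *m E))).
Proof.
move=> [g cg fg].
apply: (@eq_integrable _ (borelRn m) R lebesgueRn (@refsimplex R m)
    (@measurable_refsimplex m) (EFin \o (fun t : 'rV[R]_m => g (s`_0 + t *m E)))).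
  by move=> t /set_mem tm; rewrite /= fg//; exact: simplex_int_param_hull.
apply: continuous_bounded_integrable; first exact: compact_refsimplex.
by move=> t; apply: continuous_comp; [exact: param_continuous|exact: cg].
Qed.

Lemma eq_simplex_int f g : (forall x, hull p F x -> f x = g x) ->
  simplex_int m s f = simplex_int m s g.
Proof.
move=> fg; rewrite /simplex_int; congr (_ * _); apply: eq_Rintegral => t /set_mem tm.
by apply: fg; exact: simplex_int_param_hull.
Qed.

Lemma simplex_int_lin a f g : hull_continuous f -> hull_continuous g ->
  simplex_int m s (fun x => a * f x + g x) = a * simplex_int m s f + simplex_int m s g.
Proof.
move=> cf cg; rewrite /simplex_int mulrCA -mulrDr; congr (_ * _).
rewrite RintegralD//.
- by rewrite RintegralZl//; [exact: measurable_refsimplex|exact: hull_continuous_integrable].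
- exact: measurable_refsimplex.
- exact: (@integrableZl _ (borelRn m) R lebesgueRn (@refsimplex R m)
    (@measurable_refsimplex m) a _ (hull_continuous_integrable cf)).
- exact: hull_continuous_integrable.
Qed.

Lemma le_simplex_int f g : hull_continuous f -> hull_continuous g -> (forall x, hull p F x -> f x <= g x) ->
  simplex_int m s f <= simplex_int m s g.
Proof.
move=> cf cg fg; rewrite /simplex_int ler_wpM2l ?sqrtr_ge0//.
apply: le_Rintegral; [exact: measurable_refsimplex|exact: hull_continuous_integrable..|].
by move=> t tm; apply: fg; exact: simplex_int_param_hull.
Qed.

Lemma simplex_int_cst c : simplex_int m s (fun=> c) = c * (gram * refvol m).
Proof.
rewrite /simplex_int Rintegral_cst; last exact: measurable_refsimplex.
by rewrite mulrCA.
Qed.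

Lemma hull_continuous_lin a f g : hull_continuous f -> hull_continuous g -> hull_continuous (fun x => a * f x + g x).
Proof.
move=> [f' cf ff'] [g' cg gg']; exists (fun x => a * f' x + g' x).
  exact: continuous_lin.
by move=> x Fx; rewrite ff'// gg'.
Qed.

Lemma hull_continuous_mul f g : hull_continuous f -> hull_continuous g -> hull_continuous (fun x => f x * g x).
Proof.
move=> [f' cf ff'] [g' cg gg']; exists (fun x => f' x * g' x).
  exact: continuous_mul.
by move=> x Fx; rewrite ff'// gg'.
Qed.

Lemma hull_continuous_cst c : hull_continuous (fun=> c).
Proof. by exists (fun=> c) => // x; exact: cst_continuous. Qed.

Lemma hull_continuous_poly k f q : polyfun k q -> (forall x, hull p F x -> f x = q x) -> hull_continuous f.
Proof. by move=> qk fq; exists q => //; exact: polyfun_continuous qk. Qed.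

End simplex_integral.

Section gram_bounds.
Context {R : realType} {d n : nat} (p : 'I_n -> 'rV[R]_d) (F : {set 'I_n}).

(* The edge vectors are bounded below through the functions [lam v], which play
   the role of barycentric coordinates with Lipschitz constant [l^-1]. *)
Lemma gram_bounds m (lam : 'I_n -> 'rV[R]_d -> R) (h l : R) :
  m = 1%N \/ m = 2%N -> #|F| = m.+1 -> 0 < l ->
  (forall u v, u \in F -> v \in F -> enorm (p u - p v) <= h) ->
  (forall v, v \in F -> affine (lam v)) ->
  (forall u v, u \in F -> v \in F -> lam v (p u) = (u == v)%:R) ->
  (forall v x y, v \in F -> lam v x - lam v y <= l^-1 * enorm (x - y)) ->
  l ^+ m <= gram p m F <= h ^+ m.
Proof.
move=> m12 cF l0 hF affl lamE lamL.
have szF : size (enum F) = m.+1 by rewrite -cardE.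
have [v0 v0F] : exists v0, v0 \in F by apply/set0Pn; rewrite -card_gt0 cF.
pose s := [seq p v | v <- enum F].
pose q i := nth v0 (enum F) i.
have sE i : (i < m.+1)%N -> s`_i = p (q i).
  by move=> im; rewrite /s (nth_map v0) ?szF.
have qF i : (i < m.+1)%N -> q i \in F.
  by move=> im; rewrite -mem_enum mem_nth ?szF.
have qE i j : (i < m.+1)%N -> (j < m.+1)%N -> (q i == q j) = (i == j).
  by move=> im jm; rewrite nth_uniq ?szF ?enum_uniq.
have lq i j : (i < m.+1)%N -> (j < m.+1)%N -> lam (q j) (p (q i)) = (i == j)%:R.
  by move=> im jm; rewrite lamE ?qF// qE.
pose e i : 'rV[R]_d := p (q i.+1) - p (q 0).
have eh i : (i < m)%N -> enorm (e i) <= h by move=> im; apply: hF; exact: qF.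
have EE i j : (\matrix_(j < m) (s`_j.+1 - s`_0) *m (\matrix_(j < m) (s`_j.+1 - s`_0))^T) i j =
    \sum_k e i 0 k * e j 0 k.
  by rewrite mxE; apply: eq_bigr => k _; rewrite !mxE !sE ?ltnS.
have h0 : 0 <= h.
  by have := hF _ _ v0F v0F; apply: le_trans; exact: enorm_ge0.
have sq (x : 'rV[R]_d) : \sum_k x 0 k * x 0 k = enorm x ^+ 2 :> R.
  by rewrite sqr_enorm; apply: eq_bigr => k _; rewrite expr2.
(* A displacement from the first vertex along which the coordinate of another vertex rises from 0 to
   1 has length at least l. *)
have le_l j x : (0 < j < m.+1)%N -> lam (q j) (p (q 0) + x) = 1 -> l <= enorm x.
  move=> /andP[j0 jm] lx; have := lamL (q j) (p (q 0) + x) (p (q 0)) (qF _ jm).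
  rewrite lx lq// addrAC subrr add0r eq_sym gtn_eqF//= subr0.
  by rewrite mulrC ler_pdivlMr// mul1r.
rewrite /gram -/s.
case: m12 => m1; subst m.
  rewrite det_mx11 EE sq sqrtr_sqr ger0_norm ?enorm_ge0// !expr1.
  rewrite (le_l 1%N)//=; last by rewrite /e addrC subrK lq.
  exact: eh.
have det2 (A : 'M[R]_2) : \det A = A 0 0 * A 1 1 - A 0 1 * A 1 0.
  rewrite (expand_det_row _ 0) !big_ord_recl big_ord0 addr0 /cofactor !det_mx11 !mxE /=.
  rewrite expr0 expr1 mul1r mulN1r mulrN; congr (_ * _ - _ * _); congr (A _ _);
    exact: val_inj.
rewrite det2 !EE /= !sq; set a := e 0%N; set b := e 1%N.
have la : l <= enorm a by rewrite (le_l 1%N)//= /a/e addrC subrK lq.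
have lb : l <= enorm b by rewrite (le_l 2%N)//= /b/e addrC subrK lq.
have -> : \sum_k b 0 k * a 0 k = \sum_k a 0 k * b 0 k.
  by apply: eq_bigr => k _; rewrite mulrC.
set ab := \sum_k _.
have b0 : enorm b != 0 by rewrite gt_eqF// (lt_le_trans l0).
(* [t *: b] is the orthogonal projection of a onto b, so the Gram determinant is the square of base
   times height. The height is at least l because the coordinate of the first endpoint still equals
   1 after moving by [a - t *: b]. *)
pose t := ab / enorm b ^+ 2.
have key : enorm a ^+ 2 * enorm b ^+ 2 - ab * ab = enorm b ^+ 2 * enorm (a - t *: b) ^+ 2.
  rewrite (sqr_enorm (a - t *: b)).
  have -> : \sum_i (a - t *: b) 0 i ^+ 2 = enorm a ^+ 2 - 2 * t * ab + t ^+ 2 * enorm b ^+ 2.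
    rewrite !sqr_enorm /ab !mulr_sumr -sumrB -big_split; apply: eq_bigr => k _.
    rewrite !mxE /=; ring.
  rewrite /t; field.
  by rewrite b0.
have lt : l <= enorm (a - t *: b).
  apply: (le_l 1%N) => //=; have [c [w lE]] := affl _ (qF 1%N isT).
  have lin u v : lam (q 1%N) (u + v) = lam (q 1%N) u + \sum_i w i * v 0 i.
    by rewrite !lE -addrA -big_split; congr (_ + _); apply: eq_bigr => k _; rewrite mxE mulrDr.
  have := lq 1%N 1%N isT isT; have := lq 2%N 1%N isT isT; have := lq 0%N 1%N isT isT.
  have -> : p (q 1%N) = p (q 0%N) + a by rewrite /a /e addrC subrK.
  have -> : p (q 2%N) = p (q 0%N) + b by rewrite /b /e addrC subrK.
  rewrite !lin /= => -> ; rewrite !add0r => hb ha.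
  rewrite (_ : \sum_i _ = \sum_i w i * a 0 i - t * \sum_i w i * b 0 i).
    by rewrite hb ha mulr0 subr0.
  by rewrite mulr_sumr -sumrB; apply: eq_bigr => k _; rewrite !mxE; ring.
apply/andP; split.
  rewrite -[l ^+ 2]ger0_norm ?sqr_ge0// -sqrtr_sqr ler_wsqrtr// key exprMn -expr2 exprMn.
  rewrite ler_pM ?sqr_ge0// ler_pXn2r ?nnegrE ?enorm_ge0 ?(ltW l0)//.
rewrite -[h ^+ 2]ger0_norm ?sqr_ge0// -sqrtr_sqr ler_wsqrtr//.
apply: (@le_trans _ _ (enorm a ^+ 2 * enorm b ^+ 2)).
  by rewrite gerBl -expr2 sqr_ge0.
by rewrite [leRHS]expr2 ler_pM ?sqr_ge0// ler_pXn2r ?nnegrE ?enorm_ge0 ?eh.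
Qed.

End gram_bounds.

(** * Barycentric coordinates *)

Lemma near_gt {R : realType} (T : topologicalType) (f : T -> R) (x : T) c :
  continuous f -> c < f x -> \forall y \near x, c < f y.
Proof. by move=> cf cx; exact: (cvgr_gt (f x) (cf x) _ cx). Qed.

Lemma near_forall (T : topologicalType) (I : finType) (P : I -> T -> Prop) (x : T) :
  (forall i, \forall y \near x, P i y) -> \forall y \near x, forall i, P i y.
Proof. exact: filter_forall. Qed.

Lemma near_always (T : topologicalType) (P : T -> Prop) (x : T) :
  (forall y, P y) -> \forall y \near x, P y.
Proof. by move=> h; apply: nearW. Qed.

Lemma near_and (T : topologicalType) (P Q : T -> Prop) (x : T) :
  (\forall y \near x, P y) -> (\forall y \near x, Q y) -> \forall y \near x, P y /\ Q y.
Proof. by move=> hP hQ; near=> y; split; near: y. Unshelve. all: by end_near. Qed.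

Lemma near_ballP {R : realType} (V : normedModType R) (P : V -> Prop) (x : V) :
  (\forall y \near x, P y) <-> exists2 e, 0 < e & forall y, `|y - x| < e -> P y.
Proof.
split=> [/nbhs_ballP[e /= e0 h]|[e e0 h]].
  by exists e => // y yx; apply: h; rewrite -ball_normE /= distrC.
by apply/nbhs_ballP; exists e => // y; rewrite -ball_normE /= distrC => /h.
Qed.

Section barycentric.
Context {R : realType} {d n : nat} (p : 'I_n -> 'rV[R]_d) (T : {set 'I_n}).

(** Rows are (1, p_j), so barycentric coordinates of x are the solution c of
    [c *m bary_mx = (1, x)]. Affine independence of d+1 vertices makes this matrix invertible; a
    pseudo-inverse is used since [#|T|] equals d+1 only propositionally. *)
Definition bary_mx : 'M[R]_(#|T|, 1 + d) :=
  row_mx (const_mx 1) (\matrix_(j < #|T|) p (enum_val j)).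

(** The sum selects the component belonging to v and gives 0 for v outside T, so coordinates are
    defined for all vertices of the mesh and stay affine even before nondegeneracy is known. *)
Definition bary (v : 'I_n) (x : 'rV[R]_d) : R :=
  \sum_(j < #|T|) (enum_val j == v)%:R * (row_mx (const_mx 1) x *m pinvmx bary_mx) 0 j.

Lemma bary_out v x : v \notin T -> bary v x = 0.
Proof.
move=> vT; rewrite /bary big1// => j _; case: eqP => [jv|]; last by rewrite mul0r.
by rewrite -jv enum_valP in vT.
Qed.

Lemma bary_affine v : affine (bary v).
Proof.
apply: affine_bigsum => j _.
exists (usubmx (pinvmx bary_mx) 0 j), (fun i => dsubmx (pinvmx bary_mx) i j) => x.
rewrite -{1}[pinvmx bary_mx]vsubmxK mul_row_col mxE; congr (_ + _).
  by rewrite mxE big_ord1 mxE mul1r.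
by rewrite mxE; apply: eq_bigr => i _; rewrite mulrC.
Qed.

Lemma bary_continuous v : continuous (bary v).
Proof. exact/affine_continuous/bary_affine. Qed.

Hypotheses (cardT : #|T| = d.+1) (indT : affinely_independent p T).

Let bary_enum j x : bary (enum_val j) x = (row_mx (const_mx 1) x *m pinvmx bary_mx) 0 j.
Proof.
rewrite /bary (bigD1 j)//= eqxx mul1r big1 ?addr0// => i ij.
case: eqP => [/enum_val_inj ji|_]; last by rewrite mul0r.
by rewrite ji eqxx in ij.
Qed.

Let bary_mx_comb (c : 'rV[R]_#|T|) :
  c *m bary_mx = row_mx (const_mx (\sum_j c 0 j)) (\sum_j c 0 j *: p (enum_val j)).
Proof.
rewrite mul_mx_row; congr row_mx; apply/rowP => i; rewrite !mxE.
  by apply: eq_bigr => j _; rewrite mxE mulr1.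
by rewrite summxE; apply: eq_bigr => j _; rewrite !mxE.
Qed.

Let bary_mx_full : row_full bary_mx.
Proof.
have : row_free bary_mx.
  apply: inj_row_free => c; rewrite bary_mx_comb => /eqP; rewrite row_mx_eq0.
  move=> /andP[/eqP/rowP/(_ 0)]; rewrite !mxE => c0 /eqP cp.
  pose a v := \sum_(j < #|T|) (enum_val j == v)%:R * c 0 j.
  have aE j : a (enum_val j) = c 0 j.
    rewrite /a (bigD1 j)//= eqxx mul1r big1 ?addr0// => i ij.
    case: eqP => [/enum_val_inj ji|_]; last by rewrite mul0r.
by rewrite ji eqxx in ij.
  apply/rowP => j; rewrite mxE -aE; apply: indT; last exact: enum_valP.
    by rewrite big_enum_val -[RHS]c0; apply: eq_bigr => i _; exact: aE.
  by rewrite big_enum_val -[RHS]cp; apply: eq_bigr => i _; rewrite aE.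
by rewrite /row_free /row_full => /eqP ->; rewrite cardT.
Qed.

Let bary_solve x : row_mx (const_mx 1) x *m pinvmx bary_mx *m bary_mx =
  row_mx (const_mx 1 : 'rV[R]_1) x.
Proof. by rewrite mulmxKpV// submx_full. Qed.

Lemma bary_sum x : \sum_(v in T) bary v x = 1.
Proof.
have := bary_solve x; rewrite bary_mx_comb => /eq_row_mx[/rowP/(_ 0)].
rewrite !mxE => h _; rewrite big_enum_val -[RHS]h.
by apply: eq_bigr => j _; exact: bary_enum.
Qed.

Lemma bary_comb x : \sum_(v in T) bary v x *: p v = x.
Proof.
have := bary_solve x; rewrite bary_mx_comb => /eq_row_mx[_ h].
rewrite big_enum_val -[RHS]h.
by apply: eq_bigr => j _; rewrite bary_enum.
Qed.

Lemma bary_unique (a : 'I_n -> R) v : \sum_(u in T) a u = 1 -> v \in T ->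
  bary v (\sum_(u in T) a u *: p u) = a v.
Proof.
move=> a1 vT; set x := \sum_(u in T) _.
apply/eqP; rewrite -subr_eq0; apply/eqP.
apply: (indT (a := fun v => bary v x - a v)) => //.
  by rewrite sumrB bary_sum a1 subrr.
by under eq_bigr do rewrite scalerBl; rewrite sumrB bary_comb subrr.
Qed.

Lemma bary_vert u v : u \in T -> bary v (p u) = (u == v)%:R.
Proof.
move=> uT; have [vT|vT] := boolP (v \in T); last first.
  by rewrite bary_out//; case: eqP => // uv; rewrite -uv uT in vT.
rewrite -[RHS](@bary_unique (fun v => (u == v)%:R))//.
  congr bary; rewrite (bigD1 u)//= eqxx scale1r big1 ?addr0// => w /andP[_].
  by rewrite eq_sym => /negbTE->; rewrite scale0r.
by rewrite (bigD1 u)//= eqxx big1 ?addr0// => w /andP[_]; rewrite eq_sym => /negbTE->.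
Qed.

(** This turns the later incidence arguments on faces into sign conditions on affine functions. *)
Lemma hull_sub_baryP (F : {set 'I_n}) x : F \subset T -> hull p F x <->
  (forall v, 0 <= bary v x) /\ (forall v, v \notin F -> bary v x = 0).
Proof.
move=> FT; split=> [[a [a0 a1 ->]]|[b0 bF]].
  pose b v := if v \in F then a v else 0.
  have bE : \sum_(v in T) b v = 1.
    rewrite -a1 [LHS](big_setID F)/= (finset.setIidPr FT) [X in _ + X]big1 ?addr0.
      by apply: eq_bigr => v vF; rewrite /b vF.
    by move=> v /finset.setDP[_ /negbTE vF]; rewrite /b vF.
  have xE : \sum_(v in F) a v *: p v = \sum_(v in T) b v *: p v.
    rewrite [RHS](big_setID F)/= (finset.setIidPr FT) [X in _ = _ + X]big1 ?addr0.
      by apply: eq_bigr => v vF; rewrite /b vF.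
    by move=> v /finset.setDP[_ /negbTE vF]; rewrite /b vF scale0r.
  rewrite xE; split=> v.
    have [vT|vT] := boolP (v \in T); last by rewrite bary_out.
    by rewrite bary_unique// /b; case: ifP.
  move=> vF; have [vT|vT] := boolP (v \in T); last by rewrite bary_out.
  by rewrite bary_unique// /b (negbTE vF).
exists (fun v => bary v x); split=> //.
  rewrite -[RHS](bary_sum x) [RHS](big_setID F)/= (finset.setIidPr FT) [X in _ = _ + X]big1 ?addr0//.
  by move=> v /finset.setDP[_ vF]; exact: bF.
rewrite -[LHS](bary_comb x) [LHS](big_setID F)/= (finset.setIidPr FT) [X in _ + X]big1 ?addr0//.
by move=> v /finset.setDP[_ vF]; rewrite bF// scale0r.
Qed.

Lemma hull_baryP x : hull p T x <-> forall v, 0 <= bary v x.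
Proof.
rewrite hull_sub_baryP//; split=> [[]//|h]; split=> // v; exact: bary_out.
Qed.

Lemma bary_le1 v x : hull p T x -> bary v x <= 1.
Proof.
move=> /hull_baryP x0; have [vT|vT] := boolP (v \in T); last by rewrite bary_out.
by rewrite -(bary_sum x) (bigD1 v)//= lerDl sumr_ge0.
Qed.

Lemma affine_bary f x : affine f -> f x = \sum_(v in T) bary v x * f (p v).
Proof. by move=> af; rewrite -[x in LHS]bary_comb affine_sum// bary_sum. Qed.

Lemma near_bary_gt0 v x : 0 < bary v x -> \forall y \near x, 0 < bary v y.
Proof. by move=> vx; apply: near_gt => //; exact: bary_continuous. Qed.

Lemma bary_open_in_hull x : (forall v, v \in T -> 0 < bary v x) ->
  \forall y \near x, hull p T y.
Proof.
move=> x0; have : \forall y \near x, forall v, 0 <= bary v y.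
  apply: near_forall => v; have [vT|vT] := boolP (v \in T).
    by apply: filterS (near_bary_gt0 (x0 v vT)) => y /ltW.
  by apply: near_always => y; rewrite bary_out.
by apply: filterS => y h; exact/hull_baryP.
Qed.

Lemma closed_hull : closed (hull p T).
Proof.
rewrite (_ : hull p T = \bigcap_(v in [set: 'I_n]) (bary v @^-1` [set t | 0 <= t])).
  apply: closed_bigI => v _; apply: closed_comp; last exact: closed_ge.
  by move=> x _; exact: bary_continuous.
by apply/seteqP; split=> x => [/hull_baryP h v _|h]; [exact: h|apply/hull_baryP => v; exact: h].
Qed.

End barycentric.

Section hull_facts.
Context {R : realType} {d n : nat} (p : 'I_n -> 'rV[R]_d).
Implicit Types F T : {set 'I_n}.

Lemma hull_vert F v : v \in F -> hull p F (p v).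
Proof.
move=> vF; exists (fun u => (u == v)%:R); split.
- by move=> u; rewrite ler0n.
- by rewrite (bigD1 v)//= eqxx big1 ?addr0// => u /andP[_ /negbTE->].
- by rewrite (bigD1 v)//= eqxx scale1r big1 ?addr0// => u /andP[_ /negbTE->]; rewrite scale0r.
Qed.

Lemma hull_convex F x y (t : R) : 0 <= t <= 1 -> hull p F x -> hull p F y ->
  hull p F (x + t *: (y - x)).
Proof.
move=> /andP[t0 t1] [a [a0 a1 ->]] [b [b0 b1 ->]].
exists (fun v => (1 - t) * a v + t * b v); split.
- by move=> v; rewrite addr_ge0// mulr_ge0// subr_ge0.
- by rewrite big_split -!mulr_sumr a1 b1 /=; ring.
- under [RHS]eq_bigr do rewrite scalerDl -!scalerA.
  rewrite big_split -!scaler_sumr /= scalerBl scale1r scalerBr -addrA; congr (_ + _).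
  by rewrite addrC.
Qed.

Lemma hull_subset F T : F \subset T -> hull p F `<=` hull p T.
Proof.
move=> FT x [a [a0 a1 ->]]; exists (fun v => if v \in F then a v else 0); split.
- by move=> v; case: ifP.
- rewrite -a1 [LHS](big_setID F)/= (finset.setIidPr FT) [X in _ + X]big1 ?addr0.
    by apply: eq_bigr => v ->.
  by move=> v /finset.setDP[_ /negbTE->].
- rewrite [RHS](big_setID F)/= (finset.setIidPr FT) [X in _ = _ + X]big1 ?addr0.
    by apply: eq_bigr => v ->.
  by move=> v /finset.setDP[_ /negbTE->]; rewrite scale0r.
Qed.

Definition vert_bound F : R := \sum_(v in F) \sum_i `|p v 0 i|.

Lemma hull_coord_bound F x i : hull p F x -> `|x 0 i| <= vert_bound F.
Proof.
move=> [a [a0 a1 ->]]; rewrite summxE (le_trans (ler_norm_sum _ _ _))//.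
apply: ler_sum => v vF; rewrite mxE normrM ger0_norm//.
have av1 : a v <= 1 by rewrite -a1 (bigD1 v)//= lerDl sumr_ge0.
rewrite (le_trans (ler_wpM2r _ av1))// mul1r.
by rewrite (bigD1 i)//= lerDl sumr_ge0.
Qed.

Lemma vert_bound_ge0 F : 0 <= vert_bound F.
Proof. by apply: sumr_ge0 => v _; apply: sumr_ge0. Qed.

Lemma enorm_le_diameter F x y : hull p F x -> hull p F y ->
  enorm (x - y) <= diameter (hull p F).
Proof.
move=> Fx Fy; apply: ub_le_sup; last by exists x, y.
exists (d%:R * (vert_bound F + vert_bound F)) => _ [u [w [Fu Fw ->]]].
apply: enorm_le; last by rewrite addr_ge0// vert_bound_ge0.
move=> i; rewrite !mxE (le_trans (ler_normB _ _))//.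
by apply: lerD; exact: hull_coord_bound.
Qed.

End hull_facts.

Section inscribed_ball.
Context {R : realType} {d n : nat} (p : 'I_n -> 'rV[R]_d) (T : {set 'I_n}).
Hypotheses (cardT : #|T| = d.+1) (indT : affinely_independent p T).
Let h := diameter (hull p T).

Lemma diameter_gt0 : (0 < d)%N -> 0 < h.
Proof.
move=> d0; have /card_gt1P[u [v [uT vT uv]]] : (1 < #|T|)%N by rewrite cardT.
have := enorm_le_diameter (hull_vert p uT) (hull_vert p vT); apply: lt_le_trans.
rewrite lt_neqAle enorm_ge0 andbT eq_sym; apply/eqP => /enorm_eq0/eqP.
rewrite subr_eq0 => /eqP puv; have := bary_vert cardT indT v uT.
rewrite puv (bary_vert cardT indT)// eqxx (negbTE uv) => /eqP.
by rewrite oner_eq0.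
Qed.

Lemma inscribed_ball (sigma : R) : 0 < sigma -> 0 < h ->
  h <= sigma * indiameter (hull p T) ->
  exists x r, [/\ 0 < r, h / (4 * sigma) <= r &
    forall y, enorm (y - x) <= r -> hull p T y].
Proof.
move=> s0 h0 hs; have i0 : 0 < indiameter (hull p T).
  by rewrite -(pmulr_rgt0 _ s0) (lt_le_trans h0).
(* A set without supremum would have [sup] equal to the default 0, contradicting [i0]. *)
have hsup : has_sup [set r *+ 2 | r in [set r : R | 0 <= r /\
    exists x, [set y | enorm (y - x) <= r] `<=` hull p T]].
  apply: contrapT => /sup_out; rewrite -/(indiameter _) => E.
  by rewrite E ltxx in i0.
have e0 : 0 < indiameter (hull p T) / 2 by rewrite divr_gt0.
(* The supremum need not be attained; a ball with more than half the extremal diameter is taken,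
   which is the origin of the factor 4. *)
have [_ [r [r0 [x xr]] <-]] := sup_adherent e0 hsup.
rewrite -/(indiameter _) => hr.
have sr : indiameter (hull p T) < 4 * r by lra.
exists x, r; split => //; first by lra.
rewrite ler_pdivrMr ?mulr_gt0// (le_trans hs)// mulrCA.
by rewrite (le_trans (ler_wpM2l (ltW s0) (ltW sr)))// [r * _]mulrC mulrCA.
Qed.

Lemma affine_direction (f : 'rV[R]_d -> R) x y z (s : R) : affine f ->
  f (z + s *: (x - y)) = f z + s * (f x - f y).
Proof.
move=> [c [w fE]]; rewrite !fE opprD addrACA subrr add0r -sumrB mulr_sumr.
rewrite -addrA -big_split; congr (_ + _); apply: eq_bigr => i _; rewrite !mxE /=.
by rewrite -mulrBr mulrDr mulrCA.
Qed.

(** A displacement of length r from the centre z stays in the simplex, where the coordinate remains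
    between 0 and 1; being affine, it therefore changes by at most 1/r per unit length in any
    direction. *)
Lemma bary_lipschitz z r v x y : 0 < r -> (forall y, enorm (y - z) <= r -> hull p T y) ->
  bary p T v x - bary p T v y <= r^-1 * enorm (x - y).
Proof.
move=> r0 hz; have := enorm_ge0 (x - y); rewrite le_eqVlt => /predU1P[/esym|e0].
  by move=> e0; have /eqP := enorm_eq0 e0; rewrite subr_eq0 e0 mulr0 => /eqP ->; rewrite subrr.
pose s := r / enorm (x - y).
have zh : hull p T (z + s *: (x - y)).
  apply: hz; rewrite addrAC subrr add0r enormZ ger0_norm ?divr_ge0 ?(ltW r0) ?(ltW e0)//.
  by rewrite divfK// gt_eqF.
have z0 : hull p T z by apply: hz; rewrite subrr -(scale0r 0) enormZ normr0 mul0r ltW.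
have := bary_le1 cardT indT v zh; rewrite affine_direction; last exact: bary_affine.
have /hull_baryP := z0 => /(_ cardT indT v) zv h1.
have : s * (bary p T v x - bary p T v y) <= 1 by lra.
by rewrite -ler_pdivlMl ?divr_gt0// mulr1 invf_div mulrC.
Qed.

End inscribed_ball.

(** * Vertex stars *)

Section generic_points.
Context {R : realType} {d : nat}.
Implicit Types (x y q : 'rV[R]_d) (U : set 'rV[R]_d).

Lemma near_segment (P : 'rV[R]_d -> Prop) x q : (\forall y \near x, P y) ->
  exists s : R, [/\ 0 < s, s <= 1 & P (x + s *: (q - x))].
Proof.
move=> /near_ballP[e e0 h]; have n0 := normr_ge0 (q - x).
have en0 : 0 < e + `|q - x| by rewrite ltr_pwDl.
exists (e / (e + `|q - x|)); split; first by rewrite divr_gt0.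
  by rewrite ler_pdivrMr// mul1r lerDl.
apply: h; rewrite addrAC subrr add0r normrZ ger0_norm ?divr_ge0 ?(ltW e0) ?(ltW en0)//.
by rewrite mulrAC ltr_pdivrMr// mulrDr ltr_pwDl// mulr_gt0.
Qed.

(** Finitely many hyperplanes do not fill an open set. The open set is shrunk one function at a
    time: from a zero of f, any small move towards a point q with [f q != 0] leaves the zero set. *)
Lemma affine_generic (I : finType) (P : pred I) (f : I -> 'rV[R]_d -> R) U :
  (forall i, P i -> affine (f i) /\ exists q, f i q != 0) ->
  open U -> U !=set0 -> exists2 y, U y & forall i, P i -> f i y != 0.
Proof.
move=> hf oU U0; suff H (r : seq I) V : open V -> V !=set0 ->
    exists2 y, V y & forall i, i \in r -> P i -> f i y != 0.
  by have [y Uy h] := H (enum I) U oU U0; exists y => // i; apply: h; rewrite mem_enum.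
elim: r V => [|i r IHr] V oV [x Vx]; first by exists x.
have [Pi|Pi] := boolP (P i); last first.
  have [y Vy h] := IHr V oV (ex_intro _ x Vx); exists y => // j.
  by rewrite inE => /predU1P[->|/h//]; rewrite (negbTE Pi).
have [af [q fq]] := hf i Pi.
have [y Vy h] : exists2 y, (V `&` f i @^-1` [set t | t != 0]) y &
    forall j, j \in r -> P j -> f j y != 0.
  apply: IHr.
    apply: openI => //; apply: open_comp; last exact: open_neq.
    by move=> y _; exact: affine_continuous.
  have [fx|fx] := eqVneq (f i x) 0; last by exists x.
  have /(near_segment q)[s [s0 _ Vs]] : \forall y \near x, V y by exact: open_nbhs_nbhs.
  exists (x + s *: (q - x)); split=> //=.
  by rewrite affine_comb// fx add0r subr0 mulf_neq0// gt_eqF.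
exists y; first by have [] := Vy.
move=> j; rewrite inE => /predU1P[->|/h//] _; by have [] := Vy.
Qed.

End generic_points.

Section star.
Context {R : realType} {d : nat} {Omega : polyhedral_domain R d}.
Variable K : triangulation Omega.
Hypothesis d0 : (0 < d)%N.
Local Notation p := (@vert _ _ _ K).
Local Notation E := (elts K).
Local Notation V := 'I_(nvert K).
Local Notation lam := (@bary R d (nvert K) (@vert _ _ _ K)).
Implicit Types (T F : {set V}) (x y z q : 'rV[R]_d) (a u v w b : V).

(** By conformity x lies in the hull of the common vertices, so all other coordinates vanish in both
    elements and uniqueness applies. Continuity of nodal functions across faces rests on this. *)
Lemma elt_bary_eq T T' x v : T \in E -> T' \in E -> hull p T x -> hull p T' x ->
  lam T v x = lam T' v x.
Proof.
move=> TE TE' Tx Tx'; have cT := card_elt TE; have iT := elt_nondegenerate TE.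
have cT' := card_elt TE'; have iT' := elt_nondegenerate TE'.
have : (hull p T `&` hull p T') x by [].
rewrite (elt_conforming TE TE') => Ix.
have [_ zT] := (hull_sub_baryP cT iT x (finset.subsetIl T T')).1 Ix.
have [_ zT'] := (hull_sub_baryP cT' iT' x (finset.subsetIr T T')).1 Ix.
have [vT'|vT'] := boolP (v \in T'); last by rewrite zT ?(bary_out _ _ vT')// inE (negbTE vT') andbF.
have red (W : nmodType) (f : V -> W) : (forall u, u \notin T :&: T' -> f u = 0) ->
    \sum_(u in T') f u = \sum_(u in T) f u.
  move=> f0; rewrite [LHS](big_setID T) [RHS](big_setID T') /= finset.setIC.
  by congr (_ + _); rewrite !big1// => u /finset.setDP[h1 h2]; apply: f0; rewrite inE (negbTE h2) ?andbF.
rewrite -(bary_unique cT' iT' (a := lam T ^~ x))//; last by rewrite red ?bary_sum.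
congr (lam T' v _); rewrite red ?bary_comb// => u /zT ->.
by rewrite scale0r.
Qed.

Lemma elt_carrier T T' x v : T \in E -> T' \in E -> hull p T x -> hull p T' x ->
  0 < lam T v x -> v \in T'.
Proof.
move=> TE TE' Tx Tx'; rewrite (elt_bary_eq v TE TE' Tx Tx'); apply: contraTT => vT'.
by rewrite bary_out// ltxx.
Qed.

Lemma closed_elt T : T \in E -> closed (hull p T).
Proof. by move=> TE; apply: closed_hull; [exact: card_elt|exact: elt_nondegenerate]. Qed.

(** Elements are closed and finite in number, so those missing x also miss a neighbourhood of x. *)
Lemma near_elt x : \forall y \near x, forall T, T \in E -> hull p T y -> hull p T x.
Proof.
apply: near_forall => T; have [TE|TE] := boolP (T \in E); last exact: near_always.
have [Tx|Tx] := pselect (hull p T x); first exact: near_always.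
have : \forall y \near x, ~ hull p T y.
  apply: open_nbhs_nbhs; split => //; exact: closed_openC (closed_elt TE).
by apply: filterS => y Ty _ /Ty.
Qed.

Lemma elt_in_closure T x : T \in E -> hull p T x -> closure Omega x.
Proof. by move=> TE Tx; rewrite (elt_cover K); exists T. Qed.

Lemma closure_in_elt x : closure Omega x -> exists2 T, T \in E & hull p T x.
Proof. by rewrite (elt_cover K) => -[T TE Tx]; exists T. Qed.

(** The only way in which points are shown to be interior: a neighbourhood covered by elements lies
    in the closure, and [dom_regular] excludes slits. *)
Lemma near_closure_dom x : (\forall y \near x, closure Omega y) -> dom Omega x.
Proof. by move=> h; rewrite -(dom_regular Omega). Qed.

Lemma dom_near x : dom Omega x -> \forall y \near x, dom Omega y.
Proof. by move=> Ox; apply: open_nbhs_nbhs; split=> //; exact: dom_open. Qed.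

Definition centroid F : 'rV[R]_d := \sum_(v in F) (#|F|%:R^-1 *: p v).

Lemma centroid_hull F : (0 < #|F|)%N -> hull p F (centroid F).
Proof.
move=> F0; exists (fun=> #|F|%:R^-1); split=> //.
by rewrite sumr_const -[LHS]mulr_natl mulfV// pnatr_eq0 -lt0n.
Qed.

Lemma centroid_bary T F v : T \in E -> F \subset T -> v \in F ->
  lam T v (centroid F) = #|F|%:R^-1.
Proof.
move=> TE FT vF; have cT := card_elt TE; have iT := elt_nondegenerate TE.
have F0 : (0 < #|F|)%N by rewrite card_gt0; apply/set0Pn; exists v.
rewrite affine_sum; last 2 first.
- exact: bary_affine.
- by rewrite sumr_const -[LHS]mulr_natl mulfV// pnatr_eq0 -lt0n.
rewrite (bigD1 v)//= (bary_vert cT iT v (fintype.subsetP FT v vF)) eqxx mulr1 big1 ?addr0//.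
move=> u /andP[uF /negbTE uv].
by rewrite (bary_vert cT iT v (fintype.subsetP FT u uF)) uv mulr0.
Qed.

(** Stepping slightly across the face opposite to u, from a point of its relative interior, stays in
    the domain and lands in some element T'. That element contains the point of departure, hence all
    vertices of the face, plus exactly one vertex b. *)
Lemma neighbor_elt T u q : T \in E -> u \in T -> hull p (T :\ u) q -> dom Omega q ->
  exists T' b, [/\ T' \in E, b \notin T :\ u, T' = b |: T :\ u & lam T u (p b) < 0].
Proof.
move=> TE uT Fq Oq; set F := T :\ u; have cT := card_elt TE; have iT := elt_nondegenerate TE.
have FT : F \subset T by exact: subD1set.
have cF : #|F| = d by have := cardsD1 u T; rewrite uT cT => -[].
have lamF x v : hull p F x -> v \notin F -> lam T v x = 0.
  by move=> Fx; have [_] := (hull_sub_baryP cT iT x FT).1 Fx; exact.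
have uF : u \notin F by rewrite setD11.
(* Moving q towards the centroid makes all coordinates on the face positive, without leaving the
   domain. *)
have [s [s0 s1 Os]] := near_segment (centroid F) (dom_near Oq).
set q1 := q + s *: _ in Os.
have Fq1 : hull p F q1.
  by apply: hull_convex => //; [rewrite s1 ltW|apply: centroid_hull; rewrite cF].
have lq1 v : v \in F -> 0 < lam T v q1.
  move=> vF; rewrite affine_comb; last exact: bary_affine.
  rewrite centroid_bary// (_ : _ + _ = (1 - s) * lam T v q + s * #|F|%:R^-1); last by ring.
  rewrite ltr_wpDl ?mulr_gt0 ?invr_gt0 ?ltr0n ?cF// mulr_ge0 ?subr_ge0//.
  by apply: (hull_baryP cT iT q).1; exact: hull_subset Fq.
have [s2 [s20 s21 [Os2 Es2]]] := near_segment (q1 + (q1 - p u)) (near_and (dom_near Os) (near_elt q1)).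
set q2 := q1 + _ in Os2 Es2.
have lq2 : lam T u q2 = - s2.
  rewrite /q2 (addrAC q1 (q1 - p u)) subrr add0r affine_direction; last exact: bary_affine.
  by rewrite lamF// (bary_vert cT iT)// eqxx add0r sub0r mulrN mulr1.
have [T' TE' Tq2] := closure_in_elt (subset_closure Os2).
have Tq1 := Es2 T' TE' Tq2.
have FT' : F \subset T'.
  by apply/fintype.subsetP => v vF; apply: (elt_carrier TE TE' _ Tq1 (lq1 v vF)); exact: hull_subset Fq1.
have /set0Pn[b] : T' :\: F != finset.set0.
  by rewrite -card_gt0 cardsD (finset.setIidPr FT') cF (card_elt TE') subSnn.
move=> /finset.setDP[bT' bF]; exists T', b.
have TE2 : T' = b |: F.
  apply/esym/eqP; rewrite eqEcard finset.subUset finset.sub1set bT' FT' /=.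
  by rewrite cardsU1 bF cF (card_elt TE').
(* On the vertices of T' the function [lam T u] vanishes except at b; its negative value at [q2]
   then forces b to the far side of the face. *)
have key x : lam T u x = lam T' b x * lam T u (p b).
  rewrite (affine_bary (card_elt TE') (elt_nondegenerate TE') x (bary_affine p T u)).
  rewrite (bigD1 b)//= big1 ?addr0// => v /andP[vT' vb].
  rewrite lamF ?mulr0//; apply: hull_vert.
  by move: vT'; rewrite TE2 !inE (negbTE vb).
split=> //; have := key q2; rewrite lq2.
have : 0 <= lam T' b q2 by exact: (hull_baryP (card_elt TE') (elt_nondegenerate TE') q2).1.
move=> h1 h2; rewrite ltNge; apply/negP => h3.
by have := mulr_ge0 h1 h3; rewrite -h2 oppr_ge0 leNgt s20.
Qed.

(** Near a relative interior point of the common face the other coordinates stay positive, so the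
    sign of [lam T u] alone decides which of the two elements contains y. *)
Lemma near_two_elts T u b z : T \in E -> u \in T -> b \notin T :\ u ->
  b |: T :\ u \in E -> lam T u (p b) < 0 -> lam T u z = 0 ->
  (forall v, v \in T :\ u -> 0 < lam T v z) ->
  \forall y \near z, hull p T y \/ hull p (b |: T :\ u) y.
Proof.
set F := T :\ u; set T' := b |: F => TE uT bF TE' lub zu zF.
have cT := card_elt TE; have iT := elt_nondegenerate TE.
have cT' := card_elt TE'; have iT' := elt_nondegenerate TE'.
have FT : F \subset T by exact: subD1set.
have lamF x v : hull p F x -> v \notin F -> lam T v x = 0.
  by move=> Fx; have [_] := (hull_sub_baryP cT iT x FT).1 Fx; exact.
have uF : u \notin F by rewrite setD11.
have z0 v : v \notin F -> lam T v z = 0.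
  move=> vF; have [->//|vu] := eqVneq v u; apply: bary_out.
  by move: vF; rewrite !inE vu.
have Fz : hull p F z.
  apply/(hull_sub_baryP cT iT z FT); split=> // v.
  by have [vF|vF] := boolP (v \in F); [exact/ltW/zF|rewrite z0].
have key x : lam T u x = lam T' b x * lam T u (p b).
  rewrite (affine_bary cT' iT' x (bary_affine p T u)).
  rewrite (bigD1 b) ?setU11//= big1 ?addr0// => v /andP[vT' vb].
  rewrite lamF ?mulr0//; apply: hull_vert.
  by move: vT'; rewrite !inE (negbTE vb).
have zE v : lam T v z = lam T' v z.
  by apply: elt_bary_eq => //; apply: hull_subset Fz => //; exact: finset.subsetUr.
have : \forall y \near z, forall v, v \in F -> 0 < lam T v y /\ 0 < lam T' v y.
  apply: near_forall => v; have [vF|vF] := boolP (v \in F); last exact: near_always.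
  have h1 : \forall y \near z, 0 < lam T v y.
    by apply: near_gt; [exact: bary_continuous|exact: zF].
  have h2 : \forall y \near z, 0 < lam T' v y.
    by apply: near_gt; [exact: bary_continuous|rewrite -zE; exact: zF].
  by apply: filterS (near_and h1 h2) => y.
apply: filterS => y yF; have [yu|yu] := leP 0 (lam T u y).
  left; apply/(hull_baryP cT iT) => v; have [->//|vu] := eqVneq v u.
  have [vT|vT] := boolP (v \in T); last by rewrite bary_out.
  by apply/ltW/(yF v _).1; rewrite !inE vu.
right; apply/(hull_baryP cT' iT') => v; have [->|vb] := eqVneq v b.
  by move: yu; rewrite key nmulr_llt0// => /ltW.
have [vT|vT] := boolP (v \in T'); last by rewrite bary_out.
by apply/ltW/(yF v _).2; move: vT; rewrite !inE (negbTE vb).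
Qed.

(** Having d common vertices means sharing a face. Requiring a among them keeps chains inside the
    star of a and makes each step cross a face through a. *)
Definition adj a : rel {set V} := fun T T' =>
  [&& T \in E, T' \in E, a \in T :&: T' & #|T :&: T'| == d].

Lemma connect_adj a T T' : T \in E -> a \in T -> connect (adj a) T T' ->
  T' \in E /\ a \in T'.
Proof.
move=> TE aT /connectP[s + ->]; elim: s T TE aT => [//|T1 s IHs] T TE aT /=.
by move=> /andP[/and4P[_ T1E] /setIP[_ aT1] _]; exact: IHs.
Qed.

Lemma generic_point a T e : T \in E -> a \in T -> 0 < e ->
  exists y, [/\ `|y - p a| < e, forall v, v \in T -> 0 < lam T v y &
    forall T' v, T' \in E -> v \in T' -> lam T' v y != 0].
Proof.
move=> TE aT e0; have cT := card_elt TE; have iT := elt_nondegenerate TE.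
pose U := [set y | ball (p a) e y /\ forall v, v \in T -> 0 < lam T v y].
have oU : open U.
  rewrite openE => y [yb yT].
  suff : \forall z \near y, ball (p a) e z /\ forall v, v \in T -> 0 < lam T v z by [].
  apply: near_and.
    by apply: open_nbhs_nbhs; split => //; exact: ball_open.
  apply: near_forall => v; have [vT|vT] := boolP (v \in T); last exact: near_always.
  have : \forall z \near y, 0 < lam T v z.
    by apply: near_gt; [exact: bary_continuous|exact: yT].
  by apply: filterS => z.
have U0 : U !=set0.
  have /(near_segment (centroid T))[s [s0 s1 bs]] : \forall y \near p a, ball (p a) e y.
    exact: nbhsx_ballx.
  exists (p a + s *: (centroid T - p a)); split=> // v vT /=.
  rewrite affine_comb; last exact: bary_affine.
  rewrite centroid_bary// (_ : _ + _ = (1 - s) * lam T v (p a) + s * #|T|%:R^-1); last by ring.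
  rewrite ltr_wpDl ?mulr_gt0 ?invr_gt0 ?ltr0n ?cT// mulr_ge0 ?subr_ge0//.
  by rewrite (bary_vert cT iT).
have [|y [yb yT] yg] := @affine_generic R d ({set V} * V)%type
    (fun i => (i.1 \in E) && (i.2 \in i.1)) (fun i => lam i.1 i.2) U _ oU U0.
  move=> [T' v] /= /andP[T'E vT']; split; first exact: bary_affine.
  exists (p v); rewrite (bary_vert (card_elt T'E) (elt_nondegenerate T'E))// eqxx.
  exact: oner_neq0.
exists y; split=> //; first by move: yb; rewrite -ball_normE /= distrC.
by move=> T' v T'E vT'; apply: (yg (T', v)); rewrite /= T'E vT'.
Qed.

(** Suppose a point y near [p a] is missed by the elements reachable from T. On the segment from a
    generic point x of T to y, consider the last time [t0] spent in a reachable element T'. By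
    genericity exactly one coordinate, that of some u, vanishes there, and u is not a. The face
    opposite to u contains a and meets the domain, so the element behind it is reachable too and
    covers a neighbourhood: the segment continues beyond [t0]. *)
Lemma star_nbhd a T : T \in E -> a \in T ->
  (forall T' u, connect (adj a) T T' -> u \in T' -> a != u ->
    exists2 q, hull p (T' :\ u) q & dom Omega q) ->
  \forall y \near p a, exists2 T', connect (adj a) T T' & hull p T' y.
Proof.
move=> TE aT nobd.
have CE T' : connect (adj a) T T' -> T' \in E /\ a \in T' by exact: connect_adj.
(* The radius e keeps the coordinate of a positive in all elements containing a; the vanishing
   coordinate will thus never be that of a. *)
have /near_ballP[e e0 ha] : \forall y \near p a, forall T', T' \in E /\ a \in T' -> 0 < lam T' a y.
  apply: near_forall => T'; have [[TE' aT']|h] := pselect (T' \in E /\ a \in T').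
    have : \forall y \near p a, 0 < lam T' a y.
      apply: near_gt; first exact: bary_continuous.
      by rewrite (bary_vert (card_elt TE') (elt_nondegenerate TE'))// eqxx.
    exact: filterS.
  by apply: near_always => y /h.
apply/near_ballP; exists e => // y0 y0e; apply: contrapT => y0C.
have {}y0C T' : connect (adj a) T T' -> ~ hull p T' y0 by move=> cT' Ty; apply: y0C; exists T'.
have [x [xe xT xg]] := generic_point TE aT e0.
(* The uncovered set is open, so y can be perturbed. The determinant condition says that no two
   coordinates of an element vanish simultaneously on the line through x and y. *)
have [y [ye yC yg]] : exists y, [/\ `|y - p a| < e,
    forall T', connect (adj a) T T' -> ~ hull p T' y &
    forall T' u w, T' \in E -> u \in T' -> w \in T' -> u != w ->
      lam T' w x * lam T' u y - lam T' u x * lam T' w y != 0].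
  pose U := [set y | ball (p a) e y /\ forall T', connect (adj a) T T' -> ~ hull p T' y].
  have oU : open U.
    rewrite openE => y [ye yC].
    suff : \forall z \near y, ball (p a) e z /\ forall T', connect (adj a) T T' -> ~ hull p T' z by [].
    apply: near_and; first by apply: open_nbhs_nbhs; split => //; exact: ball_open.
    apply: filterS (near_elt y) => z hz T' cT' Tz.
    by apply: (yC T' cT'); apply: hz => //; exact: (CE _ cT').1.
  have U0 : U !=set0 by exists y0; split => //; rewrite -ball_normE /= distrC.
  have [|y [ye yC] yg] := @affine_generic R d ({set V} * (V * V))%type
      (fun i => [&& i.1 \in E, i.2.1 \in i.1, i.2.2 \in i.1 & i.2.1 != i.2.2])
      (fun i y => lam i.1 i.2.2 x * lam i.1 i.2.1 y + (- lam i.1 i.2.1 x * lam i.1 i.2.2 y)) U _ oU U0.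
    move=> [T' [u w]] /= /and4P[TE' uT' wT' uw]; split.
      apply: affine_lin; first exact: bary_affine.
      rewrite (_ : (fun=> _) = fun y => - lam T' u x * lam T' w y + 0); last first.
        by apply/funext => y; rewrite addr0.
      by apply: affine_lin; [exact: bary_affine|exact: affine_cst].
    exists (p u); rewrite !(bary_vert (card_elt TE') (elt_nondegenerate TE'))// eqxx (negbTE uw).
    by rewrite mulr1 mulr0 addr0 xg.
  exists y; split=> //; first by move: ye; rewrite -ball_normE /= distrC.
  move=> T' u w TE' uT' wT' uw; have := yg (T', (u, w)); rewrite /= TE' uT' wT' uw => /(_ isT).
  by rewrite mulNr.
pose g t := x + t *: (y - x).
have gcont : continuous g.
  move=> t; apply: cvgD; first exact: cvg_cst.
  by apply: cvgZr_tmp; exact: cvg_id.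
pose A := [set t : R | [/\ 0 <= t, t <= 1 & exists2 T', connect (adj a) T T' & hull p T' (g t)]].
have A0 : A 0.
  split=> //; exists T; first exact: connect0.
  rewrite /g scale0r addr0; apply/(hull_baryP (card_elt TE) (elt_nondegenerate TE)) => v.
  by have [/xT/ltW//|vT] := boolP (v \in T); rewrite bary_out.
have supA : has_sup A by split; [exists 0|exists 1 => t []].
pose t0 := sup A.
have t00 : 0 <= t0 by apply: ub_le_sup => //; exact: supA.2.
have t01 : t0 <= 1 by apply: ge_sup => [|t []//]; exists 0.
have ge t : 0 <= t <= 1 -> `|g t - p a| < e.
  move=> /andP[t0' t1']; rewrite /g.
  have -> : x + t *: (y - x) - p a = (1 - t) *: (x - p a) + t *: (y - p a).
    apply/rowP => i; rewrite !mxE; ring.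
  apply: le_lt_trans (ler_normD _ _) _; rewrite !normrZ !ger0_norm ?subr_ge0//.
  have [->|tn0] := eqVneq t 0; first by rewrite subr0 mul1r mul0r addr0.
  have h1 : t * `|y - p a| < t * e by rewrite ltr_pM2l// lt_neqAle eq_sym tn0.
  have h2 : (1 - t) * `|x - p a| <= (1 - t) * e by rewrite ler_wpM2l ?subr_ge0// ltW.
  by lra.
have [T' cT' Tz] : exists2 T', connect (adj a) T T' & hull p T' (g t0).
  have /near_ballP[r r0 hr] : \forall t \near t0, forall T', T' \in E -> hull p T' (g t) -> hull p T' (g t0).
    exact: (gcont t0 _ (near_elt (g t0))).
  have [t [t0' t1' [T' cT' Tt]] rt] := sup_adherent r0 supA.
  have tt0 : t <= t0 by apply: ub_le_sup; [exact: supA.2|split=> //; exists T'].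
  exists T' => //; apply: hr Tt; last exact: (CE _ cT').1.
  by rewrite ler0_norm ?subr_le0// opprB; rewrite -/t0 in rt; lra.
have [TE' aT'] := CE _ cT'; have cdT' := card_elt TE'; have iT' := elt_nondegenerate TE'.
have t0lt1 : t0 < 1.
  rewrite lt_neqAle t01 andbT; apply/eqP => t0E.
  by apply: (yC T' cT'); move: Tz; rewrite t0E /g scale1r addrC subrK.
(* Otherwise the segment would remain covered for a while after its supremal time. *)
have notnear : ~ \forall z \near g t0, exists2 T', connect (adj a) T T' & hull p T' z.
  move=> /(gcont t0 _)/near_ballP[r r0 hr].
  pose t := t0 + Num.min (r / 2) (1 - t0).
  have m0 : 0 < Num.min (r / 2) (1 - t0) by rewrite lt_min divr_gt0// subr_gt0.
  have : t <= t0.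
    apply: ub_le_sup; first exact: supA.2.
    split; first by rewrite addr_ge0// ltW.
      by rewrite /t -lerBrDl ge_min lexx orbT.
    apply: hr; rewrite /t addrAC subrr add0r gtr0_norm// gt_min.
    by rewrite ltr_pdivrMr// ltr_pMr// ltr1n.
  by rewrite /t gerDl leNgt m0.
have lz v : 0 <= lam T' v (g t0) by exact: (hull_baryP cdT' iT' _).1.
have [u uT' uz] : exists2 u, u \in T' & lam T' u (g t0) = 0.
  apply: contrapT => nu; apply: notnear.
  have : \forall z \near g t0, hull p T' z.
    apply: bary_open_in_hull => // v vT'; rewrite lt_neqAle lz andbT eq_sym.
    by apply/eqP => vz; apply: nu; exists v.
  by apply: filterS => z; exists T'.
have wz w : w \in T' -> w != u -> 0 < lam T' w (g t0).
  move=> wT' wu; rewrite lt_neqAle lz andbT eq_sym; apply/eqP => wz.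
  have /eqP := yg T' w u TE' wT' uT' wu; apply.
  have t0n : t0 != 0.
    apply/eqP => t0E; move: uz; rewrite t0E /g scale0r addr0 => /eqP.
    by rewrite (negbTE (xg _ _ TE' uT')).
  move: uz wz; rewrite /g !affine_comb; try exact: bary_affine.
  move: (lam T' u x) (lam T' u y) (lam T' w x) (lam T' w y) => xu yu xw yw uz wz.
  apply: (mulfI t0n); rewrite mulr0.
  have -> : t0 * (xu * yw - xw * yu) = xu * (xw + t0 * (yw - xw)) - xw * (xu + t0 * (yu - xu)) by ring.
  by rewrite uz wz !mulr0 subrr.
have au : a != u.
  apply/eqP => au; have /ha/(_ T' (conj TE' aT')) := ge t0 (introT andP (conj t00 t01)).
  by rewrite au uz ltxx.
have [q Fq Oq] := nobd T' u cT' uT' au.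
have [T2 [b [TE2 bF T2E lb]]] := neighbor_elt TE' uT' Fq Oq.
apply: notnear.
have : \forall z \near g t0, hull p T' z \/ hull p (b |: T' :\ u) z.
  apply: near_two_elts => //; first by rewrite -T2E.
  by move=> v; rewrite !inE => /andP[vu vT']; exact: wz.
apply: filterS => z [Tz'|Tz']; first by exists T'.
exists (b |: T' :\ u) => //; apply: connect_trans cT' (connect1 _).
rewrite /adj TE' -T2E TE2 /= T2E.
have -> : T' :&: (b |: T' :\ u) = T' :\ u.
  apply/setP => v; rewrite !inE; have [->|vb] := eqVneq v b; last by rewrite orFb; case: (v \in T'); rewrite ?andbT ?andbF.
  apply/idP/idP; last by move: bF; rewrite !inE => /negbTE ->.
  rewrite andbT => bT'; exfalso; move: bF; rewrite !inE bT' andbT negbK => /eqP bu.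
  by move: lb; rewrite bu (bary_vert cdT' iT')// eqxx ltNge ler01.
rewrite !inE au aT' /=; apply/eqP.
by have := cardsD1 u T'; rewrite uT' cdT' => -[].
Qed.

(** A generic point of T' near [p a] lies in a reachable element; having all coordinates of that
    element nonzero, it identifies it with T'. *)
Lemma star_connected a T T' : dom Omega (p a) -> T \in E -> T' \in E ->
  a \in T -> a \in T' -> connect (adj a) T T'.
Proof.
move=> Oa TE TE' aT aT'.
have : \forall y \near p a, exists2 T'', connect (adj a) T T'' & hull p T'' y.
  apply: star_nbhd => // T'' u cT'' uT'' au; exists (p a) => //; apply: hull_vert.
  by rewrite !inE au; have [] := connect_adj TE aT cT''.
move=> /near_ballP[e e0 h].
have [y [ye yT' yg]] := generic_point TE' aT' e0.
have [T2 cT2 Ty] := h y ye; have [TE2 aT2] := connect_adj TE aT cT2.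
suff -> : T' = T2 by [].
apply/esym/eqP; rewrite eqEcard (card_elt TE2) (card_elt TE') leqnn andbT.
apply/fintype.subsetP => v vT2; apply: (elt_carrier TE2 TE' Ty).
  apply/(hull_baryP (card_elt TE') (elt_nondegenerate TE')) => w.
  by have [/yT'/ltW//|wT] := boolP (w \in T'); rewrite bary_out.
rewrite lt_neqAle eq_sym yg//=.
by have /(hull_baryP (card_elt TE2) (elt_nondegenerate TE2)) := Ty; apply.
Qed.

(** By contraposition: if no reachable element had a boundary face through a, reachable elements
    would cover a neighbourhood of [p a], which would then be a point of the domain. *)
Lemma star_boundary a T : ~ dom Omega (p a) -> T \in E -> a \in T ->
  exists T' u, [/\ connect (adj a) T T', u \in T', a != u &
    hull p (T' :\ u) `<=` closure Omega `\` Omega].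
Proof.
move=> Oa TE aT; apply: contrapT => nb; apply: Oa; apply: near_closure_dom.
have : \forall y \near p a, exists2 T', connect (adj a) T T' & hull p T' y.
  apply: star_nbhd => // T' u cT' uT' au; apply: contrapT => nq; apply: nb.
  exists T', u; split=> // q Fq; split.
    have [TE' _] := connect_adj TE aT cT'; apply: (elt_in_closure TE').
    by apply: hull_subset Fq; exact: subD1set.
  by move=> Oq; apply: nq; exists q.
apply: filterS => y [T' cT' Ty]; have [TE' _] := connect_adj TE aT cT'.
exact: elt_in_closure Ty.
Qed.

End star.

(** * Averages along coordinate directions *)

Section unit_interval_mean.
Context {R : realType}.
Implicit Types (g h : R -> R).
Local Notation mean h := (\int[@lebesgue_measure R]_(s in `[0, 1]) h s).

Lemma mean_integrable h : continuous h ->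
  (@lebesgue_measure R).-integrable `[0, 1] (EFin \o h).
Proof.
move=> ch; apply: continuous_compact_integrable; first exact: segment_compact.
exact: continuous_subspaceT.
Qed.

Lemma mean_lin (a : R) g h : continuous g -> continuous h ->
  mean (fun s => a * g s + h s) = a * mean g + mean h.
Proof.
move=> cg ch; rewrite RintegralD//; last 2 first.
- exact: (integrableZl _ a (mean_integrable cg)).
- exact: mean_integrable.
by rewrite RintegralZl//; exact: mean_integrable.
Qed.

Lemma mean_cst (c : R) : mean (fun=> c) = c.
Proof.
rewrite Rintegral_cst//; have := @lebesgue_measure_itv R `[0, 1].
by rewrite /= lte_fin ltr01 => -> /=; rewrite subr0 mulr1.
Qed.

Lemma mean_near h (c M : R) : continuous h -> (forall s : R, 0 <= s <= 1 -> `|h s - c| <= M) ->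
  `|mean h - c| <= M.
Proof.
move=> ch hc; have cc : continuous (fun _ : R => - c) by exact: cst_continuous.
have -> : mean h - c = mean (fun s => h s - c).
  have := mean_lin 1 ch cc; rewrite mean_cst mul1r => <-.
  by apply: eq_Rintegral => s _; rewrite mul1r.
have chc : continuous (fun s => h s - c) by exact: continuous_add.
apply: (le_trans (le_normr_Rintegral _ (mean_integrable chc))) => //.
rewrite -[leRHS]mean_cst; apply: le_Rintegral => //.
- apply: (@mean_integrable (fun s => `|h s - c|)) => x.
  exact: (@continuous_comp _ _ _ (fun s : R => h s - c) Num.norm x (chc x) (@norm_continuous _ _ _)).
- by apply: mean_integrable; exact: cst_continuous.
Qed.

(** The moving average is a difference quotient of a primitive of g, so its derivative is the
    difference quotient of g itself. *)
Lemma mean_derive (g : R -> R) (delta : R) : continuous g -> 0 < delta ->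
  is_derive (0 : R) 1 (fun t => mean (fun s => g (t + s * delta)))
    (delta^-1 * (g delta - g 0)).
Proof.
move=> cg d0.
(* Starting the primitive at -1 leaves room on both sides of t = 0. *)
pose G (x : R) : R := \int[@lebesgue_measure R]_(t in `[-1, x]) g t.
have dG (x : R) : -1 < x -> is_derive x (1 : R) G (g x).
  move=> x1; have [] := @continuous_FTC1 R g (BLeft (-1)) x (x + 1) _ _ _ (cg x).
  - by rewrite ltrDl.
  - apply: continuous_compact_integrable; first exact: segment_compact.
    exact: continuous_subspaceT.
  - by rewrite lte_fin.
  - by rewrite derive1E => dGx <-; exact: DeriveDef.
have dGc (t s : R) : -1 < t + s * delta ->
    is_derive s (1 : R) (fun s : R => delta^-1 * G (t + s * delta)) (g (t + s * delta)).
  move=> ts; have da : is_derive s (1 : R) (fun s : R => t + s * delta) delta.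
    apply: (is_derive_eq (is_deriveD (is_derive_cst _ _ _) (is_deriveM (is_derive_id _ _) (is_derive_cst _ _ _)))).
    by rewrite add0r scaler0 add0r /GRing.scale/= mulr1.
  have := @is_derive1_comp R G (fun s : R => t + s * delta) s _ _ (dG _ ts) da => dc.
  apply: (is_derive_eq (is_deriveZ delta^-1 dc)).
  by rewrite /GRing.scale/= mulrCA mulVf ?mulr1// gt_eqF.
have meanE (t : R) : -1 < t -> mean (fun s => g (t + s * delta)) = delta^-1 * G (t + delta) - delta^-1 * G t.
  move=> t1; have ts (s : R) : 0 <= s -> -1 < t + s * delta.
    by move=> s0; rewrite (lt_le_trans t1)// lerDl mulr_ge0// ltW.
  have ca : continuous (fun s : R => g (t + s * delta)).
    move=> s; apply: (@continuous_comp _ _ _ (fun s : R => t + s * delta) g); last exact: cg.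
    move: s; apply: continuous_add; first exact: cst_continuous.
    by apply: continuous_mul; [move=> s; exact: cvg_id|exact: cst_continuous].
  have cG (s : R) : 0 <= s -> {for s, continuous (fun s : R => delta^-1 * G (t + s * delta))}.
    move=> s0; have [dd _] := dGc t s (ts s s0).
    by apply: differentiable_continuous; exact/derivable1_diffP.
  rewrite /Rintegral (@continuous_FTC2 R _ (fun s : R => delta^-1 * G (t + s * delta)) 0 1)//.
  - by rewrite mul1r mul0r addr0.
  - exact: continuous_subspaceT.
  - split.
    + by move=> s; rewrite in_itv/= => /andP[s0 _]; have [] := dGc t s (ts s (ltW s0)).
    + by apply: cvg_at_right_filter; exact: cG.
    + by apply: cvg_at_left_filter; exact: cG.
  - move=> s; rewrite in_itv/= => /andP[s0 _]; rewrite derive1E.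
    by have [_ ->] := dGc t s (ts s (ltW s0)).
have dN : is_derive (0 : R) (1 : R) (fun t : R => delta^-1 * G (t + delta) - delta^-1 * G t)
    (delta^-1 * (g delta - g 0)).
  have da : is_derive (0 : R) (1 : R) (fun t : R => t + delta) 1.
    apply: (is_derive_eq (is_deriveD (is_derive_id _ _) (is_derive_cst _ _ _))).
    by rewrite addr0.
  have d1 : is_derive (0 + delta) (1 : R) G (g delta).
    by rewrite add0r; apply: dG; rewrite (lt_trans _ d0)// ltrN10.
  have d2 : is_derive (0 : R) (1 : R) G (g 0) by apply: dG; rewrite ltrN10.
  have := @is_derive1_comp R G (fun t : R => t + delta) 0 _ _ d1 da => dc.
  apply: (is_derive_eq (is_deriveB (is_deriveZ delta^-1 dc) (is_deriveZ delta^-1 d2))).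
  by rewrite /GRing.scale/= mulr1 mulrBr.
have e : {near (0 : R), (fun t : R => delta^-1 * G (t + delta) - delta^-1 * G t) =1
    (fun t => mean (fun s => g (t + s * delta)))}.
  apply/near_ballP; exists 1 => // t; rewrite subr0 ltr_norml => /andP[t1 _].
  by rewrite meanE.
exact: (near_eq_is_derive e).
Qed.

End unit_interval_mean.

Section directional.
Context {R : realType} {V : normedModType R}.

Lemma is_derive_line (f : V -> R) x v df :
  is_derive x v f df <-> is_derive (0 : R) 1 (fun t => f (x + t *: v)) df.
Proof.
have f0 : f x = f (x + 0) by rewrite addr0.
have E : (fun h : R => h^-1 *: ((f \o shift x) (h *: v) - f x)) =
    (fun h : R => h^-1 *: (((fun t => f (x + t *: v)) \o shift 0) (h *: 1) - f (x + 0 *: v))).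
  apply/funext => h; rewrite /= scale0r addr0; congr (_ *: (f _ - f _)).
    by rewrite addrC; congr (_ + _ *: _); rewrite /GRing.scale/= mulr1.
  by rewrite addr0.
by split=> -[h1 h2]; split; rewrite /derivable /derive ?E// -?E.
Qed.

End directional.

Definition is_lipschitz {R : realType} {V : normedModType R} (L : R) (f : V -> R) :=
  forall x y, `|f x - f y| <= L * `|x - y|.

Lemma is_lipschitz_continuous {R : realType} {V : normedModType R} (L : R) (f : V -> R) :
  0 <= L -> is_lipschitz L f -> continuous f.
Proof.
move=> L0 Lf x; apply/cvgrPdist_lt => e e0.
have : \forall y \near x, `|f x - f y| < e.
  apply/near_ballP; exists (e / (L + 1)); first by rewrite divr_gt0// ltr_wpDl.
  move=> y; rewrite distrC ltr_pdivlMr ?ltr_wpDl// => yx.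
  apply: (le_lt_trans (Lf x y)); apply: le_lt_trans yx.
  by rewrite mulrC ler_wpM2l// lerDl.
by [].
Qed.

Section box_average.
Context {R : realType} {d : nat}.
Implicit Types (f : 'rV[R]_d -> R) (x y : 'rV[R]_d) (i j : 'I_d) (delta L : R).
Local Notation e i := (delta_mx 0 i : 'rV[R]_d).
Local Notation mean h := (\int[@lebesgue_measure R]_(s in `[0, 1]) h s).

Definition avg delta i f x : R := mean (fun s : R => f (x + (s * delta) *: e i)).

(** One average per coordinate direction turns a Lipschitz function into a C^1 function with the
    same Lipschitz constant, and adds only a constant where the function is affine. *)
Definition avgs delta (r : seq 'I_d) f := foldr (avg delta) f r.

Lemma norm_delta_le1 i : `|e i| <= 1.
Proof.
rewrite [leLHS]mx_normrE; apply: bigmax_le => // -[k l] _ /=.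
by rewrite mxE normr_nat; case: (_ && _).
Qed.

Lemma avg_dist delta i x (s : R) : 0 <= delta -> 0 <= s <= 1 ->
  `|x + (s * delta) *: e i - x| <= delta.
Proof.
move=> d0 /andP[s0 s1]; rewrite addrAC subrr add0r normrZ ger0_norm ?mulr_ge0//.
rewrite (le_trans (ler_wpM2l _ (norm_delta_le1 i))) ?mulr_ge0// mulr1.
by rewrite ler_piMl.
Qed.

Lemma line_continuous f x v : continuous f -> continuous (fun t : R => f (x + t *: v)).
Proof.
move=> cf t; apply: (@continuous_comp _ _ _ (fun t : R => x + t *: v) f); last exact: cf.
apply: (@continuousD _ _ _ (fun=> x) (fun t : R => t *: v)); first exact: cst_continuous.
by apply: continuousZr_tmp.
Qed.

Lemma avg_arg_continuous delta i f x : continuous f ->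
  continuous (fun s : R => f (x + (s * delta) *: e i)).
Proof.
move=> cf; rewrite (_ : (fun s : R => _) = fun s : R => f (x + s *: (delta *: e i))).
  exact: line_continuous.
by apply/funext => s; rewrite scalerA.
Qed.

Lemma avg_lipschitz delta i f L : 0 <= L -> is_lipschitz L f -> is_lipschitz L (avg delta i f).
Proof.
move=> L0 Lf x y; have cf := is_lipschitz_continuous L0 Lf.
have := mean_lin (-1) (@avg_arg_continuous delta i f y cf) (@avg_arg_continuous delta i f x cf).
rewrite mulN1r addrC /avg => <-; rewrite -[X in `|X|]subr0; apply: mean_near.
  apply: continuous_add; last exact: avg_arg_continuous.
  by apply: continuous_mul; [exact: cst_continuous|exact: avg_arg_continuous].
move=> s _; rewrite subr0 mulN1r addrC (le_trans (Lf _ _))//.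
by rewrite opprD addrACA subrr addr0.
Qed.

Lemma avgs_lipschitz delta r f L : 0 <= L -> is_lipschitz L f -> is_lipschitz L (avgs delta r f).
Proof. by move=> L0 Lf; elim: r => //= i r; exact: avg_lipschitz. Qed.

Lemma avgs_close delta r f L x : 0 <= delta -> 0 <= L -> is_lipschitz L f ->
  `|avgs delta r f x - f x| <= (size r)%:R * (L * delta).
Proof.
move=> d0 L0 Lf; elim: r x => [|i r IHr] x /=; first by rewrite subrr normr0 mul0r.
apply: mean_near.
  apply: avg_arg_continuous; apply: (is_lipschitz_continuous L0).
  exact: avgs_lipschitz.
move=> s s01; set y := x + _; rewrite -(subrK (f y) (avgs _ _ _ _)) -addrA.
rewrite (le_trans (ler_normD _ _))// -natr1 mulrDl mul1r lerD//.
by rewrite (le_trans (Lf _ _))// ler_wpM2l// avg_dist.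
Qed.

(* Each averaging step looks at distance at most [delta]. *)
Lemma avgs_local delta r f L (c : R) (w : 'I_d -> R) x (rho : R) :
  0 <= delta -> 0 <= L -> is_lipschitz L f -> (size r)%:R * delta <= rho ->
  (forall y, `|y - x| <= rho -> f y = c + \sum_i w i * y 0 i) ->
  exists c', forall y, `|y - x| <= rho - (size r)%:R * delta ->
    avgs delta r f y = c' + \sum_i w i * y 0 i /\ ((forall i, w i = 0) -> c' = c).
Proof.
move=> d0 L0 Lf; elim: r => [|i r IHr] /= rrho fE.
  by exists c => y; rewrite mul0r subr0 => /fE.
have rrho' : (size r)%:R * delta <= rho.
  by rewrite (le_trans _ rrho)// ler_wpM2r// ler_nat.
have [c' c'E] := IHr rrho' fE.
exists (c' + w i * delta * mean (fun s : R => s)) => y yx; split; last first.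
  move=> w0; rewrite w0 !mul0r addr0; apply: (c'E y _).2 => //.
  by rewrite (le_trans yx)// lerD2l lerN2 ler_wpM2r// ler_nat.
have cl : continuous (fun s : R => c' + \sum_i w i * y 0 i) by exact: cst_continuous.
have ci : continuous (fun s : R => s) by move=> s; exact: cvg_id.
have := mean_lin (w i * delta) ci cl.
rewrite mean_cst => M; rewrite addrAC addrC -M; apply: eq_Rintegral => s /set_mem.
rewrite /= in_itv /= => s01; rewrite (c'E _ _).1; last first.
  rewrite (_ : _ - x = (y + (s * delta) *: e i - y) + (y - x)); last by rewrite subrKA.
  rewrite (le_trans (ler_normD _ _))//.
  have := avg_dist i y d0 s01; move: yx; rewrite -natr1 mulrDl mul1r; lra.
rewrite [RHS]addrCA; congr (_ + _).
rewrite (eq_bigr (fun k => w k * y 0 k + w k * ((s * delta) *: e i) 0 k)); last first.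
  by move=> k _; rewrite -mulrDr mxE.
rewrite big_split addrC; congr (_ + _).
rewrite (bigD1 i)//= big1 ?addr0; last by move=> j ji; rewrite !mxE (negbTE ji) andbF !mulr0.
by rewrite !mxE !eqxx mulr1 mulrA [RHS]mulrC mulrCA mulrA.
Qed.

Lemma avg_derive_same delta i f x : 0 < delta -> continuous f ->
  is_derive x (e i) (avg delta i f) (delta^-1 * (f (x + delta *: e i) - f x)).
Proof.
move=> d0 cf; apply/is_derive_line.
have := mean_derive (line_continuous (x := x) (v := e i) cf) d0.
rewrite scale0r addr0; congr is_derive; apply/funext => t; apply: eq_Rintegral => s _.
by rewrite -addrA -scalerDl.
Qed.

(** Averaging in another direction commutes with the derivative; the bound L on [f'] is the
    dominating function for differentiation under the integral. *)
Lemma avg_derive_other delta i j f f' L x :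
  continuous f -> continuous f' -> (forall y, `|f' y| <= L) ->
  (forall y, is_derive y (e i) f (f' y)) ->
  is_derive x (e i) (avg delta j f) (avg delta j f' x).
Proof.
move=> cf cf' f'L df; apply/is_derive_line.
pose F (t s : R) := f (x + t *: e i + (s * delta) *: e j).
have dF t s : is_derive t (1 : R) (F ^~ s) (f' (x + t *: e i + (s * delta) *: e j)).
  apply/is_derive_line; have /is_derive_line := df (x + t *: e i + (s * delta) *: e j).
  congr is_derive; apply/funext => h; rewrite /F; congr f.
  by rewrite [h *: 1]mulr1; apply/rowP => k; rewrite !mxE /=; ring.
have dFE t s : partial1of2 F t s = f' (x + t *: e i + (s * delta) *: e j).
  by rewrite partial1of2E; have [_ ->] := dF t s.
have B01 : measurable (`[0, 1] : set R) by exact: measurable_itv.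
have := @cvg_differentiation_under_integral R _ _ (@lebesgue_measure R) F `[0, 1] B01
  0 (-1) 1 _ _ _ (fun=> L) _ _ _.
have h0 : `](-1), 1[%classic (0 : R) by rewrite /= in_itv/= ltrN10 ltr01.
have hint t : `](-1), 1[%classic t -> (@lebesgue_measure R).-integrable `[0, 1] (EFin \o F t).
  by move=> _; apply: mean_integrable; exact: avg_arg_continuous.
have hder t s : `](-1), 1[%classic t -> `[0, 1]%classic s -> derivable (F ^~ s) t 1.
  by move=> _ _; have [] := dF t s.
have hL : forall s : R, 0 <= L by move=> _; exact: le_trans (normr_ge0 _) (f'L 0).
have hiL : (@lebesgue_measure R).-integrable `[0, 1] (EFin \o (fun=> L)).
  by apply: mean_integrable; exact: cst_continuous.
have hb t s : `](-1), 1[%classic t -> `[0, 1]%classic s -> `|partial1of2 F t s| <= L.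
  by move=> _ _; rewrite dFE.
move=> /(_ h0 hint hder hL hiL hb) h.
have {}h : h^-1 *: (((fun t : R => avg delta j f (x + t *: e i)) \o shift 0) (h *: 1)
    - avg delta j f (x + 0 *: e i)) @[h --> 0^'] --> avg delta j f' x.
  rewrite (_ : avg delta j f' x = \int[lebesgue_measure]_(s in `[0, 1]) partial1of2 F 0 s).
    move: h; rewrite [X in X @ _ --> _ -> _](_ : _ =
      (fun h : R => h^-1 *: (((fun t : R => avg delta j f (x + t *: e i)) \o shift 0) (h *: 1)
    - avg delta j f (x + 0 *: e i))))//.
    apply/funext => h; rewrite /= !addr0 [h *: 1]mulr1; congr (_ *: (_ - _)).
  by apply: eq_Rintegral => s _; rewrite dFE scale0r addr0.
split; first by apply/cvg_ex; exists (avg delta j f' x).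
by apply/cvg_lim.
Qed.

(** The outermost average in direction i produces a difference quotient, and the averages applied
    after it, all in other directions, merely average that quotient. *)
Lemma avgs_derive delta r f L i : 0 < delta -> 0 <= L -> is_lipschitz L f -> i \in r ->
  exists h, [/\ continuous h, forall x, `|h x| <= L &
    forall x, is_derive x (e i) (avgs delta r f) (h x)].
Proof.
move=> d0 L0 Lf ir.
(* The induction carries a Lipschitz bound [L'], which may blow up with 1/delta, because it survives
   averaging and gives continuity. *)
suff [h [L' [L'0 Lh hL dh]]] : exists h L', [/\ 0 <= L', is_lipschitz L' h,
    forall x, `|h x| <= L & forall x, is_derive x (e i) (avgs delta r f) (h x)].
  by exists h; split=> //; exact: (is_lipschitz_continuous L'0).
elim: r ir => [//|j r IHr]; rewrite inE.
have Lg : is_lipschitz L (avgs delta r f) by exact: avgs_lipschitz.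
have cg := is_lipschitz_continuous L0 Lg.
have [<- _|ij /= ir] := eqVneq i j.
  exists (fun x => delta^-1 * (avgs delta r f (x + delta *: e i) - avgs delta r f x)).
  exists (delta^-1 * (L + L)); split.
  - by rewrite mulr_ge0// ?addr_ge0// invr_ge0 ltW.
  - move=> x y; rewrite -mulrBr normrM normfV (gtr0_norm d0).
    apply: (@le_trans _ _ (delta^-1 * ((L + L) * `|x - y|))); last by rewrite mulrA.
    rewrite ler_wpM2l ?invr_ge0 ?(ltW d0)//.
    set g := avgs delta r f.
    rewrite (_ : g _ - g x - _ = (g (x + delta *: e i) - g (y + delta *: e i)) + (g y - g x)).
      rewrite (le_trans (ler_normD _ _))// mulrDl lerD//.
        by rewrite (le_trans (Lg _ _))// opprD addrACA subrr addr0.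
      by rewrite [`|x - y|]distrC Lg.
    by ring.
  - move=> x; rewrite normrM normfV (gtr0_norm d0) ler_pdivrMl// mulrC.
    rewrite (le_trans (Lg _ _))// ler_wpM2l// addrAC subrr add0r normrZ (gtr0_norm d0).
    by rewrite ler_piMr ?norm_delta_le1 ?ltW.
  - by move=> x; exact: avg_derive_same.
have [h [L' [L'0 Lh hL dh]]] := IHr ir; have ch := is_lipschitz_continuous L'0 Lh.
exists (avg delta j h), L'; split=> //; first exact: avg_lipschitz.
- move=> x; rewrite -[X in `|X|]subr0; apply: mean_near; first exact: avg_arg_continuous.
  by move=> s _; rewrite subr0.
- by move=> x; exact: (@avg_derive_other delta i j (avgs delta r f) h L x cg ch hL dh).
Qed.

End box_average.

(** * Lipschitz functions in H^1_0 *)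

Section lipschitz_H10.
Context {R : realType} {d : nat}.
Local Notation e i := (delta_mx 0 i : 'rV[R]_d).
Implicit Types (f u v : 'rV[R]_d -> R) (x y : 'rV[R]_d).

Lemma ae_mono (P Q : borelRn d -> Prop) :
  {ae (lebesgueRn (R := R) (n := d)), forall x, P x} -> (forall x, P x -> Q x) ->
  {ae (lebesgueRn (R := R) (n := d)), forall x, Q x}.
Proof. by move=> [A [mA A0 PA]] PQ; exists A; split=> // x nQ; apply: PA => /PQ. Qed.

Lemma max_sub0_close (a b : R) : 0 <= a -> 0 <= b -> `|Num.max (a - b) 0 - a| <= b.
Proof.
move=> a0 b0; have [h|h] := lerP (a - b) 0; rewrite ler_norml; apply/andP; split; lra.
Qed.

Section bounded_open.
Variables (Omega : set 'rV[R]_d) (r : R).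
Hypotheses (oO : open Omega) (bO : forall x, Omega x -> `|x| <= r).

Let mO : measurable (Omega : set (borelRn d)).
Proof. exact: measurable_open_Rn. Qed.

Let finO : (lebesgueRn (Omega : set (borelRn d)) < +oo)%E.
Proof. exact: lebesgueRn_bounded mO bO. Qed.

Lemma cst_integrable (c : R) : (lebesgueRn (n := d)).-integrable Omega (cst c%:E).
Proof.
apply: (@measurable_bounded_integrable _ (borelRn d) R lebesgueRn (cst c)) => //.
by exists `|c|; split=> [|M cM y _]; [exact: num_real|exact: ltW].
Qed.

Lemma bounded_L2 u (M : R) :
  measurable_fun (Omega : set (borelRn d)) (u : borelRn d -> R) ->
  (forall x, Omega x -> `|u x| <= M) -> L2_on Omega u.
Proof.
move=> mu uM; split=> //.
apply: (@le_lt_trans _ _ (\int[lebesgueRn]_(x in Omega) (M ^+ 2)%:E)%E).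
  apply: ge0_le_integral => //.
  - by move=> x _; rewrite lee_fin sqr_ge0.
  - by apply/measurable_EFinP; exact: measurable_funX.
  - move=> x /uM ux; rewrite lee_fin -real_normK ?num_real//.
    by rewrite lerXn2r ?nnegrE// (le_trans _ ux).
rewrite integral_cst// lte_mul_pinfty//.
by rewrite lee_fin sqr_ge0.
Qed.

Lemma L2_cvg_dominated (f : nat -> 'rV[R]_d -> R) u (M : R) :
  (forall n, measurable_fun (Omega : set (borelRn d)) (f n : borelRn d -> R)) ->
  measurable_fun (Omega : set (borelRn d)) (u : borelRn d -> R) ->
  (forall n x, Omega x -> `|f n x - u x| <= M) ->
  {ae (lebesgueRn (n := d)), forall x, Omega x -> f n x @[n --> \oo] --> u x} ->
  L2_cvg Omega f u.
Proof.
move=> mf mu fM fu; rewrite /L2_cvg.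
have mfu n : measurable_fun (Omega : set (borelRn d))
    (fun x : borelRn d => ((f n x - u x) ^+ 2)%:E).
  by apply/measurable_EFinP; apply: measurable_funX; exact: measurable_funB.
have cv : {ae (lebesgueRn (n := d)), forall x : borelRn d, Omega x ->
    ((f n x - u x) ^+ 2)%:E @[n --> \oo] --> cst 0%E x}.
  apply: ae_mono fu _ => x fux Ox; apply: cvg_EFin; first exact: nearW.
  have h0 : f n x - u x @[n --> \oo] --> (0 : R) by apply/subr_cvg0; exact: fux.
  have h2 := cvgM h0 h0; rewrite mulr0 in h2.
  rewrite (_ : fine \o _ = fun n => (f n x - u x) * (f n x - u x)); first exact: h2.
  by apply/funext => n; rewrite /= expr2.
have bd : {ae (lebesgueRn (n := d)), forall (x : borelRn d) n, Omega x ->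
    (`|((f n x - u x) ^+ 2)%:E| <= cst (M ^+ 2)%:E x)%E}.
  apply: aeW => x n Ox; rewrite gee0_abs ?lee_fin ?sqr_ge0//.
  rewrite /cst -real_normK ?num_real// lerXn2r ?nnegrE//; last exact: fM.
  by rewrite (le_trans _ (fM n x Ox)).
have [_ _] := @dominated_convergence _ (borelRn d) R lebesgueRn Omega mO
  (fun n x => ((f n x - u x) ^+ 2)%:E) (cst 0%E) (cst (M ^+ 2)%:E) mfu
  (measurable_cst _) cv (cst_integrable _) bd.
by rewrite integral0.
Qed.

Variables (phi : 'rV[R]_d -> R) (L : R) (g : 'I_d -> 'rV[R]_d -> R) (G : R).
Hypotheses (L0 : 0 <= L) (Lphi : is_lipschitz L phi) (phi0 : forall x, 0 <= phi x).
Hypothesis phiO : forall x, 0 < phi x -> Omega x.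
Hypothesis mg : forall i, measurable_fun (Omega : set (borelRn d)) (g i : borelRn d -> R).
Hypothesis gG : forall i x, Omega x -> `|g i x| <= G.
Hypothesis g_grad : {ae (lebesgueRn (n := d)), forall x, Omega x ->
  exists (rho c : R), [/\ 0 < rho, forall i, phi x = 0 -> g i x = 0 &
    forall y, `|y - x| <= rho -> phi y = c + \sum_i g i x * y 0 i]}.

Let eps n : R := n.+1%:R^-1.
(** Chosen so that all d averages together move values by at most [d * L * delta n <= eps n / 2];
    [d.+1] and [L + 1] keep the denominator positive. *)
Let delta n : R := eps n / (2 * d.+1%:R * (L + 1)).
(** Lowering phi by [eps n] provides the margin for averaging: the result vanishes wherever
    [phi x < eps n / 2], so its support is compact in Omega. *)
Let cut n x := Num.max (phi x - eps n) 0.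
Let smooth n := avgs (delta n) (enum 'I_d) (cut n).

Let eps0 n : 0 < eps n. Proof. by rewrite invr_gt0. Qed.

Let L1 : 0 < L + 1. Proof. by rewrite ltr_wpDl. Qed.

Let delta0 n : 0 < delta n.
Proof. by rewrite divr_gt0// !mulr_gt0. Qed.

Let szE : (size (enum 'I_d))%:R = d%:R :> R. Proof. by rewrite size_enum_ord. Qed.

Let delta_eps n : d%:R * (L * delta n) <= eps n / 2.
Proof.
have dE : (d.+1%:R * (L + 1)) * delta n = eps n / 2.
  have a0 : d.+1%:R != 0 :> R by rewrite pnatr_eq0.
  have b0 : L + 1 != 0 by rewrite gt_eqF.
  rewrite /delta; move: (d.+1%:R) (L + 1) (eps n) a0 b0 => a b c a0 b0.
  by field; rewrite a0 b0.
rewrite -dE mulrA ler_wpM2r ?(ltW (delta0 n))// ler_pM//.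
  by rewrite ler_nat.
by rewrite lerDl.
Qed.

Let cutL n : is_lipschitz L (cut n).
Proof.
move=> x y; apply: le_trans (Lphi x y).
have H a b : Num.max (a - eps n) 0 - Num.max (b - eps n) 0 <= `|a - b|.
  have := ler_norm (a - b); have := normr_ge0 (a - b); rewrite /Num.max.
  by case: ltP => ?; case: ltP => ?; lra.
by rewrite /cut ler_norml lerNl opprB H distrC H.
Qed.

Let cut_close n x : `|cut n x - phi x| <= eps n.
Proof.
by apply: max_sub0_close => //; exact: ltW. Qed.

Let smooth_close n x : `|smooth n x - phi x| <= 2 * eps n.
Proof.
rewrite -(subrK (cut n x) (smooth n x)) -addrA (le_trans (ler_normD _ _))//.
have := cut_close n x; have := avgs_close (enum 'I_d) x (ltW (delta0 n)) L0 (cutL n).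
by rewrite szE => h1 h2; have := delta_eps n; have := eps0 n; rewrite /smooth; lra.
Qed.

(** Within the reach of the averages the cut function is identically 0, which is the case of zero
    slope and zero constant in [avgs_local]. *)
Let smooth_support n x : phi x < eps n / 2 -> smooth n x = 0.
Proof.
move=> phix; have := @avgs_local R d (delta n) (enum 'I_d) (cut n) L 0 (fun=> 0) x
  (d%:R * delta n) (ltW (delta0 n)) L0 (cutL n).
rewrite szE lexx => /(_ isT)[|c'].
  move=> y yx; rewrite big1 ?addr0; last by move=> i _; rewrite mul0r.
  have : phi y - phi x <= L * (d%:R * delta n).
    rewrite (le_trans (ler_norm _))// (le_trans (Lphi _ _))// ler_wpM2l//.
  rewrite mulrCA /cut /Num.max => h; have := delta_eps n.
  by case: ltP => // ?; lra.
move=> h; have [|xE c0] := h x; first by rewrite !subrr normr0.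
by rewrite /smooth xE c0// big1 ?addr0// => i _; rewrite mul0r.
Qed.

Let smoothL n : is_lipschitz L (smooth n).
Proof. exact: avgs_lipschitz. Qed.

Let smooth_derive n i : exists h, [/\ continuous h, forall x, `|h x| <= L &
  forall x, is_derive x (e i) (smooth n) (h x)].
Proof. by apply: avgs_derive => //; rewrite mem_enum. Qed.

Let smooth_C1c n : C1c Omega (smooth n).
Proof.
have cphi := is_lipschitz_continuous L0 Lphi.
split.
- exists [set x | eps n / 2 <= phi x]; split.
  + apply: bounded_closed_compact.
      exists r; split; first exact: num_real.
      move=> M rM x /= px; apply: le_trans (ltW rM); apply: bO; apply: phiO.
      by rewrite (lt_le_trans _ px)// divr_gt0.
    apply: (@closed_comp _ _ phi [set t | eps n / 2 <= t]); last exact: closed_ge.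
    by move=> x _; exact: cphi.
  + by move=> x /= px; apply: phiO; rewrite (lt_le_trans _ px)// divr_gt0.
  + by move=> x /= /negP; rewrite -ltNge => /smooth_support.
- exact: (is_lipschitz_continuous L0 (smoothL n)).
- by move=> i x; have [h [_ _ dh]] := smooth_derive n i; have [] := dh x.
- move=> i; have [h [ch _ dh]] := smooth_derive n i.
  by rewrite (_ : 'D_(e i) (smooth n) = h)//; apply/funext => x; have [] := dh x.
Qed.

Let deriv_bound n i x : `|'D_(e i) (smooth n) x| <= L.
Proof. by have [h [_ hL dh]] := smooth_derive n i; have [_ ->] := dh x. Qed.

Let cvg_eps : eps n @[n --> \oo] --> (0 : R).
Proof. exact: cvg_harmonic. Qed.

(** Where phi is affine near x the approximations eventually have exactly its gradient at x:
    lowering and averaging change only the constant term. Pointwise convergence of the derivatives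
    is thus stationary. *)
Let smooth_grad x rho c i : 0 < rho -> (forall i, phi x = 0 -> g i x = 0) ->
  (forall y, `|y - x| <= rho -> phi y = c + \sum_i g i x * y 0 i) ->
  \forall n \near \oo, 'D_(e i) (smooth n) x = g i x.
Proof.
move=> rho0 gx0 phiE.
have [rho' [c'' [n0 [rho'0 cutE]]]] : exists rho' c'' (n0 : nat), 0 < rho' /\
    forall n y, (n0 <= n)%N -> `|y - x| <= rho' ->
    cut n y = c'' n + \sum_i g i x * y 0 i.
  (* If [phi x = 0] the gradient is 0 too, so phi and all its cuts vanish near x. Otherwise the cut
     is inactive near x as soon as [eps n < phi x / 2]. *)
  have [px|px] := eqVneq (phi x) 0.
    exists rho, (fun=> 0), 0%N; split=> // n y _ yx.
    rewrite big1 ?addr0; last by move=> j _; rewrite gx0// mul0r.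
    rewrite /cut phiE// big1 ?addr0; last by move=> j _; rewrite gx0// mul0r.
    have := phiE x; rewrite subrr normr0 => /(_ (ltW rho0)).
    rewrite big1 ?addr0 ?px; last by move=> j _; rewrite gx0// mul0r.
    by move=> <-; rewrite sub0r; apply: max_r; rewrite oppr_le0 ltW.
  have {}px : 0 < phi x by rewrite lt_neqAle eq_sym px phi0.
  have [n0 n0P] : exists n0, forall n, (n0 <= n)%N -> eps n < phi x / 2.
    have h : 0 < phi x / 2 by rewrite divr_gt0.
    have [n0 _ hn0] : \forall n \near \oo, eps n < phi x / 2.
      by apply: (cvgr_lt (0 : R)) => //; exact: cvg_eps.
    by exists n0 => n n0n; exact: hn0.
  exists (Num.min rho (phi x / (2 * (L + 1)))), (fun n => c - eps n), n0; split.
    by rewrite lt_min rho0 divr_gt0// mulr_gt0.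
  move=> n y n0n; rewrite le_min => /andP[y1 y2].
  have : phi x - phi y <= phi x / 2.
    rewrite (le_trans (ler_norm _))// (le_trans (Lphi _ _))// distrC.
    rewrite (le_trans (ler_wpM2l L0 y2))// mulrA ler_pdivrMr ?mulr_gt0//.
    rewrite (_ : phi x / 2 * (2 * (L + 1)) = phi x * (L + 1)); last by field.
    by rewrite mulrC ler_wpM2l ?ltW// ltrDl.
  move=> h; have := n0P n n0n => h'.
  rewrite /cut max_l; first by rewrite phiE// addrAC.
  by rewrite subr_ge0; lra.
have [n1 _ hn1] : \forall n \near \oo, eps n < rho'.
  by apply: (cvgr_lt (0 : R)) => //; exact: cvg_eps.
exists (maxn n0 n1) => // n /=; rewrite geq_max => /andP[n0n n1n].
have drho : d%:R * delta n < rho'.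
  apply: le_lt_trans (hn1 n n1n); rewrite /delta mulrCA ler_piMr ?(ltW (eps0 n))//.
  rewrite ler_pdivrMr ?mulr_gt0// mul1r.
  have h1 : (d%:R : R) <= d.+1%:R by rewrite ler_nat.
  apply: (le_trans h1); rewrite -[leLHS]mulr1 ler_pM//; last by rewrite lerDr.
  by rewrite ler_peMl// ler1n.
have := @avgs_local R d (delta n) (enum 'I_d) (cut n) L (c'' n) (fun i => g i x) x
  rho' (ltW (delta0 n)) L0 (cutL n).
rewrite szE (ltW drho) => /(_ isT)[|c3 smE]; first by move=> y; exact: cutE.
have nearE : \forall y \near x,
    (fun y : 'rV[R]_d => c3 + \sum_i g i x * y 0 i) y = smooth n y.
  apply/near_ballP; exists (rho' - d%:R * delta n); first by rewrite subr_gt0.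
  by move=> y /ltW yx; have [] := smE y yx.
have dl : is_derive x (e i) (fun y : 'rV[R]_d => c3 + \sum_i g i x * y 0 i) (g i x).
  apply/is_derive_line.
  rewrite (_ : (fun t : R => _) = fun t : R => (c3 + \sum_i g i x * x 0 i) + t * g i x).
    apply: (is_derive_eq (is_deriveD (is_derive_cst _ _ _)
      (is_deriveM (is_derive_id _ _) (is_derive_cst _ _ _)))).
    by rewrite add0r scaler0 add0r /GRing.scale/= mulr1.
  apply/funext => t; rewrite -addrA; congr (_ + _).
  rewrite (eq_bigr (fun k => g k x * x 0 k + g k x * (t *: e i) 0 k)); last first.
    by move=> k _; rewrite -mulrDr mxE.
  rewrite big_split; congr (_ + _).
  rewrite (bigD1 i)//= big1 ?addr0; last by move=> j ji; rewrite !mxE (negbTE ji) andbF !mulr0.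
  by rewrite !mxE !eqxx mulr1 mulrC.
by have [_ ->] := near_eq_is_derive nearE dl.
Qed.

(** Both the functions and their derivatives are uniformly bounded on a bounded set, so pointwise
    and almost everywhere convergence upgrade to L^2 convergence by domination. *)
Lemma lipschitz_H10 : H10 Omega phi.
Proof.
have cphi := is_lipschitz_continuous L0 Lphi.
have mphi : measurable_fun (Omega : set (borelRn d)) (phi : borelRn d -> R).
  exact: measurable_test.
have msm n : measurable_fun (Omega : set (borelRn d)) (smooth n : borelRn d -> R).
  by apply: measurable_test => //; have [] := smooth_C1c n.
split.
  have [x0|O0] := pselect (exists x, Omega x); last first.
    apply: (bounded_L2 (M := 0)) => // x Ox; exfalso; apply: O0; by exists x.
  have [x Ox] := x0.
  apply: (bounded_L2 (M := phi x + L * (r + r))) => // y Oy.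
  rewrite ger0_norm// -lerBlDl (le_trans (ler_norm _))// (le_trans (Lphi _ _))//.
  by rewrite ler_wpM2l// (le_trans (ler_normB _ _))// lerD// bO.
exists smooth, g; split.
- exact: smooth_C1c.
- apply: (L2_cvg_dominated (M := 2)) => //.
    move=> n x _; rewrite (le_trans (smooth_close n x))// ler_piMr//.
    by rewrite invf_le1// ler1n.
  apply: aeW => x _; apply/cvgrPdist_le => a a0.
  have a20 : 0 < a / 2 by rewrite divr_gt0.
  have [n0 _ hn0] : \forall n \near \oo, eps n < a / 2.
    by apply: (cvgr_lt (0 : R)) => //; exact: cvg_eps.
  exists n0 => // n /= n0n; rewrite distrC (le_trans (smooth_close n x))//.
  by have := hn0 n n0n; rewrite /= ; lra.
- by move=> i; apply: (bounded_L2 (M := G)) => // x; exact: gG.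
- move=> i; apply: (L2_cvg_dominated (M := L + G)) => //.
  + move=> n; apply: measurable_test => //.
    by have [_ _ _] := smooth_C1c n; exact.
  + move=> n x Ox; rewrite (le_trans (ler_normB _ _))// lerD//; exact: gG.
  + apply: ae_mono g_grad _ => x gx Ox.
    have [rho [c [rho0 gx0 phiE]]] := gx Ox.
    have h := smooth_grad i rho0 gx0 phiE.
    exact: cvg_near_cst h.
Qed.

End bounded_open.
End lipschitz_H10.

(** * Nodal functions *)

Section lipschitz_tools.
Context {R : realType}.

(* A real function on a segment which is locally [L]-Lipschitz at every point
   cannot leave the cone of slope [L] (supremum argument). *)
Lemma local_lipschitz (V : normedModType R) (f : V -> R) (L : R) : 0 <= L ->
  (forall z, \forall q \near z, `|f q - f z| <= L * `|q - z|) -> is_lipschitz L f.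
Proof.
move=> L0 locf x y.
pose g (t : R) := y + t *: (x - y).
have gcont : continuous g.
  move=> t; apply: (@continuousD _ _ _ (fun=> y) (fun t : R => t *: (x - y))).
    exact: cst_continuous.
  exact: continuousZr_tmp.
have gB s t : `|g s - g t| = `|s - t| * `|x - y|.
  by rewrite /g opprD addrACA subrr add0r -scalerBl normrZ.
have loc t : exists2 e : R, 0 < e & forall s, `|s - t| < e ->
    `|f (g s) - f (g t)| <= L * `|x - y| * `|s - t|.
  have /near_ballP[e e0 h] : \forall s \near t, `|f (g s) - f (g t)| <= L * `|g s - g t|.
    exact: (gcont t _ (locf (g t))).
  exists e => // s /h; rewrite gB.
  by have -> : L * (`|s - t| * `|x - y|) = L * `|x - y| * `|s - t| by rewrite mulrCA mulrC.
pose A := [set t : R | [/\ 0 <= t, t <= 1 & `|f (g t) - f y| <= L * `|x - y| * t]].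
have A0 : A 0 by split=> //; rewrite /g scale0r addr0 subrr normr0 mulr0.
have supA : has_sup A by split; [exists 0|exists 1 => t []].
pose t0 := sup A.
have t00 : 0 <= t0 by apply: ub_le_sup => //; exact: supA.2.
have t01 : t0 <= 1 by apply: ge_sup => [|t []//]; exists 0.
have Lxy : 0 <= L * `|x - y| by exact: mulr_ge0.
have step s t : s <= t -> `|f (g t) - f (g s)| <= L * `|x - y| * `|t - s| ->
    `|f (g s) - f y| <= L * `|x - y| * s -> `|f (g t) - f y| <= L * `|x - y| * t.
  move=> st h1 h2; rewrite -(subrK (f (g s)) (f (g t))) -addrA.
  rewrite (le_trans (ler_normD _ _))//; have ts : `|t - s| = t - s by rewrite ger0_norm// subr_ge0.
  rewrite ts in h1.
  by move: h1 h2; rewrite mulrBr; lra.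
have At0 : A t0.
  split=> //; have [e e0 h] := loc t0.
  have [t [t0' t1' Ht] rt] := sup_adherent e0 supA.
  have tt0 : t <= t0 by apply: ub_le_sup; [exact: supA.2|].
  apply: (step t) => //; rewrite distrC [`|t0 - t|]distrC; apply: h.
  by rewrite ler0_norm ?subr_le0// opprB; rewrite -/t0 in rt; lra.
have [t01'|] := eqVneq t0 1.
  by have [_ _] := At0; rewrite t01' mulr1 /g scale1r (addrC y) subrK.
move=> t0n1; have t0lt1 : t0 < 1 by rewrite lt_neqAle t0n1.
have [e e0 h] := loc t0; pose t := t0 + Num.min (e / 2) (1 - t0).
have m0 : 0 < Num.min (e / 2) (1 - t0) by rewrite lt_min divr_gt0// subr_gt0.
exfalso; have : t <= t0.
  apply: ub_le_sup; first exact: supA.2.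
  split; first by rewrite addr_ge0// ltW.
    by rewrite /t -lerBrDl ge_min lexx orbT.
  apply: (step t0); first by rewrite lerDl ltW.
    apply: h; rewrite /t addrAC subrr add0r gtr0_norm// gt_min.
    by rewrite ltr_pdivrMr// ltr_pMr// ltr1n.
  by have [] := At0.
by rewrite /t gerDl leNgt m0.
Qed.

Lemma coord_le_norm d (x : 'rV[R]_d) i : `|x 0 i| <= `|x|.
Proof. by rewrite [leRHS]mx_normrE; exact: (le_bigmax _ (fun ij => `|x ij.1 ij.2|) (0, i)). Qed.

Lemma affine_coeff d (f : 'rV[R]_d -> R) x : affine f ->
  f x = f 0 + \sum_i (f (delta_mx 0 i) - f 0) * x 0 i.
Proof.
move=> [c [w fE]]; have f0 : f 0 = c.
  by rewrite fE big1 ?addr0// => i _; rewrite mxE mulr0.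
have fe i : f (delta_mx 0 i) - f 0 = w i.
  rewrite f0 fE addrAC subrr add0r (bigD1 i)//= big1 ?addr0; last first.
    by move=> j ji; rewrite mxE (negbTE ji) andbF mulr0.
  by rewrite mxE !eqxx mulr1.
by rewrite fE f0; congr (_ + _); apply: eq_bigr => i _; rewrite -fe f0.
Qed.

Lemma affine_is_lipschitz d (f : 'rV[R]_d -> R) : affine f ->
  exists2 L, 0 <= L & is_lipschitz L f.
Proof.
move=> af; exists (\sum_i `|f (delta_mx 0 i) - f 0|); first by apply: sumr_ge0.
move=> x y; rewrite (affine_coeff x af) (affine_coeff y af) opprD addrACA subrr add0r.
rewrite -sumrB (le_trans (ler_norm_sum _ _ _))// mulr_suml; apply: ler_sum => i _.
rewrite -mulrBr normrM ler_wpM2l//.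
by have := coord_le_norm (x - y) i; rewrite !mxE.
Qed.

End lipschitz_tools.

Section hat_functions.
Context {R : realType} {d : nat} {Omega : polyhedral_domain R d}.
Variable K : triangulation Omega.
Hypothesis d0 : (0 < d)%N.
Local Notation p := (@vert _ _ _ K).
Local Notation E := (elts K).
Local Notation V := 'I_(nvert K).
Local Notation lam := (@bary R d (nvert K) (@vert _ _ _ K)).
Implicit Types (T F : {set V}) (x y z q : 'rV[R]_d) (a u v w b : V).

(** Whichever element [pick] returns, the value is the same by [elt_bary_eq]; the default 0 is the
    extension outside the closure that [in_V] requires. *)
Definition hat a x : R :=
  if [pick T in E | `[< hull p T x >]] is Some T then lam T a x else 0.

Lemma hat_elt a T x : T \in E -> hull p T x -> hat a x = lam T a x.
Proof.
move=> TE Tx; rewrite /hat; case: pickP => [T' /andP[TE' /asboolP Tx']|/(_ T)].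
  exact: elt_bary_eq.
by rewrite TE asboolT.
Qed.

Lemma hat_out a x : ~ closure Omega x -> hat a x = 0.
Proof.
move=> Ox; rewrite /hat; case: pickP => [T' /andP[TE' /asboolP Tx']|//].
by case: Ox; exact: elt_in_closure Tx'.
Qed.

Lemma hat_pos a x : 0 < hat a x -> exists T, [/\ T \in E, hull p T x & 0 < lam T a x].
Proof.
rewrite /hat; case: pickP => [T' /andP[TE' /asboolP Tx'] h|]; last by rewrite ltxx.
by exists T'.
Qed.

Lemma hat_ge0 a x : 0 <= hat a x.
Proof.
rewrite /hat; case: pickP => [T' /andP[TE' /asboolP Tx']|//].
by have /(hull_baryP (card_elt TE') (elt_nondegenerate TE')) := Tx'; exact.
Qed.

(* Contract towards the vertex [a]: the elements containing [x] are exactly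
   those containing the contracted point, which lies in [Omega]. *)
Lemma hat_dom a x : dom Omega (p a) -> 0 < hat a x -> dom Omega x.
Proof.
move=> Oa /hat_pos[T [TE Tx ax]]; have cT := card_elt TE; have iT := elt_nondegenerate TE.
have aT : a \in T by apply: contraTT ax => aT; rewrite bary_out// ltxx.
have [s [s0 s1 Oy]] := near_segment x (dom_near Oa).
pose c q := p a + s *: (q - p a).
have cc : continuous c.
  move=> q; apply: (@continuousD _ _ _ (fun=> p a) (fun q => s *: (q - p a))).
    exact: cst_continuous.
  apply: continuousZl_tmp; apply: (@continuousD _ _ _ id); first exact: cvg_id.
  exact: cst_continuous.
have lamc T' v q : T' \in E -> a \in T' -> lam T' v (c q) = (1 - s) * (a == v)%:R + s * lam T' v q.
  move=> TE' aT'; rewrite affine_comb; last exact: bary_affine.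
  by rewrite (bary_vert (card_elt TE') (elt_nondegenerate TE'))//; ring.
have lam0 T' v q : T' \in E -> hull p T' q -> 0 <= lam T' v q.
  by move=> TE' /(hull_baryP (card_elt TE') (elt_nondegenerate TE')); exact.
have Ty : hull p T (c x).
  apply/(hull_baryP cT iT) => v; rewrite lamc// addr_ge0// mulr_ge0 ?subr_ge0//.
    exact: ltW.
  exact: lam0.
have star T' : T' \in E -> hull p T' (c x) -> hull p T' x /\ a \in T'.
  move=> TE' Ty'.
  have sup v : 0 < lam T v x -> v \in T'.
    move=> vx; apply: (elt_carrier TE TE' Ty Ty'); rewrite lamc//.
    by rewrite ltr_wpDl ?mulr_gt0// mulr_ge0 ?subr_ge0.
  split; last exact: sup.
  apply: (hull_subset (finset.subsetIr T T')).
  apply/(hull_sub_baryP cT iT x (finset.subsetIl T T')); split.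
    by move=> v; exact: lam0.
  move=> v; rewrite inE; have [vT|vT _] := boolP (v \in T); last by rewrite bary_out.
  move=> /= vT'; apply/eqP; rewrite eq_le lam0// andbT leNgt.
  by apply: contra vT' => /sup.
apply: near_closure_dom.
have h1 : \forall q \near x, dom Omega (c q) /\ forall T', T' \in E -> hull p T' (c q) -> hull p T' (c x).
  exact: (cc x _ (near_and (dom_near Oy) (near_elt K (c x)))).
(* Undoing the contraction rescales all coordinates except that of a, whose sign is therefore
   secured separately by continuity. *)
have h2 : \forall q \near x, forall T', T' \in E /\ hull p T' x /\ a \in T' -> 0 < lam T' a q.
  apply: near_forall => T'; have [[TE' [Tx' aT']]|h] := pselect (T' \in E /\ hull p T' x /\ a \in T').
    have : \forall q \near x, 0 < lam T' a q.
      by apply: near_gt; [exact: bary_continuous|rewrite -(elt_bary_eq a TE TE')].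
    exact: filterS.
  by apply: near_always => y /h.
apply: filterS (near_and h1 h2) => q [[Oq hq] aq].
have [T' TE' Tq] := closure_in_elt K (subset_closure Oq).
have [Tx' aT'] := star T' TE' (hq T' TE' Tq).
apply: (elt_in_closure TE'); apply/(hull_baryP (card_elt TE') (elt_nondegenerate TE')) => v.
have [<-|av] := eqVneq a v; first by apply/ltW/aq.
have := lam0 T' v _ TE' Tq; rewrite lamc// (negbTE av) mulr0 add0r.
by rewrite pmulr_rge0.
Qed.

(** A point q near z lies only in elements that also contain z, so the two values are compared
    inside one element; outside the domain the hat function is 0 by [hat_dom]. The constant is crude
    and mesh dependent, which is harmless as it serves only membership in [H10]. *)
Lemma hat_lipschitz a : dom Omega (p a) -> exists2 L, 0 <= L & is_lipschitz L (hat a).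
Proof.
move=> Oa.
have /choice[L LP] : forall T, exists L : R, 0 <= L /\ is_lipschitz L (lam T a).
  move=> T; by have [L L0 hL] := affine_is_lipschitz (bary_affine p T a); exists L.
have S0 : 0 <= \sum_(T in E) L T by apply: sumr_ge0 => T _; exact: (LP T).1.
exists (\sum_(T in E) L T) => //; apply: local_lipschitz => // z.
have elt_case q : (forall T, T \in E -> hull p T q -> hull p T z) -> closure Omega q ->
    `|hat a q - hat a z| <= (\sum_(T in E) L T) * `|q - z|.
  move=> hq /(closure_in_elt K)[T TE Tq]; have Tz := hq T TE Tq.
  rewrite (hat_elt a TE Tq) (hat_elt a TE Tz) (le_trans ((LP T).2 q z))//.
  rewrite ler_wpM2r// (bigD1 T)//= lerDl sumr_ge0// => T' _; exact: (LP T').1.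
have [Oz|Oz] := pselect (dom Omega z).
  apply: filterS (near_and (dom_near Oz) (near_elt K z)) => q [Oq hq].
  by apply: elt_case => //; exact: subset_closure.
apply: filterS (near_elt K z) => q hq.
have [Oq|Oq] := pselect (closure Omega q); first exact: elt_case.
have -> : hat a z = 0.
  apply/eqP; rewrite eq_le hat_ge0 andbT leNgt; apply/negP => /(hat_dom Oa).
  exact: Oz.
by rewrite hat_out// subrr normr0 mulr_ge0.
Qed.

Definition elt_interior T := [set x : 'rV[R]_d | forall v, v \in T -> 0 < lam T v x].

Lemma open_elt_interior T : open (elt_interior T).
Proof.
rewrite openE => y yT.
suff : \forall z \near y, forall v, v \in T -> 0 < lam T v z by [].
apply: near_forall => v; have [vT|vT] := boolP (v \in T); last exact: near_always.
have : \forall z \near y, 0 < lam T v z.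
  by apply: near_gt; [exact: bary_continuous|exact: yT].
by apply: filterS => z.
Qed.

Lemma elt_interior_hull T x : T \in E -> elt_interior T x -> hull p T x.
Proof.
move=> TE Tx; apply/(hull_baryP (card_elt TE) (elt_nondegenerate TE)) => v.
by have [/Tx/ltW//|vT] := boolP (v \in T); rewrite bary_out.
Qed.

Lemma elt_interior_uniq T T' x : T \in E -> T' \in E -> elt_interior T x ->
  hull p T' x -> T = T'.
Proof.
move=> TE TE' Tx Tx'; apply/eqP; rewrite eqEcard (card_elt TE) (card_elt TE') leqnn andbT.
apply/fintype.subsetP => v vT; apply: (elt_carrier TE TE' _ Tx' (Tx v vT)).
exact: elt_interior_hull.
Qed.

(** Points of the domain in no open element lie on one of finitely many hyperplanes where a
    barycentric coordinate vanishes. *)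
Lemma ae_elt_interior : {ae (lebesgueRn (R := R) (n := d)), forall x : borelRn d,
  dom Omega x -> exists2 T, T \in E & elt_interior T x}.
Proof.
pose N (i : {set V} * V) : set (borelRn d) :=
  if (i.1 \in E) && (i.2 \in i.1) then [set x | lam i.1 i.2 x = 0] else classical_sets.set0.
have mN i : measurable (N i).
  rewrite /N; case: ifP => // _; apply: measurable_closed_Rn.
  apply: (@closed_comp _ _ (lam i.1 i.2) [set t | t = 0]); last exact: closed_eq.
  by move=> x _; exact: bary_continuous.
have N0 i : lebesgueRn (N i) = 0%E.
  rewrite /N; case: ifP => [/andP[TE vT]|_]; last by rewrite measure0.
  have af := bary_affine p i.1 i.2.
  rewrite -(@lebesgueRn_hyperplane R d (fun j => lam i.1 i.2 (delta_mx 0 j) - lam i.1 i.2 0)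
    (lam i.1 i.2 0)); last first.
    (* With all slopes zero the coordinate would be constant, yet it is 1 at its own vertex and 0 at
       another one. *)
    apply: contrapT => /forallNP w0.
    have cst x : lam i.1 i.2 x = lam i.1 i.2 0.
      rewrite (affine_coeff x af) big1 ?addr0// => j _.
      by have /negP/negPn/eqP -> := w0 j; rewrite mul0r.
    have [u uT uv] : exists2 u, u \in i.1 & u != i.2.
      have : (0 < #|i.1 :\ i.2|)%N.
        by have := cardsD1 i.2 i.1; rewrite vT (card_elt TE) => -[/esym E]; rewrite -[X in (0 < X)%N]add0n E.
      by rewrite card_gt0 => /set0Pn[u]; rewrite !inE => /andP[]; exists u.
    have := bary_vert (card_elt TE) (elt_nondegenerate TE) i.2 uT.
    rewrite (negbTE uv) cst -(cst (p i.2)).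
    rewrite (bary_vert (card_elt TE) (elt_nondegenerate TE))// eqxx => /eqP.
    by rewrite oner_eq0.
  congr (lebesgueRn _); apply/seteqP; split=> x /=; by rewrite (affine_coeff x af).
exists (\bigcup_(i in [set` index_enum ({set V} * V)%type]) N i); split.
- by apply: fin_bigcup_measurable => //; exact: finite_seq.
- rewrite bigcup_seq; elim: (index_enum _) => [|i s IHs]; first by rewrite big_nil measure0.
  rewrite big_cons null_set_setU//.
    by apply: bigsetU_measurable.
  exact: N0.
- move=> x /= nx; apply: contrapT => nN; apply: nx => Ox.
  have [T TE Tx] := closure_in_elt K (subset_closure Ox); exists T => // v vT.
  have /(hull_baryP (card_elt TE) (elt_nondegenerate TE)) := Tx => /(_ v).
  rewrite le_eqVlt => /predU1P[vx|//]; exfalso; apply: nN; exists (T, v); first by rewrite /= mem_index_enum.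
  by rewrite /N /= TE vT.
Qed.

Lemma dom_norm_bound : exists r : R, forall x, dom Omega x -> `|x| <= r.
Proof.
have [M [_ h]] := dom_bounded Omega; exists (`|M| + 1) => x Ox; apply: h => //.
by rewrite ltr_pwDr// ler_norm.
Qed.

(** The candidate gradient g is the piecewise constant one; inside an open element the hat function
    is affine with slopes [D T], which is what [lipschitz_H10] asks almost everywhere. *)
Lemma hat_H10 a : dom Omega (p a) -> H10 (dom Omega) (hat a).
Proof.
move=> Oa; have [L L0 Lh] := hat_lipschitz Oa; have [r rO] := dom_norm_bound.
pose D T i := lam T a (delta_mx 0 i) - lam T a 0.
pose g i x := \sum_(T in E) D T i * \1_(elt_interior T) x.
have gE i T x : T \in E -> elt_interior T x -> g i x = D T i.
  move=> TE Tx; rewrite /g (bigD1 T)//= indicE mem_set// mulr1 big1 ?addr0//.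
  move=> T' /andP[TE' TT']; rewrite indicE memNset ?mulr0// => Tx'.
  have := elt_interior_uniq TE TE' Tx (elt_interior_hull TE' Tx') => TT.
  by rewrite TT eqxx in TT'.
apply: (@lipschitz_H10 R d _ r (@dom_open _ _ Omega) rO (hat a) L g
  (\sum_(i < d) \sum_(T in E) `|D T i|)) => //.
- by move=> x; exact: hat_ge0.
- by move=> x; exact: hat_dom.
- move=> i; apply: measurable_funTS.
  have -> : g i = fun x => \sum_T (if T \in E then D T i else 0) * \1_(elt_interior T) x.
    apply/funext => x; rewrite /g big_mkcond; apply: eq_bigr => T _.
    by case: ifP; rewrite ?mul0r.
  apply: measurable_sum => T.
  have mi : measurable_fun setT (\1_(elt_interior T) : borelRn d -> R).
    by apply: measurable_indic; apply: measurable_open_Rn; exact: open_elt_interior.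
  by apply: measurable_funM => //; exact: measurable_cst.
- move=> i x _; rewrite (le_trans (ler_norm_sum _ _ _))// (bigD1 i)//=.
  rewrite -[leLHS]addr0 lerD//; last by rewrite sumr_ge0// => j _; rewrite sumr_ge0.
  apply: ler_sum => T _; rewrite normrM ler_piMr// indicE.
  by case: (_ \in _); rewrite ?normr1 ?normr0.
- apply: ae_mono ae_elt_interior _ => x xT Ox; have [T TE Tx] := xT Ox.
  have /near_ballP[e e0 he] : \forall y \near x, elt_interior T y.
    by apply: open_nbhs_nbhs; split => //; exact: open_elt_interior.
  exists (e / 2), (lam T a 0); split; first by rewrite divr_gt0.
    move=> i; rewrite (gE _ T)// (hat_elt a TE (elt_interior_hull TE Tx)) => ax0.
    have aT : a \notin T by apply/negP => /Tx; rewrite ax0 ltxx.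
    by rewrite /D !bary_out// subrr.
  move=> y yx; have Ty : elt_interior T y.
    by apply: he; apply: (le_lt_trans yx); rewrite ltr_pdivrMr// ltr_pMr// ltr1n.
  rewrite (hat_elt a TE (elt_interior_hull TE Ty)) (affine_coeff y (bary_affine p T a)).
  by congr (_ + _); apply: eq_bigr => i _; rewrite (gE _ T).
Qed.

Section nodal_function.
Variable c : V -> R.
Hypothesis c0 : forall a, ~ dom Omega (p a) -> c a = 0.

Definition nodal x : R := \sum_a c a * hat a x.

Lemma nodal_elt T x : T \in E -> hull p T x -> nodal x = \sum_(a in T) c a * lam T a x.
Proof.
move=> TE Tx; rewrite /nodal [LHS](bigID (mem T))/= [X in _ + X]big1 ?addr0.
  by apply: eq_bigr => a _; rewrite (hat_elt a TE Tx).
by move=> a aT; rewrite (hat_elt a TE Tx) bary_out// mulr0.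
Qed.

Lemma nodal_in_V : in_V K nodal.
Proof.
have mO : measurable (dom Omega : set (borelRn d)).
  by apply: measurable_open_Rn; exact: dom_open.
split.
- rewrite /nodal; elim: (index_enum V) => [|a r IHr].
    by under eq_fun do rewrite big_nil; exact: H100.
  under eq_fun do rewrite big_cons; have [Oa|Oa] := pselect (dom Omega (p a)).
    by apply: H10_lin => //; exact: hat_H10.
  by under eq_fun do rewrite c0// mul0r add0r.
- move=> T TE; exists (fun x => \sum_(a in T) c a * lam T a x).
    by apply/polyfun_affine; apply: affine_bigsum => a _; exact: bary_affine.
  by move=> x Tx; exact: nodal_elt.
- by move=> x Ox; rewrite /nodal big1// => a _; rewrite hat_out// mulr0.
Qed.

End nodal_function.
End hat_functions.

(** * Face integrals *)

Section face_integrals.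
Context {R : realType} {d : nat} {Omega : polyhedral_domain R d}.
Variable K : triangulation Omega.
Hypothesis d0 : (0 < d)%N.
Local Notation p := (@vert _ _ _ K).
Local Notation V := 'I_(nvert K).
Implicit Types (T F : {set V}) (f g : 'rV[R]_d -> R).

Let card_pred F : #|F| = d -> #|F| = d.-1.+1.
Proof. by rewrite prednK. Qed.

Section one_face.
Variable F : {set V}.
Hypothesis cF : #|F| = d.

Lemma eq_face_int f g : (forall x, hull p F x -> f x = g x) -> face_int F f = face_int F g.
Proof. exact: (eq_simplex_int (card_pred cF)). Qed.

Lemma face_int_lin a f g : hull_continuous p F f -> hull_continuous p F g ->
  face_int F (fun x => a * f x + g x) = a * face_int F f + face_int F g.
Proof. exact: (simplex_int_lin (card_pred cF)). Qed.

Lemma le_face_int f g : hull_continuous p F f -> hull_continuous p F g ->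
  (forall x, hull p F x -> f x <= g x) -> face_int F f <= face_int F g.
Proof. exact: (le_simplex_int (card_pred cF)). Qed.

Lemma face_measureE : face_measure F = gram p d.-1 F * refvol d.-1.
Proof. by rewrite /face_measure /face_int simplex_int_cst mul1r. Qed.

Lemma face_int_cst c : face_int F (fun=> c) = c * face_measure F.
Proof. by rewrite face_measureE /face_int simplex_int_cst. Qed.

Lemma hull_continuous_sub f c : hull_continuous p F f -> hull_continuous p F (fun x => f x - c).
Proof.
move=> cf; rewrite (_ : (fun x => _) = fun x => 1 * f x + - c).
  by apply: hull_continuous_lin => //; exact: hull_continuous_cst.
by apply/funext => x; rewrite mul1r.
Qed.

Lemma hull_continuous_sqr f : hull_continuous p F f -> hull_continuous p F (fun x => f x ^+ 2).
Proof.
move=> cf; rewrite (_ : (fun x => _) = fun x => f x * f x); first exact: hull_continuous_mul.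
by apply/funext => x; rewrite expr2.
Qed.

Lemma face_int_sqr_ge0 f : hull_continuous p F f -> 0 <= face_int F (fun x => f x ^+ 2).
Proof.
move=> cf; have <- : face_int F (fun=> 0) = 0 by rewrite face_int_cst mul0r.
apply: le_face_int; [exact: hull_continuous_cst|exact: hull_continuous_sqr|].
by move=> x _; exact: sqr_ge0.
Qed.

Lemma face_int_sqr_sub f c : hull_continuous p F f ->
  face_int F (fun x => (f x - c) ^+ 2) =
  face_int F (fun x => f x ^+ 2) - 2 * c * face_int F f + c ^+ 2 * face_measure F.
Proof.
move=> cf; have cf2 := hull_continuous_sqr cf.
have ck : hull_continuous p F (fun=> c ^+ 2) by exact: hull_continuous_cst.
rewrite (_ : (fun x => (f x - c) ^+ 2) =
  fun x => (- (2 * c)) * f x + (1 * f x ^+ 2 + c ^+ 2)); last first.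
  by apply/funext => x; ring.
rewrite face_int_lin//; last exact: hull_continuous_lin.
by rewrite face_int_lin// face_int_cst; ring.
Qed.

(** Jensen for the square, read off from the nonnegative variance of f over the face. *)
Lemma face_mean_sqr_le f c : hull_continuous p F f -> 0 < face_measure F ->
  ((face_measure F)^-1 * face_int F f - c) ^+ 2 * face_measure F <=
  face_int F (fun x => (f x - c) ^+ 2).
Proof.
move=> cf F0; rewrite face_int_sqr_sub//.
have := face_int_sqr_ge0 (hull_continuous_sub ((face_measure F)^-1 * face_int F f) cf).
rewrite face_int_sqr_sub//.
move: (face_int F f) (face_int F _) (face_measure F) F0 => A B m m0.
have mn : m != 0 by rewrite gt_eqF.
rewrite (_ : B - _ + _ = B - m^-1 * A ^+ 2); last by field.
rewrite (_ : (m^-1 * A - c) ^+ 2 * m = m^-1 * A ^+ 2 - 2 * c * A + c ^+ 2 * m); last by field.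
by move=> h; lra.
Qed.

Lemma face_int_sqr_split f c c' : hull_continuous p F f ->
  face_int F (fun x => (f x - c) ^+ 2) <=
  2 * face_int F (fun x => (f x - c') ^+ 2) + 2 * (c' - c) ^+ 2 * face_measure F.
Proof.
move=> cf; have cf' := hull_continuous_sqr (hull_continuous_sub c' cf).
have ck : hull_continuous p F (fun=> 2 * (c' - c) ^+ 2) by exact: hull_continuous_cst.
rewrite -face_int_cst -face_int_lin//; apply: le_face_int.
- exact/hull_continuous_sqr/hull_continuous_sub.
- exact: hull_continuous_lin.
- move=> x _; have := sqr_ge0 (f x - c' - (c' - c)); move: (f x) => y h.
  rewrite -subr_ge0; apply: le_trans h _; rewrite le_eqVlt; apply/orP; left; apply/eqP.
  by ring.
Qed.

Lemma face_int_sqr_bound f c e : hull_continuous p F f -> 0 <= e ->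
  (forall x, hull p F x -> `|f x - c| <= e) ->
  face_int F (fun x => (f x - c) ^+ 2) <= e ^+ 2 * face_measure F.
Proof.
move=> cf e0 fe; rewrite -face_int_cst; apply: le_face_int.
- exact/hull_continuous_sqr/hull_continuous_sub.
- exact: hull_continuous_cst.
- by move=> x /fe h; rewrite -real_normK ?num_real// lerXn2r ?nnegrE.
Qed.

End one_face.

Lemma card_face T F : face_of T F -> #|F| = d.
Proof. by move=> /andP[_ /eqP]. Qed.

Lemma is_faceP T F : T \in elts K -> face_of T F -> is_face F.
Proof. by move=> TE TF; apply/existsP; exists T; rewrite TE. Qed.

Lemma card_faces T (c : R) : T \in elts K -> \sum_(F | face_of T F) c = d.+1%:R * c.
Proof.
move=> TE; rewrite sumr_const; have -> : #|[pred F | face_of T F]| = d.+1.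
  rewrite -(binSn d) -(card_elt TE) -cards_draws; apply: eq_card => F.
  by rewrite !inE.
by rewrite mulr_natl.
Qed.

Section spaces.
Variable k : nat.
Implicit Types (mu : Mspace K k) (v : Vspace K).

Lemma Mspace_continuous mu F : is_face F -> hull_continuous p F (mu F).
Proof.
move=> FK; have /asboolP[Pm _ _] := M_funP mu; have [q qk muq] := Pm F FK.
by apply: (hull_continuous_poly qk) => x /muq.
Qed.

Lemma Vspace_affine v T : T \in elts K ->
  exists2 f, affine f & forall x, hull p T x -> v x = f x.
Proof.
move=> TE; have /asboolP[_ Pv _] := V_funP v; have [f fk vf] := Pv T TE.
by exists f => //; exact/polyfun_affine.
Qed.

Lemma Vspace_continuous v F : is_face F -> hull_continuous p F v.
Proof.
move=> /existsP[T /andP[TE /andP[FT _]]]; have [f af vf] := Vspace_affine v TE.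
by exists f => [|x Fx]; [exact: affine_continuous|apply: vf; exact: hull_subset Fx].
Qed.

(** Both prolongations preserve constants and do not increase the L^2 norm on a face: the first by
    Jensen, the second as an orthogonal projection. *)
Lemma prolongation_le (P : Vspace K -> Mspace K k) v F c :
  is_Pi1 P \/ is_Pi2 P -> is_face F -> 0 < face_measure F ->
  face_int F (fun x => (P v F x - c) ^+ 2) <= face_int F (fun x => (v x - c) ^+ 2).
Proof.
move=> hP FK F0; have cv := Vspace_continuous v FK.
have cF : #|F| = d by move: FK => /existsP[T /andP[_ /card_face]].
case: hP => hP.
  rewrite (eq_face_int cF (g := fun=> ((face_measure F)^-1 * face_int F v - c) ^+ 2)).
    by rewrite face_int_cst//; exact: face_mean_sqr_le.
  by move=> x Fx; rewrite hP.
have /asboolP[Pm _ _] := M_funP (P v); have [q0 q0k Pq0] := Pm F FK.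
(* The test polynomial is the projected function [P v F - c] itself; orthogonality then gives that
   the integral of q^2 equals that of (v - c) q. *)
pose q x := 1 * q0 x + - c.
have qk : polyfun k q by apply: polyfun_lin => //; exact: polyfun_cst.
have cq : hull_continuous p F q by exact: (hull_continuous_poly qk).
have Pq x : hull p F x -> P v F x - c = q x by move=> Fx; rewrite /q Pq0// mul1r.
have cPv : hull_continuous p F (fun x => P v F x * q x).
  by apply: hull_continuous_mul => //; exact: Mspace_continuous.
have cvq : hull_continuous p F (fun x => v x * q x) by exact: hull_continuous_mul.
have E1 : face_int F (fun x => (P v F x - c) ^+ 2) = face_int F (fun x => q x ^+ 2).
  by apply: eq_face_int => // x Fx; rewrite Pq.
have E2 : face_int F (fun x => q x ^+ 2) = - c * face_int F q + face_int F (fun x => P v F x * q x).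
  rewrite -face_int_lin//; apply: eq_face_int => // x Fx.
  have -> : P v F x = q x + c by rewrite -Pq// subrK.
  by ring.
have E3 : face_int F (fun x => (v x - c) * q x) = - c * face_int F q + face_int F (fun x => v x * q x).
  by rewrite -face_int_lin//; apply: eq_face_int => // x Fx; ring.
have cvc := hull_continuous_sub c cv.
have E4 : 2 * face_int F (fun x => (v x - c) * q x) <=
    face_int F (fun x => (v x - c) ^+ 2) + face_int F (fun x => q x ^+ 2).
  have := face_int_sqr_ge0 cF (hull_continuous_lin (-1) cq cvc).
  have c1 := hull_continuous_sqr cvc; have c2 := hull_continuous_sqr cq.
  have c3 := hull_continuous_mul cvc cq.
  rewrite (_ : (fun x => _) = fun x => (-2) * ((v x - c) * q x) + (1 * (v x - c) ^+ 2 + q x ^+ 2)).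
    by rewrite face_int_lin//; [rewrite face_int_lin//; lra|exact: hull_continuous_lin].
  by apply/funext => x; ring.
by rewrite E1; move: E4; rewrite E3 -(hP v F FK q qk) -E2; lra.
Qed.

End spaces.
End face_integrals.

(** * Shape-regular elements *)

Section affine_gradient.
Context {R : realType} {d : nat}.
Implicit Types (f : 'rV[R]_d -> R) (x y : 'rV[R]_d).

Lemma norm_le_enorm x : `|x| <= enorm x.
Proof.
rewrite [leLHS]mx_normrE; apply: bigmax_le; first exact: enorm_ge0.
by move=> [i j] _; rewrite ord1; exact: coord_le_enorm.
Qed.

Definition affine_grad f : 'rV[R]_d := \row_i (f (delta_mx 0 i) - f 0).

Lemma affine_gradE f x y : affine f -> f x - f y = \sum_i affine_grad f 0 i * (x - y) 0 i.
Proof.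
move=> af; rewrite (affine_coeff x af) (affine_coeff y af) opprD addrACA subrr add0r.
by rewrite -sumrB; apply: eq_bigr => i _; rewrite !mxE mulrBr.
Qed.

Lemma affine_grad_le f x y : affine f -> `|f x - f y| <= enorm (affine_grad f) * enorm (x - y).
Proof. by move=> af; rewrite affine_gradE//; exact: dot_le_enorm. Qed.

Lemma affine_derive f x i : affine f ->
  is_derive x (delta_mx 0 i : 'rV[R]_d) f (affine_grad f 0 i).
Proof.
move=> af; apply/is_derive_line.
rewrite (_ : (fun t : R => _) = fun t : R => f x + t * affine_grad f 0 i).
  apply: (is_derive_eq (is_deriveD (is_derive_cst _ _ _)
    (is_deriveM (is_derive_id _ _) (is_derive_cst _ _ _)))).
  by rewrite add0r scaler0 add0r /GRing.scale/= mulr1.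
apply/funext => t; rewrite -[LHS](subrK (f x)) addrC affine_gradE// (bigD1 i)//= big1.
  by rewrite addr0 (addrC x) addrK !mxE !eqxx mulr1 mulrC.
by move=> j ji; rewrite (addrC x) addrK !mxE (negbTE ji) andbF !mulr0.
Qed.

End affine_gradient.

Section shape_regular_mesh.
Context {R : realType} {d : nat} {Omega : polyhedral_domain R d}.
Variables (K : triangulation Omega) (tau : R).
Hypothesis d23 : d = 2%N \/ d = 3%N.
Hypothesis tau1 : 1 <= tau.
Local Notation p := (@vert _ _ _ K).
Local Notation E := (elts K).
Local Notation V := 'I_(nvert K).
Local Notation h := (@elt_diameter _ _ _ K).
Local Notation lam := (@bary R d (nvert K) (@vert _ _ _ K)).
Hypothesis shape : forall T, T \in E -> exists x r,
  [/\ 0 < r, h T / tau <= r & forall y, enorm (y - x) <= r -> hull p T y].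
Implicit Types (T F S : {set V}) (x y : 'rV[R]_d) (a u v : V).

Let d0 : (0 < d)%N. Proof. by case: d23 => ->. Qed.
Let tau0 : 0 < tau. Proof. exact: lt_le_trans tau1. Qed.

Lemma elt_diameter_gt0 T : T \in E -> 0 < h T.
Proof. by move=> TE; apply: (diameter_gt0 (card_elt TE) (elt_nondegenerate TE)). Qed.

Let l0 T : T \in E -> 0 < h T / tau.
Proof. by move=> TE; rewrite divr_gt0// elt_diameter_gt0. Qed.

Lemma bary_elt_lipschitz T v x y : T \in E ->
  lam T v x - lam T v y <= (h T / tau)^-1 * enorm (x - y).
Proof.
move=> TE; have [z [r [r0 hr hz]]] := shape TE.
apply: le_trans (bary_lipschitz (card_elt TE) (elt_nondegenerate TE) v x y r0 hz) _.
by rewrite ler_wpM2r ?enorm_ge0// lef_pV2 ?posrE// l0.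
Qed.

Lemma norm_bary_elt T v x y : T \in E ->
  `|lam T v x - lam T v y| <= (h T / tau)^-1 * enorm (x - y).
Proof.
move=> TE; rewrite ler_norml bary_elt_lipschitz// andbT lerNl opprB enormB.
exact: bary_elt_lipschitz.
Qed.

Lemma edge_le T u v : u \in T -> v \in T -> enorm (p u - p v) <= h T.
Proof. by move=> uT vT; apply: enorm_le_diameter; exact: hull_vert. Qed.

Lemma edge_ge T u v : T \in E -> u \in T -> v \in T -> u != v -> h T / tau <= enorm (p u - p v).
Proof.
move=> TE uT vT uv; have := bary_elt_lipschitz u (p u) (p v) TE.
rewrite !(bary_vert (card_elt TE) (elt_nondegenerate TE))// eqxx eq_sym (negbTE uv) subr0.
by rewrite ler_pdivlMl ?l0// mulr1.
Qed.

(** A common edge has length at least h_T / tau and at most h_S. *)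
Lemma diameter_shared_edge T S : T \in E -> S \in E -> (1 < #|T :&: S|)%N ->
  h T <= tau * h S.
Proof.
move=> TE SE /card_gt1P[u [v [/setIP[uT uS] /setIP[vT vS] uv]]].
by rewrite -ler_pdivrMl// mulrC (le_trans (edge_ge TE uT vT uv))// edge_le.
Qed.

Lemma face_measure_bounds T F : T \in E -> face_of T F ->
  (h T / tau) ^+ d.-1 * refvol d.-1 <= face_measure F <= h T ^+ d.-1 * refvol d.-1.
Proof.
move=> TE TF; have cF := card_face TF; have /andP[/fintype.subsetP FT _] := TF.
rewrite face_measureE !ler_pM2r ?refvol_gt0//.
apply: (@gram_bounds _ _ _ _ _ _ (lam T)) => //.
- by case: d23 => ->; [left|right].
- by rewrite prednK.
- exact: l0.
- by move=> u v /FT uT /FT vT; exact: edge_le.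
- by move=> v _; exact: bary_affine.
- by move=> u v /FT uT _; rewrite (bary_vert (card_elt TE) (elt_nondegenerate TE)).
- by move=> v x y _; exact: bary_elt_lipschitz.
Qed.

Lemma face_measure_gt0 T F : T \in E -> face_of T F -> 0 < face_measure F.
Proof.
move=> TE /(face_measure_bounds TE)/andP[+ _]; apply: lt_le_trans.
by rewrite mulr_gt0 ?refvol_gt0// exprn_gt0// l0.
Qed.

(** Only sup-norm balls have a computed volume: one of radius r/d fits in the Euclidean inner ball
    of radius r, and one of radius 2 h_T about a vertex contains the element. The factor 2 makes the
    inclusion in an open ball strict. *)
Lemma interior_volume T : T \in E ->
  exists2 m, lebesgueRn (hull p T)^° = m%:E &
    (2 * (h T / tau) / d%:R) ^+ d <= m <= (4 * h T) ^+ d.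
Proof.
move=> TE; have [z [r [r0 hr hz]]] := shape TE.
have dR : 0 < d%:R :> R by rewrite ltr0n.
have mI : measurable ((hull p T)^° : set (borelRn d)).
  by apply: measurable_open_Rn; exact: open_interior.
have mB (x : 'rV[R]_d) (e : R) : 0 < e -> measurable (ball x e : set (borelRn d)).
  by move=> e0; apply: measurable_open_Rn; exact: ball_open.
have [a aT] : exists a, a \in T by apply/set0Pn; rewrite -card_gt0 (card_elt TE).
have h2 : 0 < 2 * h T by rewrite mulr_gt0// elt_diameter_gt0.
have hB : (lebesgueRn (hull p T)^° <= ((4 * h T) ^+ d)%:E)%E.
  rewrite (_ : 4 * h T = 2 * (2 * h T)); last by rewrite mulrA -natrM.
  rewrite -(lebesgueRn_ball (p a) h2); apply: le_measure; rewrite ?inE//; first exact: mB.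
  move=> x /interior_subset Tx; rewrite -ball_normE /= distrC.
  rewrite (le_lt_trans (norm_le_enorm _))//.
  rewrite (le_lt_trans (enorm_le_diameter Tx (hull_vert p aT)))//.
  by rewrite -/(h T) ltr_pMl ?ltr1n// elt_diameter_gt0.
have rd : 0 < r / d%:R by rewrite divr_gt0.
have hb : (((2 * (r / d%:R)) ^+ d)%:E <= lebesgueRn (hull p T)^°)%E.
  rewrite -(lebesgueRn_ball z rd); apply: le_measure; rewrite ?inE//; first exact: mB.
  rewrite -open_subsetE; last exact: ball_open.
  move=> x.
  rewrite -ball_normE /= distrC => xz; apply: hz.
  apply: (@le_trans _ _ (d%:R * (r / d%:R))); last by rewrite mulrC divfK ?gt_eqF.
  apply: enorm_le (ltW rd) => i; rewrite (le_trans (coord_le_norm _ i))//; exact: ltW.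
move: hB hb; case: (lebesgueRn _) => [m| |]//.
rewrite !lee_fin => hB hb; exists m => //; rewrite hB andbT (le_trans _ hb)//.
by rewrite lerXn2r ?nnegrE ?mulr_ge0 ?invr_ge0 ?(ltW tau0) ?(ltW (elt_diameter_gt0 TE))//
  ?(ltW r0)// -mulrA ler_pM2l// ler_pM2r// invr_gt0.
Qed.

Definition elt_energy T (v : 'rV[R]_d -> R) : R :=
  \int[lebesgueRn]_(x in (hull p T)^°) \sum_i ('D_(delta_mx 0 i) v x) ^+ 2.

Lemma elt_energy_affine T (v f : 'rV[R]_d -> R) : T \in E -> affine f ->
  (forall x, hull p T x -> v x = f x) ->
  enorm (affine_grad f) ^+ 2 * (2 * (h T / tau) / d%:R) ^+ d <= elt_energy T v <=
  enorm (affine_grad f) ^+ 2 * (4 * h T) ^+ d.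
Proof.
move=> TE af vf; have [m mE /andP[m1 m2]] := interior_volume TE.
have mI : measurable ((hull p T)^° : set (borelRn d)).
  by apply: measurable_open_Rn; exact: open_interior.
have -> : elt_energy T v = enorm (affine_grad f) ^+ 2 * m.
  rewrite /elt_energy (@eq_Rintegral _ _ _ _ _ (fun=> enorm (affine_grad f) ^+ 2)).
    by rewrite Rintegral_cst// -[m]/(fine m%:E) -mE.
  move=> x /set_mem Tx; rewrite sqr_enorm; apply: eq_bigr => i _; congr (_ ^+ 2).
  have nearE : \forall y \near x, f y = v y.
    by apply: filterS Tx => y /vf.
  by have [_ ->] := near_eq_is_derive nearE (affine_derive x i af).
by rewrite !ler_wpM2l ?sqr_ge0.
Qed.

End shape_regular_mesh.

(** * Stability of the prolongations *)

Section prolongation_stability.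
Context {R : realType} {d : nat} {Omega : polyhedral_domain R d}.
Variables (K : triangulation Omega) (k : nat) (tau : R).
Hypothesis d23 : d = 2%N \/ d = 3%N.
Hypothesis tau1 : 1 <= tau.
Local Notation p := (@vert _ _ _ K).
Local Notation E := (elts K).
Local Notation V := 'I_(nvert K).
Local Notation h := (@elt_diameter _ _ _ K).
Local Notation lam := (@bary R d (nvert K) (@vert _ _ _ K)).
Hypothesis shape : forall T, T \in E -> exists x r,
  [/\ 0 < r, h T / tau <= r & forall y, enorm (y - x) <= r -> hull p T y].
Implicit Types (T F S : {set V}) (x y : 'rV[R]_d) (a u : V) (mu : Mspace K k) (v : Vspace K).

Let d0 : (0 < d)%N. Proof. by case: d23 => ->. Qed.
Let tau0 : 0 < tau. Proof. exact: lt_le_trans tau1. Qed.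
Let h0 T : T \in E -> 0 < h T. Proof. exact: elt_diameter_gt0. Qed.
Let F0 T F : T \in E -> face_of T F -> 0 < face_measure F.
Proof. exact: (face_measure_gt0 d23 tau1 shape). Qed.

Definition face_avg F mu : R := (face_measure F)^-1 * face_int F (mu F).

Lemma face_int_M_sqr_ge0 mu F c : is_face F -> 0 <= face_int F (fun x => (mu F x - c) ^+ 2).
Proof.
move=> FK; have cF : #|F| = d by move: FK => /existsP[T /andP[_ /card_face]].
by apply: (face_int_sqr_ge0 d0 cF); apply: hull_continuous_sub; exact: Mspace_continuous.
Qed.

Lemma bdry_int_M_sqr_ge0 T mu c : T \in E -> 0 <= bdry_int T (fun F x => (mu F x - c) ^+ 2).
Proof. by move=> TE; apply: sumr_ge0 => F TF; apply: face_int_M_sqr_ge0; exact: is_faceP TF. Qed.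

Lemma sqr_semi_hT T mu : T \in E ->
  semi_hT T mu ^+ 2 = (h T)^-1 * bdry_int T (fun F x => (mu F x - mean_T T mu) ^+ 2).
Proof.
move=> TE; rewrite /semi_hT exprMn exprVn !sqr_sqrtr//; first exact: bdry_int_M_sqr_ge0.
exact/ltW/h0.
Qed.

Lemma sqr_norm_hT T mu : T \in E ->
  norm_hT T mu ^+ 2 = h T * bdry_int T (fun F x => mu F x ^+ 2).
Proof.
move=> TE; rewrite /norm_hT exprMn !sqr_sqrtr//; last exact/ltW/h0.
have := bdry_int_M_sqr_ge0 mu 0 TE; congr (_ <= _); apply: eq_bigr => F _.
by congr face_int; apply/funext => x; rewrite subr0.
Qed.

Lemma sqr_semi_h mu : semi_h mu ^+ 2 = \sum_(T in E) semi_hT T mu ^+ 2.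
Proof. by rewrite sqr_sqrtr// sumr_ge0// => T _; exact: sqr_ge0. Qed.

Lemma elt_energy_ge0 T v : T \in E -> 0 <= elt_energy T v.
Proof.
move=> TE; apply: Rintegral_ge0 => x _; apply: sumr_ge0 => i _; exact: sqr_ge0.
Qed.

Lemma sqr_h1_semi v : h1_semi v ^+ 2 = \sum_(T in E) elt_energy T v.
Proof. by rewrite sqr_sqrtr// sumr_ge0// => T TE; exact: elt_energy_ge0. Qed.

Lemma sum_face_avg_le T mu c e : T \in E -> 0 <= e ->
  (forall F, face_of T F -> `|face_avg F mu - c| <= e) -> `|mean_T T mu - c| <= e.
Proof.
move=> TE e0 hF; have d1 : d.+1%:R != 0 :> R by rewrite pnatr_eq0.
have -> : mean_T T mu - c = d.+1%:R^-1 * \sum_(F | face_of T F) (face_avg F mu - c).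
  by rewrite sumrB card_faces// mulrBr mulKf.
rewrite normrM ger0_norm ?invr_ge0// ler_pdivrMl ?ltr0n// (le_trans (ler_norm_sum _ _ _))//.
by rewrite -(card_faces _ TE); exact: ler_sum.
Qed.

Lemma face_avg_sqr_le F mu c : is_face F -> 0 < face_measure F ->
  (face_avg F mu - c) ^+ 2 <= (face_measure F)^-1 * face_int F (fun x => (mu F x - c) ^+ 2).
Proof.
move=> FK Fp; rewrite ler_pdivlMl// mulrC.
have cF : #|F| = d by move: FK => /existsP[T /andP[_ /card_face]].
by apply: (face_mean_sqr_le d0 cF) => //; exact: Mspace_continuous.
Qed.

Lemma norm_le_sqr (x e : R) : 0 <= e -> x ^+ 2 <= e ^+ 2 -> `|x| <= e.
Proof. by move=> e0; rewrite -{1}real_normK ?num_real//; exact: le_of_sqr. Qed.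

Let rho : R := refvol d.-1.
Let rho0 : 0 < rho. Proof. exact: refvol_gt0. Qed.

(** The 4 comes from two squared deviations bounded by e^2, each doubled by the splitting of a
    square; there are d+1 faces of measure at most [rho * h^(d-1)]; the last power trades h^d for
    the lower bound on the volume. *)
Definition prolongation_cst : R := 4 * d.+1%:R * rho * (tau * d%:R / 2) ^+ d.

(** On T the affine v deviates from its value c at a vertex by at most e = |grad v| h_T. The
    prolongation inherits this bound in mean square on each face, hence so do its face averages and
    [mean_T]. *)
Lemma prolongation_elt (P : Vspace K -> Mspace K k) T v : is_Pi1 P \/ is_Pi2 P -> T \in E ->
  semi_hT T (P v) ^+ 2 <= prolongation_cst * elt_energy T v.
Proof.
move=> hP TE; have [f af vf] := Vspace_affine v TE.
have /andP[vE _] := elt_energy_affine d23 tau1 shape TE af vf.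
set g := enorm (affine_grad f); have g0 : 0 <= g by exact: enorm_ge0.
have hT := h0 TE.
have [a aT] : exists a, a \in T by apply/set0Pn; rewrite -card_gt0 (card_elt TE).
pose e := g * h T; have e0 : 0 <= e by rewrite mulr_ge0// ltW.
pose c := f (p a).
have osc x : hull p T x -> `|v x - c| <= e.
  move=> Tx; rewrite vf// (le_trans (affine_grad_le _ _ af))// ler_wpM2l//.
  by apply: enorm_le_diameter => //; exact: hull_vert.
have Pc F : face_of T F -> face_int F (fun x => (P v F x - c) ^+ 2) <= e ^+ 2 * face_measure F.
  move=> TF; have FK := is_faceP TE TF; have cF := card_face TF.
  apply: le_trans (prolongation_le d0 v c hP FK (F0 TE TF)) _.
  apply: (face_int_sqr_bound d0 cF) => // [|x Fx]; first exact: Vspace_continuous.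
  by apply: osc; move: TF => /andP[FT _]; exact: hull_subset Fx.
have mc : `|mean_T T (P v) - c| <= e.
  apply: sum_face_avg_le => // F TF; apply: norm_le_sqr => //.
  apply: le_trans (face_avg_sqr_le (P v) c (is_faceP TE TF) (F0 TE TF)) _.
  by rewrite ler_pdivrMl ?(F0 TE TF)// mulrC Pc.
have mc2 : (c - mean_T T (P v)) ^+ 2 <= e ^+ 2.
  by rewrite -real_normK ?num_real// lerXn2r ?nnegrE// distrC.
have B : bdry_int T (fun F x => (P v F x - mean_T T (P v)) ^+ 2) <=
    d.+1%:R * (4 * e ^+ 2 * (h T ^+ d.-1 * rho)).
  rewrite -(card_faces _ TE); apply: ler_sum => F TF.
  have cF := card_face TF; have cv := Mspace_continuous (P v) (is_faceP TE TF).
  apply: le_trans (face_int_sqr_split d0 cF (mean_T T (P v)) c cv) _.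
  apply: (@le_trans _ _ (4 * e ^+ 2 * face_measure F)).
    have := Pc F TF; have := ler_wpM2r (ltW (F0 TE TF)) mc2.
    by move: (face_measure F) (face_int _ _) => m i; lra.
  have e4 : 0 <= 4 * e ^+ 2 by apply: mulr_ge0 => //; exact: sqr_ge0.
  rewrite ler_wpM2l//.
  by have /andP[] := face_measure_bounds d23 tau1 shape TE TF.
rewrite sqr_semi_hT// ler_pdivrMl//; apply: le_trans B _.
have -> : d.+1%:R * (4 * e ^+ 2 * (h T ^+ d.-1 * rho)) =
   h T * (4 * d.+1%:R * rho * (g ^+ 2 * h T ^+ d)).
  have -> : h T ^+ d = h T * h T ^+ d.-1 by rewrite -exprS prednK.
  rewrite /e; ring.
rewrite ler_pM2l//.
have -> : h T ^+ d = (tau * d%:R / 2) ^+ d * (2 * (h T / tau) / d%:R) ^+ d.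
  rewrite -exprMn; congr (_ ^+ _); field.
  by rewrite pnatr_eq0 -lt0n d0 gt_eqF.
have C0 : 0 <= prolongation_cst.
  rewrite /prolongation_cst; apply: mulr_ge0; first by rewrite !mulr_ge0// ltW.
  by rewrite exprn_ge0// !mulr_ge0// ltW.
apply: le_trans (ler_wpM2l C0 vE).
by rewrite /prolongation_cst -/g le_eqVlt; apply/orP; left; apply/eqP; ring.
Qed.

Lemma prolongation_stable (P : Vspace K -> Mspace K k) v : is_Pi1 P \/ is_Pi2 P ->
  semi_h (P v) ^+ 2 <= prolongation_cst * h1_semi v ^+ 2.
Proof.
move=> hP; rewrite sqr_semi_h sqr_h1_semi mulr_sumr; apply: ler_sum => T TE.
exact: prolongation_elt.
Qed.

End prolongation_stability.

(** * Size of vertex stars *)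

Section star_size.
Context {R : realType} {d : nat} {Omega : polyhedral_domain R d}.
Variables (K : triangulation Omega) (tau : R).
Hypothesis d23 : d = 2%N \/ d = 3%N.
Hypothesis tau1 : 1 <= tau.
Local Notation p := (@vert _ _ _ K).
Local Notation E := (elts K).
Local Notation V := 'I_(nvert K).
Local Notation h := (@elt_diameter _ _ _ K).
Local Notation lam := (@bary R d (nvert K) (@vert _ _ _ K)).
Hypothesis shape : forall T, T \in E -> exists x r,
  [/\ 0 < r, h T / tau <= r & forall y, enorm (y - x) <= r -> hull p T y].
Implicit Types (T F S : {set V}) (x y : 'rV[R]_d) (a u v : V).

Let d0 : (0 < d)%N. Proof. by case: d23 => ->. Qed.
Let tau0 : 0 < tau. Proof. exact: lt_le_trans tau1. Qed.
Let h0 T : T \in E -> 0 < h T. Proof. exact: elt_diameter_gt0. Qed.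

(** If the coordinate of v at z were nonpositive, a small step from z away from [p v] would make it
    negative while staying in the ball. *)
Lemma ball_center_interior T z r : T \in E -> 0 < r ->
  (forall y, enorm (y - z) <= r -> hull p T y) -> elt_interior T z.
Proof.
move=> TE r0 hz v vT; rewrite ltNge; apply/negP => z0.
have n0 := enorm_ge0 (z - p v); have n1 : 0 < 1 + enorm (z - p v) by rewrite ltr_wpDr.
pose s := r / (1 + enorm (z - p v)); have s0 : 0 < s by rewrite divr_gt0.
have : hull p T (z + s *: (z - p v)).
  apply: hz; rewrite addrAC subrr add0r enormZ gtr0_norm// /s -mulrA ler_piMr ?(ltW r0)//.
  by rewrite ler_pdivrMl// mulr1 lerDr.
move=> /(hull_baryP (card_elt TE) (elt_nondegenerate TE))/(_ v).
rewrite affine_direction; last exact: bary_affine.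
rewrite (bary_vert (card_elt TE) (elt_nondegenerate TE))// eqxx => H.
have := mulr_ge0_le0 (ltW s0) z0; move: (lam T v z) z0 H => b z0 H sb.
by move: H; rewrite mulrBr mulr1; lra.
Qed.

(* Elements meeting at [a] span disjoint cones at [a]: the contraction towards
   [a] maps each element and its interior into itself. *)
Lemma cones_disjoint a T S x y (s t : R) : T \in E -> S \in E -> a \in T -> a \in S ->
  elt_interior T x -> hull p S y -> 0 < s <= 1 -> 0 < t <= 1 ->
  s *: (x - p a) = t *: (y - p a) -> T = S.
Proof.
move=> TE SE aT aS Tx Sy /andP[s0 s1] /andP[t0 t1] st.
apply: (elt_interior_uniq TE SE (x := p a + s *: (x - p a))); last first.
  by rewrite st; apply: hull_convex => //; [rewrite ltW|exact: hull_vert].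
move=> v vT; rewrite affine_comb; last exact: bary_affine.
rewrite (bary_vert (card_elt TE) (elt_nondegenerate TE))//.
have : 0 <= (1 - s) * (a == v)%:R by rewrite mulr_ge0// subr_ge0.
by have := mulr_gt0 s0 (Tx v vT); lra.
Qed.

(** Grid fineness for a pigeonhole argument: [d * tau < M] makes two points in the same cell of side
    1/M closer than 1/tau. Grid coordinates range over 0..2M inclusive, so the resulting
    [star_bound] depends on d and tau only. *)
Let M : nat := (Num.Def.trunc (d%:R * tau)).+1.
Definition star_bound : nat := #|{ffun 'I_d -> 'I_(2 * M).+1}|.

(** Each element around a is mapped to the grid cell of its inner ball centre, seen from a and
    divided by its diameter. If T and S shared a cell, the direction of the centre of S would enter
    the inner ball of T, so their cones at a would overlap. *)
Lemma star_card a : (#|[set T in E | a \in T]| <= star_bound)%N.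
Proof.
have M0 : 0 < M%:R :> R by rewrite ltr0n.
have dM : d%:R * tau < M%:R by exact: truncnS_gt.
have [c cP] : exists c : {set V} -> 'rV[R]_d, forall T, T \in E -> exists r,
    [/\ 0 < r, h T / tau <= r & forall y, enorm (y - c T) <= r -> hull p T y].
  have : forall T, exists z, T \in E -> exists r,
    [/\ 0 < r, h T / tau <= r & forall y, enorm (y - z) <= r -> hull p T y].
    move=> T; have [TE|TE] := boolP (T \in E); last by exists 0.
    by have [z [r zr]] := shape TE; exists z => _; exists r.
  by move=> /choice[c cP]; exists c.
pose y T := (h T)^-1 *: (c T - p a).
have hull_c T : T \in E -> hull p T (c T).
  by move=> /cP[r [r0 _]]; apply; rewrite subrr -(scale0r 0) enormZ normr0 mul0r ltW.
have yE T : T \in E -> h T *: y T = c T - p a.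
  by move=> TE; rewrite /y scalerA mulfV ?scale1r// gt_eqF// h0.
pose u T i : R := (y T 0 i + 1) * M%:R.
have u_bd T i : T \in E -> a \in T -> 0 <= u T i <= (2 * M)%:R.
  move=> TE aT; have : `|y T 0 i| <= 1.
    rewrite (le_trans (coord_le_enorm _ _))// enormZ gtr0_norm ?invr_gt0 ?h0//.
    rewrite ler_pdivrMl ?h0// mulr1; apply: enorm_le_diameter (hull_c T TE) _.
    exact: hull_vert.
  rewrite ler_norml => /andP[y1 y2]; rewrite mulr_ge0 ?(ltW M0)//=; last by lra.
  by rewrite natrM ler_pM2r//; lra.
pose cell T : {ffun 'I_d -> 'I_(2 * M).+1} := [ffun i => inord (Num.Def.trunc (u T i))].
have cell_inj : {in [set T in E | a \in T] &, injective cell}.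
  move=> T S; rewrite !inE => /andP[TE aT] /andP[SE aS] /ffunP cTS.
  have hT := h0 TE; have hS := h0 SE; have hTS : 0 < h T + h S by exact: addr_gt0.
  have close i : `|(y S - y T) 0 i| <= M%:R^-1.
    have /andP[uT0 uT1] := u_bd T i TE aT; have /andP[uS0 uS1] := u_bd S i SE aS.
    have /(congr1 (@nat_of_ord _)) := cTS i; rewrite !ffunE !inordK.
    - move=> /= e; have /andP[] := truncn_itv uT0; have /andP[] := truncn_itv uS0.
      rewrite -e -[_.+1]addn1 natrD; move: (Num.Def.trunc _)%:R => t t1 t2 t3 t4.
      rewrite -[leRHS]mul1r ler_pdivlMr// -[X in _ * X]gtr0_norm// -normrM.
      rewrite (_ : _ * M%:R = u S i - u T i); last by rewrite /u !mxE; ring.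
      by rewrite ler_norml; apply/andP; split; lra.
    - by rewrite ltnS truncn_le_nat (le_lt_trans uS1)// ltr_nat.
    - by rewrite ltnS truncn_le_nat (le_lt_trans uT1)// ltr_nat.
  have [r [r0 hr rT]] := cP T TE.
  (* The rescaled centre of S, magnified by h_T, is within h_T / tau of the centre of T. *)
  have Tw : hull p T (p a + h T *: y S).
    apply: rT; have -> : p a + h T *: y S - c T = h T *: (y S - y T).
      by rewrite scalerBr yE// opprB addrA (addrC (p a)).
    rewrite enormZ gtr0_norm//.
    apply: le_trans hr; rewrite ler_pM2l//.
    have Mi : 0 <= M%:R^-1 :> R by rewrite invr_ge0 ltW.
    rewrite (le_trans (enorm_le close Mi))// ler_pdivrMr// ler_pdivlMl//.
    by rewrite mulrC ltW.
  have [r' [r'0 _ rS]] := cP S SE.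
  (* The vectors from a to the two points are h_S and h_T times the same [y S]; the factors s and t
     bring both to length h_T h_S / (h_T + h_S) times it, with s and t at most 1. *)
  apply/esym; apply: (cones_disjoint (x := c S) (y := p a + h T *: y S)
    (s := h T / (h T + h S)) (t := h S / (h T + h S)) SE TE aS aT) => //.
  - exact: ball_center_interior r'0 rS.
  - by rewrite divr_gt0//= ler_pdivrMr// mul1r lerDl ltW.
  - by rewrite divr_gt0//= ler_pdivrMr// mul1r lerDr ltW.
  - by rewrite -yE// (addrC (p a)) addrK !scalerA; congr (_ / _ *: _); rewrite mulrAC [RHS]mulrAC (mulrC (h T)).
by rewrite -(card_in_imset cell_inj) max_card.
Qed.

(** A path without repetition cannot be longer than the number of elements around a. *)
Lemma star_chain a T S : T \in E -> a \in T -> connect (adj a) T S ->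
  exists s, [/\ path (adj a) T s, last T s = S, uniq (T :: s),
    forall U, U \in T :: s -> connect (adj a) T U & (size s <= star_bound)%N].
Proof.
move=> TE aT /connectP[s0 s0P ->].
case: (shortenP s0P) => s sP su _; exists s.
have sC U : U \in T :: s -> connect (adj a) T U by exact: path_connect sP U.
split=> //; apply: leq_trans (star_card a).
have : (size (T :: s) <= #|[set U in E | a \in U]|)%N; last exact: leq_trans.
rewrite cardE; apply: uniq_leq_size su _ => U /sC/(connect_adj TE aT)[UE aU].
by rewrite mem_enum inE UE.
Qed.

(** Consecutive elements share a face, hence an edge since d >= 2, so each step of the chain costs
    one factor tau. *)
Lemma diameter_star a T S : T \in E -> a \in T -> connect (adj a) T S ->
  h T <= tau ^+ star_bound * h S.
Proof.
move=> TE aT TS; have [s [sP <- _ _ sz]] := star_chain TE aT TS.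
have : h T <= tau ^+ size s * h (last T s).
  elim: s T {TE aT TS sz} sP => [|T1 s IHs] T /=; first by rewrite expr0 mul1r.
  move=> /andP[/and4P[TE T1E _ /eqP cTT] /IHs T1s].
  rewrite exprS -mulrA; apply: le_trans (ler_wpM2l (ltW tau0) T1s).
  apply: (diameter_shared_edge d23 tau1 shape) => //.
  by rewrite cTT; case: d23 => ->.
have [SE _] := connect_adj TE aT TS; move=> /le_trans; apply.
rewrite ler_wpM2r ?ler_weXn2l//; case: s sP TS SE sz => [|T1 s] sP _ _ _ /=.
  exact/ltW/h0.
apply/ltW/h0; have TSs : connect (adj a) T (last T (T1 :: s)) by apply/connectP; exists (T1 :: s).
by have [] := connect_adj TE aT TSs.
Qed.

(** Along a path without repetition each [e U] is used by at most two consecutive differences. *)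
Lemma star_telescope a T S (m e : {set V} -> R) : (forall U, 0 <= e U) ->
  (forall U U', adj a U U' -> `|m U - m U'| <= e U + e U') -> T \in E -> a \in T ->
  connect (adj a) T S -> `|m T - m S| <= 2 * \sum_(U | connect (adj a) T U) e U.
Proof.
move=> e0 me TE aT TS; have [s [sP <- su sC _]] := star_chain TE aT TS.
have : `|m T - m (last T s)| <= e T + 2 * \sum_(U <- s) e U.
  elim: s T {TE aT TS su sC} sP => [|T1 s IHs] T /=.
    by rewrite subrr normr0 big_nil mulr0 addr0.
  move=> /andP[/me TT1 /IHs T1s]; rewrite big_cons.
  have := ler_distD (m T1) (m T) (m (last T1 s)).
  by move: (\sum_(_ <- _) _) T1s TT1 => q; lra.
move=> /le_trans; apply.
have : \sum_(U <- T :: s) e U <= \sum_(U | connect (adj a) T U) e U.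
  rewrite big_uniq//= big_mkcond [leRHS]big_mkcond; apply: ler_sum => U _.
  case: ifP => [/sC -> //|_]; case: ifP => // _; exact: e0.
by rewrite big_cons; have := e0 T; move: (\sum_(_ <- _) _) => q; lra.
Qed.

End star_size.

(** * Stable decomposition *)

Lemma sqr_sum_le {R : realFieldType} (I : finType) (P : pred I) (x : I -> R) :
  (\sum_(i | P i) x i) ^+ 2 <= #|P|%:R * \sum_(i | P i) x i ^+ 2.
Proof.
have [n0|n0] := eqVneq #|P| 0%N.
  have P0 i : P i = false by have := card0_eq n0 i.
  by rewrite (eq_bigl _ _ P0) (eq_bigl _ (fun i => x i ^+ 2) P0) !big_pred0_eq mulr0 expr0n.
set S := \sum_(i | P i) x i; set Q := \sum_(i | P i) x i ^+ 2; set n : R := #|P|%:R.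
have np : 0 < n by rewrite ltr0n lt0n.
have : 0 <= \sum_(i | P i) (n * x i - S) ^+ 2 by apply: sumr_ge0 => i _; exact: sqr_ge0.
have -> : \sum_(i | P i) (n * x i - S) ^+ 2 = n * (n * Q - S ^+ 2).
  rewrite (eq_bigr (fun i => n ^+ 2 * x i ^+ 2 + (- (2 * n * S) * x i + S ^+ 2))); last first.
    by move=> i _; ring.
  have Sn c : \sum_(i | P i) c = n * c by rewrite sumr_const -mulr_natl.
  by rewrite !big_split -!mulr_sumr /= Sn -/S -/Q; ring.
by rewrite pmulr_rge0// subr_ge0.
Qed.

Section decomposition.
Context {R : realType} {d : nat} {Omega : polyhedral_domain R d}.
Variables (K : triangulation Omega) (k : nat) (tau : R).
Hypothesis d23 : d = 2%N \/ d = 3%N.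
Hypothesis tau1 : 1 <= tau.
Local Notation p := (@vert _ _ _ K).
Local Notation E := (elts K).
Local Notation V := 'I_(nvert K).
Local Notation h := (@elt_diameter _ _ _ K).
Local Notation lam := (@bary R d (nvert K) (@vert _ _ _ K)).
Hypothesis shape : forall T, T \in E -> exists x r,
  [/\ 0 < r, h T / tau <= r & forall y, enorm (y - x) <= r -> hull p T y].
Implicit Types (T F S U : {set V}) (x y : 'rV[R]_d) (a u : V) (v : Vspace K).

Let d0 : (0 < d)%N. Proof. by case: d23 => ->. Qed.
Let tau0 : 0 < tau. Proof. exact: lt_le_trans tau1. Qed.
Let h0 T : T \in E -> 0 < h T. Proof. exact: elt_diameter_gt0. Qed.
Let F0 T F : T \in E -> face_of T F -> 0 < face_measure F.
Proof. exact: (face_measure_gt0 d23 tau1 shape). Qed.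
Let rho : R := refvol d.-1.
Let rho0 : 0 < rho. Proof. exact: refvol_gt0. Qed.
Let N := star_bound (d := d) tau.

Variable mu : Mspace K k.
Let m T := mean_T T mu.

(** Faces are weighted by 1/|F| so that this has the dimension of [mu] itself and controls
    differences of averages; multiplied by h_T^(d-2) its square is bounded by [semi_hT]. *)
Definition oscillation T : R := Num.sqrt (\sum_(F | face_of T F)
  (face_measure F)^-1 * face_int F (fun x => (mu F x - mean_T T mu) ^+ 2)).
Local Notation e := oscillation.

Let e0 T : 0 <= e T. Proof. exact: sqrtr_ge0. Qed.

Let osc_term T F c : T \in E -> face_of T F ->
  0 <= (face_measure F)^-1 * face_int F (fun x => (mu F x - c) ^+ 2).
Proof.
move=> TE TF; rewrite mulr_ge0 ?invr_ge0 ?(ltW (F0 TE TF))//.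
apply: (face_int_M_sqr_ge0 d23); exact: is_faceP TF.
Qed.

Lemma sqr_oscillation T : T \in E -> e T ^+ 2 = \sum_(F | face_of T F)
  (face_measure F)^-1 * face_int F (fun x => (mu F x - m T) ^+ 2).
Proof. by move=> TE; rewrite sqr_sqrtr// sumr_ge0// => F; exact: osc_term. Qed.

Lemma face_avg_mean T F : T \in E -> face_of T F -> `|face_avg F mu - m T| <= e T.
Proof.
move=> TE TF; apply: norm_le_sqr => //; rewrite sqr_oscillation//.
apply: le_trans (face_avg_sqr_le d23 mu (m T) (is_faceP TE TF) (F0 TE TF)) _.
by rewrite [leRHS](bigD1 F)//= lerDl sumr_ge0// => F' /andP[TF' _]; exact: (osc_term _ TE TF').
Qed.

(** [mu] is single valued on the common face, whose average is close to both means. *)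
Lemma mean_adj a T S : adj a T S -> `|m T - m S| <= e T + e S.
Proof.
move=> /and4P[TE SE _ /eqP cTS].
have TF : face_of T (T :&: S) by rewrite /face_of finset.subsetIl cTS eqxx.
have SF : face_of S (T :&: S) by rewrite /face_of finset.subsetIr cTS eqxx.
have := face_avg_mean TE TF; have := face_avg_mean SE SF.
have := ler_distD (face_avg (T :&: S) mu) (m T) (m S).
by rewrite [`|m T - face_avg _ _|]distrC; lra.
Qed.

Lemma mean_boundary T F : T \in E -> face_of T F ->
  hull p F `<=` closure Omega `\` Omega -> `|m T| <= e T.
Proof.
move=> TE TF Fb; have /asboolP[_ _ mu0] := M_funP mu.
have := face_avg_mean TE TF; rewrite /face_avg (_ : mu F = fun=> 0).
  by rewrite face_int_cst mul0r mulr0 sub0r normrN.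
by apply/funext => x; apply: mu0 => //; exact: is_faceP TF.
Qed.

Let star_osc a T := \sum_(U | connect (adj a) T U) e U.

Lemma mean_star a T S : T \in E -> a \in T -> connect (adj a) T S ->
  `|m T - m S| <= 2 * star_osc a T.
Proof. by move=> TE aT TS; apply: (star_telescope d23 tau1 shape (m := m)) => // U U'; exact: mean_adj. Qed.

Definition vertex_value a : R :=
  if `[< dom Omega (p a) >] then
    if [pick T in E | a \in T] is Some T then mean_T T mu else 0
  else 0.

(** A chain inside the star accounts for 2 of the 3. The third covers a vertex outside the domain:
    the last element of the chain has a boundary face, so its mean is itself bounded by its
    oscillation. *)
Lemma vertex_value_mean a T : T \in E -> a \in T ->
  `|vertex_value a - m T| <= 3 * star_osc a T.
Proof.
move=> TE aT; have s0 : 0 <= star_osc a T by apply: sumr_ge0.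
rewrite /vertex_value; case: asboolP => [Oa|Oa].
  case: pickP => [S /andP[SE aS]|/(_ T)]; last by rewrite TE aT.
  rewrite distrC; apply: le_trans (mean_star TE aT (star_connected d0 Oa TE SE aT aS)) _.
  by rewrite ler_wpM2r// ler_nat.
have [S [u [TS uS au Sb]]] := star_boundary d0 Oa TE aT.
have [SE _] := connect_adj TE aT TS.
have SF : face_of S (S :\ u).
  rewrite /face_of subD1set /=; have := cardsD1 u S; rewrite uS (card_elt SE) => -[cS].
  exact/eqP/esym.
have hb := mean_boundary SE SF Sb; have := mean_star TE aT TS.
have : e S <= star_osc a T.
  by rewrite /star_osc (bigD1 S)//= lerDl sumr_ge0.
rewrite sub0r normrN; move: hb.
by have := ler_normD (m T - m S) (m S); rewrite subrK; lra.
Qed.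

Lemma corrector_in_V : nodal vertex_value \in V_pred K.
Proof.
apply/asboolP; apply: (nodal_in_V d0) => a Oa.
by rewrite /vertex_value; case: asboolP.
Qed.

Definition corrector : Vspace K := MkVspace corrector_in_V.

Definition vertex_dev T : R := \sum_(a in T) `|vertex_value a - m T|.
Local Notation A := vertex_dev.

Let A0 T : 0 <= A T. Proof. by apply: sumr_ge0. Qed.

Lemma corrector_mean T x : T \in E -> hull p T x -> `|corrector x - m T| <= A T.
Proof.
move=> TE Tx; have -> : corrector x = \sum_(a in T) vertex_value a * lam T a x by exact: nodal_elt.
rewrite -[m T]mul1r -(bary_sum (card_elt TE) (elt_nondegenerate TE) x).
rewrite mulr_suml -sumrB (le_trans (ler_norm_sum _ _ _))//; apply: ler_sum => a _.
rewrite mulrC -mulrBr normrM ler_piMl// ger0_norm.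
  exact: (bary_le1 (card_elt TE) (elt_nondegenerate TE)).
by move: Tx => /(hull_baryP (card_elt TE) (elt_nondegenerate TE)).
Qed.

Let exprd (z : R) : z ^+ d = z ^+ 2 * z ^+ (d - 2).
Proof. by rewrite -exprD; congr (_ ^+ _); case: d23 => ->. Qed.
Let exprd1 (z : R) : z ^+ d.-1 = z * z ^+ (d - 2).
Proof. by rewrite -exprS; congr (_ ^+ _); case: d23 => ->. Qed.

(** The coordinates sum to 1, so [m T] may be subtracted from all vertex values without changing the
    gradient; each coordinate has slope at most tau / h_T, and the volume is at most (4 h_T)^d. *)
Lemma corrector_energy T : T \in E ->
  elt_energy T corrector <= d%:R * tau ^+ 2 * 4 ^+ d * (A T ^+ 2 * h T ^+ (d - 2)).
Proof.
move=> TE; have hT := h0 TE.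
pose f x := \sum_(a in T) vertex_value a * lam T a x.
have af : affine f by apply: affine_bigsum => a _; exact: bary_affine.
have vf x : hull p T x -> corrector x = f x by exact: nodal_elt.
have /andP[_ vE] := elt_energy_affine d23 tau1 shape TE af vf.
have bs := bary_sum (card_elt TE) (elt_nondegenerate TE).
have grad i : `|affine_grad f 0 i| <= A T * (h T / tau)^-1.
  rewrite mxE (_ : f _ - f 0 = \sum_(a in T) (vertex_value a - m T) *
      (lam T a (delta_mx 0 i) - lam T a 0)).
    rewrite (le_trans (ler_norm_sum _ _ _))// mulr_suml; apply: ler_sum => a _.
    rewrite normrM ler_wpM2l// (le_trans (norm_bary_elt d23 tau1 shape a _ _ TE))//.
    rewrite subr0 -[leRHS]mulr1 ler_wpM2l ?invr_ge0 ?divr_ge0 ?(ltW hT) ?(ltW tau0)//.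
    apply: le_of_sqr => //; rewrite sqr_enorm (bigD1 i)//= big1 ?addr0.
      by rewrite mxE !eqxx !expr1n.
    by move=> j ji; rewrite mxE (negbTE ji) andbF expr0n.
  under [RHS]eq_bigr do rewrite mulrBl.
  rewrite sumrB -mulr_sumr sumrB !bs subrr mulr0 subr0 /f -sumrB.
  by apply: eq_bigr => a _; rewrite mulrBr.
have g2 : enorm (affine_grad f) ^+ 2 <= d%:R * (A T * (h T / tau)^-1) ^+ 2.
  have Sd (c : R) : \sum_(i < d) c = d%:R * c by rewrite sumr_const card_ord mulr_natl.
  rewrite sqr_enorm -Sd; apply: ler_sum => i _.
  rewrite -real_normK ?num_real// lerXn2r ?nnegrE// mulr_ge0 ?invr_ge0 ?divr_ge0 ?(ltW hT)//.
  exact: ltW.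
apply: le_trans vE _; apply: le_trans (ler_wpM2r _ g2) _.
  by rewrite exprn_ge0// mulr_ge0// ltW.
rewrite le_eqVlt; apply/orP; left; apply/eqP.
rewrite [(4 * h T) ^+ d]exprMn (exprd (h T)); move: (A T) (h T ^+ (d - 2)) (4 ^+ d) => x y z.
by field; rewrite !gt_eqF.
Qed.

(** The difference is split at the constant [m T]. The first part is [semi_hT] exactly, since h^-2
    times the h of [norm_hT] is h^-1; the second is bounded by [prolongation_le], as the corrector
    is within [A T] of [m T]. *)
Lemma corrector_norm_hT (P : Vspace K -> Mspace K k) T : is_Pi1 P \/ is_Pi2 P -> T \in E ->
  (h T) ^- 2 * norm_hT T (mu - P corrector) ^+ 2 <=
  2 * semi_hT T mu ^+ 2 + 2 * d.+1%:R * rho * (A T ^+ 2 * h T ^+ (d - 2)).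
Proof.
move=> hP TE; have hT := h0 TE.
rewrite (sqr_norm_hT d23)// (sqr_semi_hT d23)//.
set B := bdry_int T (fun F x => (mu F x - m T) ^+ 2).
have : bdry_int T (fun F x => (mu - P corrector) F x ^+ 2) <=
    2 * B + d.+1%:R * (2 * A T ^+ 2 * (h T ^+ d.-1 * rho)).
  rewrite -(card_faces _ TE) /B /bdry_int mulr_sumr -big_split; apply: ler_sum => F TF.
  have FK := is_faceP TE TF; have cF := card_face TF.
  have c1 := hull_continuous_sub (m T) (Mspace_continuous mu FK).
  have c2 := hull_continuous_sub (m T) (Mspace_continuous (P corrector) FK).
  have s1 := hull_continuous_sqr c1; have s2 := hull_continuous_sqr c2.
  apply: (@le_trans _ _ (2 * face_int F (fun x => (mu F x - m T) ^+ 2) +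
      2 * face_int F (fun x => (P corrector F x - m T) ^+ 2))).
    have s0 := hull_continuous_cst p F 0.
    rewrite -[X in _ <= _ + X]addr0 -[X in _ <= _ + (_ + X)](mul0r (face_measure F)).
    rewrite -face_int_cst -(face_int_lin d0 cF _ s2 s0) -(face_int_lin d0 cF)//; last first.
      exact: hull_continuous_lin.
    apply: (le_face_int d0 cF).
    - exact/hull_continuous_sqr/Mspace_continuous.
    - by do 2 apply: hull_continuous_lin => //.
    - move=> x _; have -> : (mu - P corrector) F x = mu F x - P corrector F x by [].
      have := sqr_ge0 ((mu F x - m T) + (P corrector F x - m T)).
      by move: (mu F x) (P corrector F x) => y z; nra.
  apply: lerD => //; rewrite -mulrA ler_wpM2l//.
  have := prolongation_le d0 corrector (m T) hP FK (F0 TE TF); move=> /le_trans; apply.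
  apply: (@le_trans _ _ (A T ^+ 2 * face_measure F)).
    apply: (face_int_sqr_bound d0 cF) => [||x Fx]//; first exact: Vspace_continuous.
    by apply: corrector_mean => //; move: TF => /andP[FT _]; exact: hull_subset Fx.
  rewrite ler_wpM2l ?sqr_ge0//.
  by have /andP[] := face_measure_bounds d23 tau1 shape TE TF.
have hi : 0 <= (h T)^-1 by rewrite invr_ge0 ltW.
move=> H; have {}H := ler_wpM2l hi H.
have hE z : (h T) ^- 2 * (h T * z) = (h T)^-1 * z by field; rewrite gt_eqF.
rewrite hE; apply: le_trans H _; rewrite exprd1 le_eqVlt; apply/orP; left; apply/eqP.
by move: B (A T) (h T ^+ (d - 2)) => x y z; field; rewrite gt_eqF.
Qed.

Lemma oscillation_le T : T \in E ->
  h T ^+ (d - 2) * e T ^+ 2 <= tau ^+ d.-1 / rho * semi_hT T mu ^+ 2.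
Proof.
move=> TE; have hT := h0 TE; rewrite sqr_oscillation// (sqr_semi_hT d23)//.
have hd1 : 0 < h T ^+ (d - 2) by rewrite exprn_gt0.
have td : 0 < tau ^+ d.-1 by rewrite exprn_gt0.
rewrite mulrCA mulr_sumr /bdry_int !mulr_sumr; apply: ler_sum => F TF.
have := face_int_M_sqr_ge0 d23 mu (m T) (is_faceP TE TF); rewrite -/(m T).
move: (face_int F _) => i i0; rewrite !mulrA; apply: (ler_wpM2r i0).
have /andP[b _] := face_measure_bounds d23 tau1 shape TE TF.
have b0 : 0 < (h T / tau) ^+ d.-1 * rho by rewrite mulr_gt0// exprn_gt0// divr_gt0.
apply: (@le_trans _ _ (h T ^+ (d - 2) * ((h T / tau) ^+ d.-1 * rho)^-1)).
  by rewrite ler_pM2l// lef_pV2 ?posrE// (F0 TE TF).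
rewrite expr_div_n (exprd1 (h T)) le_eqVlt; apply/orP; left; apply/eqP.
move: (h T ^+ _) (tau ^+ _) hd1 td => x y x0 y0.
by field; rewrite !gt_eqF.
Qed.

(** Each S is counted once per vertex a of S and per element T around a, that is at most (d+1) N
    times. *)
Lemma sum_elt_vertex_le (X : {set V} -> R) : (forall S, S \in E -> 0 <= X S) ->
  \sum_(T in E) \sum_(a in T) \sum_(S in E | a \in S) X S <=
  d.+1%:R * N%:R * \sum_(S in E) X S.
Proof.
move=> X0; pose Y a := \sum_(S in E | a \in S) X S.
have Y0 a : 0 <= Y a by apply: sumr_ge0 => S /andP[SE _]; exact: X0.
rewrite (exchange_big_dep xpredT)//=.
apply: (@le_trans _ _ (\sum_a N%:R * Y a)).
  apply: ler_sum => a _; rewrite sumr_const -[leLHS]mulr_natl; apply: ler_wpM2r; first exact: Y0.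
  rewrite ler_nat.
  apply: leq_trans (star_card d23 tau1 shape a); rewrite subset_leq_card//.
  by apply/fintype.subsetP => T; rewrite !inE.
rewrite -mulr_sumr [in X in _ <= X]mulrAC mulrC ler_wpM2r// /Y.
rewrite (exchange_big_dep (mem E))/=; last by move=> a S _ /andP[].
rewrite mulr_sumr; apply: ler_sum => S SE.
by rewrite SE /= sumr_const (card_elt SE) mulr_natl.
Qed.

(** In order: Cauchy-Schwarz over d+1 vertices; the 3 of [vertex_value_mean] squared and
    Cauchy-Schwarz over N elements; change of diameter within a star; overlap of stars; passage from
    [oscillation] to [semi_hT]. *)
Definition vertex_dev_cst : R :=
  d.+1%:R * (9 * N%:R) * (tau ^+ N) ^+ (d - 2) * (d.+1%:R * N%:R) * (tau ^+ d.-1 / rho).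

(** Diameters are exchanged only between elements of one star, which is why no global
    quasi-uniformity enters. *)
Lemma sum_vertex_dev_le :
  \sum_(T in E) A T ^+ 2 * h T ^+ (d - 2) <= vertex_dev_cst * semi_h mu ^+ 2.
Proof.
pose L : R := (tau ^+ N) ^+ (d - 2); have L0 : 0 <= L by rewrite !exprn_ge0// ltW.
pose X S := h S ^+ (d - 2) * e S ^+ 2.
have X0 S : S \in E -> 0 <= X S.
  by move=> SE; rewrite mulr_ge0 ?sqr_ge0// exprn_ge0// ltW// h0.
have c0 : 0 <= d.+1%:R * (9 * N%:R) * L :> R by rewrite !mulr_ge0.
have step T : T \in E -> A T ^+ 2 * h T ^+ (d - 2) <=
    d.+1%:R * (9 * N%:R) * L * \sum_(a in T) \sum_(S in E | a \in S) X S.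
  move=> TE; have hT : 0 <= h T ^+ (d - 2) by rewrite exprn_ge0// ltW// h0.
  apply: le_trans (ler_wpM2r hT (sqr_sum_le _ _)) _; rewrite (card_elt TE).
  rewrite -!mulrA ler_wpM2l// mulr_suml !mulr_sumr; apply: ler_sum => a aT.
  apply: (@le_trans _ _ ((9 * star_osc a T ^+ 2) * h T ^+ (d - 2))).
    rewrite ler_wpM2r//; have := vertex_value_mean TE aT.
    have s0 : 0 <= star_osc a T by apply: sumr_ge0.
    have -> : 9 * star_osc a T ^+ 2 = (3 * star_osc a T) ^+ 2 by ring.
    by move=> ?; rewrite lerXn2r ?nnegrE ?mulr_ge0.
  rewrite -mulrA ler_wpM2l//.
  have CE U : connect (adj a) T U -> U \in E /\ a \in U by exact: connect_adj.
  have hN : (#|[pred U | connect (adj a) T U]| <= N)%N.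
    apply: leq_trans (star_card d23 tau1 shape a); rewrite subset_leq_card//.
    by apply/fintype.subsetP => U; rewrite !inE => /CE[-> ->].
  apply: le_trans (ler_wpM2r hT (sqr_sum_le _ _)) _.
  apply: (@le_trans _ _ (N%:R * (\sum_(U | connect (adj a) T U) e U ^+ 2) * h T ^+ (d - 2))).
    rewrite ler_wpM2r// ler_wpM2r ?ler_nat// sumr_ge0// => U _; exact: sqr_ge0.
  rewrite -mulrA ler_wpM2l// mulr_suml mulr_sumr big_mkcond [leRHS]big_mkcond.
  apply: ler_sum => U _; case: ifP => [TU|_].
    have [UE aU] := CE U TU; rewrite UE aU /= /X mulrC mulrA ler_wpM2r ?sqr_ge0//.
    rewrite -exprMn lerXn2r ?nnegrE ?mulr_ge0 ?exprn_ge0 ?(ltW tau0) ?(ltW (h0 _))//.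
    exact: (diameter_star d23 tau1 shape TE aT TU).
  by case: ifP => [/andP[UE _]|//]; rewrite mulr_ge0// X0.
apply: le_trans (ler_sum _ step) _; rewrite -mulr_sumr.
apply: le_trans (ler_wpM2l c0 (sum_elt_vertex_le X0)) _.
rewrite sqr_semi_h !mulr_sumr; apply: ler_sum => T TE.
have c1 : 0 <= d.+1%:R * (9 * N%:R) * L * (d.+1%:R * N%:R) :> R by rewrite !mulr_ge0.
by have := ler_wpM2l c1 (oscillation_le TE); rewrite /vertex_dev_cst -/L /X !mulrA.
Qed.

Definition decomposition_cst : R :=
  2 + (2 * d.+1%:R * rho + d%:R * tau ^+ 2 * 4 ^+ d) * vertex_dev_cst.

Lemma stable_decomposition (P : Vspace K -> Mspace K k) : is_Pi1 P \/ is_Pi2 P ->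
  \sum_(T in E) (h T) ^- 2 * norm_hT T (mu - P corrector) ^+ 2 + h1_semi corrector ^+ 2 <=
  decomposition_cst * semi_h mu ^+ 2.
Proof.
move=> hP; rewrite sqr_h1_semi -big_split /=.
pose G : R := 2 * d.+1%:R * rho + d%:R * tau ^+ 2 * 4 ^+ d.
have G0 : 0 <= G by rewrite addr_ge0// !mulr_ge0 ?exprn_ge0 ?(ltW rho0) ?(ltW tau0).
apply: (@le_trans _ _ (\sum_(T in E) (2 * semi_hT T mu ^+ 2 + G * (A T ^+ 2 * h T ^+ (d - 2))))).
  apply: ler_sum => T TE; have := corrector_norm_hT hP TE; have := corrector_energy TE.
  by rewrite /G mulrDl; lra.
rewrite big_split -!mulr_sumr /= -sqr_semi_h /decomposition_cst -/G [leRHS]mulrDl.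
by apply: lerD => //; rewrite -mulrA ler_wpM2l// sum_vertex_dev_le.
Qed.

End decomposition.

(** * The auxiliary space method *)

Section coordinates.
Context {R : realType} {V : lmodType R}.

(** [coord] is a relation because a function on a face may have several polynomial representatives.
    A left kernel vector of the coefficient matrix, which has one more row than columns, gives the
    dependence. *)
Lemma rank_le_coordinates (J : finType) (coord : V -> (J -> R) -> Prop) :
  (forall v, exists c, coord v c) -> coord 0 (fun=> 0) ->
  (forall a u v c c', coord u c -> coord v c' -> coord (a *: u + v) (fun j => a * c j + c' j)) ->
  (forall v, coord v (fun=> 0) -> v = 0) -> rank_le (V := V) #|J|.
Proof.
move=> /choice[c cP] c0 clin cinj e.
pose M := \matrix_(i < #|J|.+1, j < #|J|) c (e i) (enum_val j).
have : kermx M != 0.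
  by rewrite -mxrank_eq0 mxrank_ker subn_eq0 -ltnNge ltnS rank_leq_col.
move=> /rowV0Pn[u /sub_kermxP uM u0]; exists (fun i => u 0 i).
  apply: contrapT => /forallNP u0'; move/eqP: u0; apply; apply/rowP => i.
  by rewrite mxE; apply/eqP/negPn/negP/u0'.
apply: cinj; have -> : (fun=> 0) = (fun j => \sum_i u 0 i * c (e i) j).
  apply/funext => j; have := congr1 (fun N : 'rV_#|J| => N 0 (enum_rank j)) uM.
  rewrite mxE [X in _ = X]mxE => uMj; rewrite -[LHS]uMj.
  by apply: eq_bigr => i _; rewrite mxE enum_rankK.
elim: (index_enum _) => [|i s IHs].
  by rewrite big_nil; under eq_fun do rewrite big_nil.
rewrite big_cons (_ : (fun j => _) = fun j => u 0 i * c (e i) j + \sum_(i <- s) u 0 i * c (e i) j).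
  exact: clin.
by apply/funext => j; rewrite big_cons.
Qed.

End coordinates.

Lemma Mspace_rank {R : realType} {d : nat} {Omega : polyhedral_domain R d}
  (K : triangulation Omega) (k : nat) : exists N, rank_le (V := Mspace K k) N.
Proof.
pose J : finType := ({set 'I_(nvert K)} * {ffun 'I_d -> 'I_k.+1})%type.
pose poly (c : J -> R) F (x : 'rV[R]_d) :=
  \sum_(a : {ffun 'I_d -> 'I_k.+1} | (\sum_i a i <= k)%N) c (F, a) * \prod_i x 0 i ^+ a i.
pose coord (mu : Mspace K k) c := forall F, is_face F ->
  forall x, hull (@vert _ _ _ K) F x -> mu F x = poly c F x.
exists #|J|; apply: (@rank_le_coordinates R (Mspace K k) J coord).
- move=> mu; have /asboolP[Pm _ _] := M_funP mu.
  have /choice[c cP] : forall F, exists c : {ffun 'I_d -> 'I_k.+1} -> R, is_face F ->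
      forall x, hull (@vert _ _ _ K) F x -> mu F x =
        \sum_(a : {ffun 'I_d -> 'I_k.+1} | (\sum_i a i <= k)%N) c a * \prod_i x 0 i ^+ a i.
    move=> F; have [FK|FK] := boolP (is_face F); last by exists (fun=> 0).
    by have [q [c qc] mq] := Pm F FK; exists c => _ x Fx; rewrite mq.
  by exists (fun j => c j.1 j.2) => F FK x Fx; rewrite cP.
- by move=> F FK x Fx; rewrite /poly big1// => a _; rewrite mul0r.
- move=> a u v c c' hu hv F FK x Fx.
  have -> : (a *: u + v) F x = a * u F x + v F x by [].
  rewrite hu// hv// /poly mulr_sumr -big_split; apply: eq_bigr => b _.
  by rewrite mulrDl mulrA.
- move=> mu mu0; apply: val_inj; apply/funext => F; apply/funext => x.
  have -> : \val (0 : Mspace K k) F x = 0 by [].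
  have [FK|FK] := boolP (is_face F); last first.
    have /asboolP[_ Zm _] := M_funP mu; apply: Zm => -[FK' _].
    by rewrite FK' in FK.
  have [Fx|Fx] := pselect (hull (@vert _ _ _ K) F x); last first.
    by have /asboolP[_ Zm _] := M_funP mu; apply: Zm => -[_].
  by apply: etrans (mu0 F FK x Fx) _; rewrite /poly big1// => a _; rewrite mul0r.
Qed.

Section L2_product.
Context {R : realType} {d : nat} {Omega : polyhedral_domain R d}.
Variable K : triangulation Omega.
Implicit Types u v w : Vspace K.

Let mO : measurable (dom Omega : set (borelRn d)).
Proof. by apply: measurable_open_Rn; exact: dom_open. Qed.

Lemma L2_mul_integrable (f g : 'rV[R]_d -> R) : L2_on Omega f -> L2_on Omega g ->
  (lebesgueRn (n := d)).-integrable (dom Omega) (EFin \o (fun x => f x * g x)).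
Proof.
move=> [mf f2] [mg g2].
have sqr_int (u : 'rV[R]_d -> R) : L2_on Omega u ->
    (lebesgueRn (n := d)).-integrable (dom Omega) (EFin \o (fun x => u x ^+ 2)).
  move=> [mu u2]; apply/integrableP; split.
    by apply/measurable_EFinP; exact: measurable_funX.
  apply: le_lt_trans u2; rewrite le_eqVlt; apply/orP; left; apply/eqP.
  by apply: eq_integral => x _ /=; rewrite ger0_norm ?sqr_ge0.
have fi := sqr_int f (conj mf f2); have gi := sqr_int g (conj mg g2).
have := integrableD mO fi gi.
apply: (@le_integrable _ (borelRn d) R lebesgueRn (dom Omega) mO).
  by apply/measurable_EFinP; exact: measurable_funM.
move=> x _ /=; rewrite lee_fin normrM [leRHS]ger0_norm ?addr_ge0 ?sqr_ge0//.
rewrite -[f x ^+ 2]real_normK ?num_real// -[g x ^+ 2]real_normK ?num_real//.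
have := sqr_ge0 (`|f x| - `|g x|); have := normr_ge0 (f x); have := normr_ge0 (g x).
by move: `|f x| `|g x| => y z; nra.
Qed.

Lemma Vspace_L2 v : L2_on Omega v.
Proof. by have /asboolP[[]] := V_funP v. Qed.

Lemma ipL2_sym_bilinear : sym_bilinear (@ipL2 R d Omega K).
Proof.
split=> [a u v w|u v]; last first.
  by apply: eq_Rintegral => x _; rewrite [LHS]mulrC.
have iu := L2_mul_integrable (Vspace_L2 u) (Vspace_L2 w).
have iv := L2_mul_integrable (Vspace_L2 v) (Vspace_L2 w).
rewrite /ipL2 -RintegralZl// -RintegralD//; last first.
  exact: (@integrableZl _ (borelRn d) R lebesgueRn (dom Omega) mO a _ iu).
apply: eq_Rintegral => x _.
have -> : (a *: u + v) x = (a : R) * (u x : R) + (v x : R) by [].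
by rewrite [LHS]mulrDl mulrA.
Qed.

End L2_product.

Lemma ip_h_sym {R : realType} {d : nat} {Omega : polyhedral_domain R d}
  (K : triangulation Omega) (k : nat) (u v : Mspace K k) : ip_h u v = ip_h v u.
Proof.
apply: eq_bigr => T _; congr (_ * _); apply: eq_bigr => F _; congr (face_int F _).
by apply/funext => x; rewrite [LHS]mulrC.
Qed.

Lemma sqr_add_le {R : realDomainType} (a b x y z w : R) :
  0 <= x -> 0 <= y -> 0 <= z -> 0 <= w -> a ^+ 2 <= x * y -> b ^+ 2 <= z * w ->
  (a + b) ^+ 2 <= (x + z) * (y + w).
Proof.
move=> x0 y0 z0 w0 ha hb.
have h : a * b * 2 <= x * w + z * y.
  apply: le_of_sqr; first by rewrite addr_ge0// mulr_ge0.
  have : (a * b) ^+ 2 <= x * y * (z * w) by rewrite exprMn ler_pM ?sqr_ge0.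
  have := sqr_ge0 (x * w - z * y); move: (a * b) => c; rewrite -subr_ge0 => h1 h2.
  rewrite -subr_ge0.
  have -> : (x * w + z * y) ^+ 2 - (c * 2) ^+ 2 =
    (x * w - z * y) ^+ 2 + 4 * (x * y * (z * w) - c ^+ 2) by ring.
  by rewrite addr_ge0 ?sqr_ge0// mulr_ge0// subr_ge0.
have -> : (a + b) ^+ 2 = a ^+ 2 + b ^+ 2 + a * b * 2 by ring.
have -> : (x + z) * (y + w) = x * y + z * w + (x * w + z * y) by ring.
by rewrite !lerD.
Qed.

Section auxiliary_space.
Context {R : realType} {M W : lmodType R}.
Variables (dh ip : M -> M -> R) (q : W -> W -> R).
Variables (D S : {linear M -> M}) (Dinv Sinv : M -> M).
Variables (B : {linear W -> W}) (Binv : W -> W).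
Variables (Pi : {linear W -> M}) (Pit : {linear M -> W}) (cS c1 c2 : R).
Hypothesis dhP : inner_product dh.
Hypothesis ip_sym : forall u v, ip u v = ip v u.
Hypothesis qP : sym_bilinear q.
Hypothesis ipD : forall u v, ip (D u) v = dh u v.
Hypothesis DK : cancel D Dinv.
Hypothesis DinvK : cancel Dinv D.
Hypothesis SP : sym_posdef ip S.
Hypothesis SinvK : cancel Sinv S.
Hypothesis BP : sym_posdef q B.
Hypothesis BK : cancel B Binv.
Hypothesis BinvK : cancel Binv B.
Hypothesis PitP : forall u v, q (Pit u) v = ip u (Pi v).
Hypothesis S_le : forall u, ip (S u) u <= cS * ip (Dinv u) u.
Hypothesis Pi_le : forall v, dh (Pi v) (Pi v) <= c1 * q (Binv v) v.
Hypothesis c1_ge0 : 0 <= c1.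
Hypothesis c2_gt0 : 0 < c2.
Hypothesis decomp : forall u, exists v,
  ip (Sinv (u - Pi v)) (u - Pi v) + q (Binv v) v <= c2 * dh u u.

Let A u : M := S (D u) + Pi (B (Pit (D u))).

Let dhb : sym_bilinear dh. Proof. by have [dl ds _] := dhP. Qed.

Let dh_ge0 u : 0 <= dh u u.
Proof.
have [->|u0] := eqVneq u 0; first by rewrite sym_bilinear0.
by have [_ _ dp] := dhP; exact/ltW/dp.
Qed.

(** Linearity of [ip] is inherited from [dh], every u being D applied to [Dinv u]. *)
Let ipb : sym_bilinear ip.
Proof.
split=> // a u v w; rewrite -[u]DinvK -[v]DinvK -linearP !ipD.
exact: dhb.1.
Qed.

Let posdef_form (N : lmodType R) (b : N -> N -> R) (F : {linear N -> N}) :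
  sym_bilinear b -> sym_posdef b F ->
  sym_bilinear (fun u v => b (F u) v) /\ forall u, 0 <= b (F u) u.
Proof.
move=> [bl bs] [Fs Fp]; split; last first.
  move=> u; have [->|/Fp/ltW//] := eqVneq u 0.
  by rewrite linear0 (sym_bilinear0 _ (conj bl bs)).
split=> [a u v w|u v]; first by rewrite linearP bl.
by rewrite Fs bs.
Qed.

Let Sb := posdef_form ipb SP.
Let Bb := posdef_form qP BP.

Let dhA u v : dh (A u) v = ip (S (D u)) (D v) + q (B (Pit (D u))) (Pit (D v)).
Proof.
rewrite dhb.2 -ipD ipb.2 /A -[S (D u)]scale1r ipb.1 mul1r scale1r; congr (_ + _).
by rewrite ip_sym -PitP qP.2.
Qed.

Lemma auxiliary_sym : sym_bilinear (fun u v => dh (A u) v).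
Proof.
split=> [a u v w|u v].
  rewrite !dhA !linearP ipb.1 qP.1; ring.
by rewrite !dhA Sb.1.2 Bb.1.2.
Qed.

(** With w = B (Pit (D u)), the auxiliary term b equals both [dh u (Pi w)] and [q (Binv w) w].
    Cauchy-Schwarz and stability give b^2 <= c1 b [dh u u], and one factor b cancels. *)
Lemma auxiliary_upper u : dh (A u) u <= (cS + c1) * dh u u.
Proof.
rewrite dhA mulrDl lerD//; first by have := S_le (D u); rewrite DK [ip u _]ip_sym ipD.
set w := B (Pit (D u)); set b := q w (Pit (D u)).
have b0 : 0 <= b by exact: Bb.2.
have bE : b = dh u (Pi w) by rewrite /b qP.2 PitP ipD.
have bE' : q (Binv w) w = b by rewrite /w BK qP.2.
have := psd_cauchy_schwarz u (Pi w) dhb dh_ge0; rewrite -bE => h.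
have {}h : b * b <= b * (c1 * dh u u).
  rewrite -expr2 (le_trans h)// mulrCA mulrC mulrA ler_wpM2r//.
  by have := Pi_le w; rewrite bE'.
have [->|bn] := eqVneq b 0; first by rewrite mulr_ge0.
by rewrite -(ler_pM2l (x := b))// lt_neqAle eq_sym bn.
Qed.

(** Testing [dh u u] against u = u0 + Pi v writes it as an S-product with [Sinv u0] plus a B-product
    with [Binv v]. Cauchy-Schwarz in each, then for the sum, bounds its square by [dh (A u) u] times
    the decomposition energy. *)
Lemma auxiliary_lower u : c2^-1 * dh u u <= dh (A u) u.
Proof.
have [v hv] := decomp u; set u0 := u - Pi v in hv.
set s := Sinv u0; set t := Binv v.
have hs : ip (S (D u)) s ^+ 2 <= ip (S (D u)) (D u) * ip (S s) s.
  exact: (psd_cauchy_schwarz (D u) s Sb.1 Sb.2).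
have ht : q (B (Pit (D u))) t ^+ 2 <= q (B (Pit (D u))) (Pit (D u)) * q (B t) t.
  exact: (psd_cauchy_schwarz (Pit (D u)) t Bb.1 Bb.2).
have uE : dh u u = ip (S (D u)) s + q (B (Pit (D u))) t.
  rewrite BP.1 /t BinvK SP.1 /s SinvK PitP ![ip (D u) _]ip_sym -[ip u0 _]mul1r -ipb.1.
  by rewrite scale1r /u0 subrK ip_sym ipD.
have := sqr_add_le (Sb.2 _) (Sb.2 _) (Bb.2 _) (Bb.2 _) hs ht.
rewrite -uE -dhA => H; rewrite ler_pdivrMl//.
have A0 : 0 <= dh (A u) u by rewrite dhA addr_ge0 ?Sb.2 ?Bb.2.
have {}H : dh u u * dh u u <= dh u u * (c2 * dh (A u) u).
  rewrite -expr2 (le_trans H)//.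
  have -> : dh u u * (c2 * dh (A u) u) = dh (A u) u * (c2 * dh u u) by ring.
  rewrite ler_wpM2l//.
  rewrite (le_trans _ hv)// /s /t SinvK BinvK ip_sym lerD// qP.2.
  by [].
have [->|un] := eqVneq (dh u u) 0; first by rewrite mulr_ge0// ltW.
by rewrite -(ler_pM2l (x := dh u u))// lt_neqAle eq_sym un dh_ge0.
Qed.

End auxiliary_space.

(** C is fixed before the mesh index, which expresses independence of h. The guard on [mu] excludes
    meshes such as a single simplex, where all faces lie on the boundary and there is no
    eigenvalue. *)
Theorem theorem3p1 (R : realType) (d : nat) (hd : d = 2%N \/ d = 3%N)
  (Omega : polyhedral_domain R d) (k : nat)
  (I : Type) (T : I -> triangulation Omega) (hT : shape_regular T)
  (dh : forall i, Mspace (T i) k -> Mspace (T i) k -> R)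
  (D S : forall i, {linear Mspace (T i) k -> Mspace (T i) k})
  (Dinv Sinv : forall i, Mspace (T i) k -> Mspace (T i) k)
  (B : forall i, {linear Vspace (T i) -> Vspace (T i)})
  (Binv : forall i, Vspace (T i) -> Vspace (T i))
  (Pi : forall i, {linear Vspace (T i) -> Mspace (T i) k})
  (Pit : forall i, {linear Mspace (T i) k -> Vspace (T i)})
  (h_dh : forall i, inner_product (dh i))
  (h_dh_equiv : equiv_unif (fun i mu => dh i mu mu) (fun i mu => semi_h mu ^+ 2))
  (h_D : forall i lambda mu, ip_h (D i lambda) mu = dh i lambda mu)
  (h_Dinv : forall i, cancel (D i) (Dinv i) /\ cancel (Dinv i) (D i))
  (h_S : forall i, sym_posdef (@ip_h _ _ _ (T i) k) (S i))
  (h_Sinv : forall i, cancel (S i) (Sinv i) /\ cancel (Sinv i) (S i))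
  (h_S_le : lesssim (fun i mu => ip_h (S i mu) mu)
                    (fun i mu => ip_h (Dinv i mu) mu))
  (h_Sinv_le : lesssim (fun i mu => ip_h (Sinv i mu) mu)
     (fun i mu => \sum_(t in elts (T i)) (elt_diameter t) ^- 2 * norm_hT t mu ^+ 2))
  (h_B : forall i, sym_posdef (@ipL2 _ _ _ (T i)) (B i))
  (h_Binv : forall i, cancel (B i) (Binv i) /\ cancel (Binv i) (B i))
  (h_B_equiv : equiv_unif (fun i v => ipL2 (Binv i v) v) (fun i v => h1_semi v ^+ 2))
  (h_Pi : (forall i, is_Pi1 (Pi i)) \/ (forall i, is_Pi2 (Pi i)))
  (h_Pit : forall i mu v, ipL2 (Pit i mu) v = ip_h mu (Pi i v)) :
  exists2 C : R, 0 < C & forall i, (exists mu : Mspace (T i) k, mu != 0) ->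
    exists lmin lmax,
      let BG := fun mu => S i mu + Pi i (B i (Pit i mu)) in
      let BGD := fun mu => BG (D i mu) in
      [/\ min_eigenvalue BGD lmin, max_eigenvalue BGD lmax, 0 < lmin &
          lmax / lmin <= C].
Proof.
have d0 : (0 < d)%N by case: hd => ->.
(* 4 sigma is the loss in [inscribed_ball]; the maximum with 1 makes powers of tau monotone in the
   exponent. *)
have [sigma sigma0 hsigma] := hT; pose tau := Num.max 1 (4 * sigma).
have tau1 : 1 <= tau by rewrite le_max lexx.
have s4 : 0 < 4 * sigma by rewrite mulr_gt0.
have shape i t : t \in elts (T i) -> exists x r, [/\ 0 < r, elt_diameter t / tau <= r &
    forall y, enorm (y - x) <= r -> hull (@vert _ _ _ (T i)) t y].
  move=> tE; have h0 := elt_diameter_gt0 hd tE.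
  have [x [r [r0 hr hx]]] := inscribed_ball sigma0 h0 (hsigma i t tE).
  exists x, r; split=> //; apply: le_trans hr.
  by rewrite ler_pM2l// lef_pV2 ?posrE ?(lt_le_trans _ tau1)// le_max lexx orbT.
have hP i : is_Pi1 (Pi i) \/ is_Pi2 (Pi i) by case: h_Pi => h; [left|right].
have [[ca ca0 dh_le] [cb cb0 le_dh]] := h_dh_equiv.
have [[be be0 B_le] [bf bf0 le_B]] := h_B_equiv.
have [cS cS0 S_le] := h_S_le; have [cI cI0 Sinv_le] := h_Sinv_le.
(* Absolute values give nonnegativity of the constants at once. *)
pose Cp := `|prolongation_cst (d := d) tau|.
pose Cd := `|decomposition_cst (d := d) tau|.
(* The summand 1 makes [c2] positive, so that its inverse can serve as lower spectral bound. *)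
pose c1 := ca * Cp * bf; pose c2 := (cI + be) * Cd * cb + 1.
have Cp0 : 0 <= Cp by exact: normr_ge0.
have Cd0 : 0 <= Cd by exact: normr_ge0.
have c1_ge0 : 0 <= c1 := mulr_ge0 (mulr_ge0 (ltW ca0) Cp0) (ltW bf0).
have cIe0 : 0 <= cI + be := addr_ge0 (ltW cI0) (ltW be0).
have c2_gt0 : 0 < c2 := ltr_wpDl (mulr_ge0 (mulr_ge0 cIe0 Cd0) (ltW cb0)) ltr01.
have Pi_le i v : dh i (Pi i v) (Pi i v) <= c1 * ipL2 (Binv i v) v.
  apply: le_trans (dh_le i _) _; rewrite /c1 -!mulrA ler_wpM2l ?(ltW ca0)//.
  apply: le_trans (prolongation_stable hd tau1 (shape i) v (hP i)) _.
  apply: (@le_trans _ _ (Cp * h1_semi v ^+ 2)).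
    by rewrite ler_wpM2r ?sqr_ge0// ler_norm.
  by rewrite ler_wpM2l// le_B.
have decomp i mu : exists v,
    ip_h (Sinv i (mu - Pi i v)) (mu - Pi i v) + ipL2 (Binv i v) v <= c2 * dh i mu mu.
  have := stable_decomposition hd tau1 (shape i) mu (hP i).
  set v := corrector hd mu; set X := \sum_(t in _) _; set Y := h1_semi v ^+ 2 => XY.
  have X0 : 0 <= X.
    by apply: sumr_ge0 => t _; rewrite mulr_ge0 ?sqr_ge0// invr_ge0 sqr_ge0.
  have Y0 : 0 <= Y by exact: sqr_ge0.
  have dmu0 : 0 <= dh i mu mu.
    have [dl ds dp] := h_dh i; have [->|/dp/ltW//] := eqVneq mu 0.
    by rewrite (sym_bilinear0 _ (conj dl ds)).
  exists v; apply: le_trans (lerD (Sinv_le i _) (B_le i v)) _; rewrite -/X -/Y.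
  apply: (@le_trans _ _ ((cI + be) * (X + Y))).
    have := mulr_ge0 (ltW cI0) Y0; have := mulr_ge0 (ltW be0) X0.
    by rewrite mulrDl !mulrDr; lra.
  rewrite /c2 [leRHS]mulrDl mul1r -[leLHS]addr0 lerD// -!mulrA ler_wpM2l//.
  apply: le_trans XY _; apply: (@le_trans _ _ (Cd * semi_h mu ^+ 2)).
    by rewrite ler_wpM2r ?sqr_ge0// ler_norm.
  by rewrite ler_wpM2l// le_dh.
exists ((cS + c1) / c2^-1).
  by rewrite divr_gt0 ?invr_gt0// ltr_wpDr.
move=> i M0; have [N hN] := Mspace_rank (T i) k.
have [DK DinvK] := h_Dinv i; have [SK SinvK] := h_Sinv i; have [BK BinvK] := h_Binv i.
have qb := ipL2_sym_bilinear (T i).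
apply: (self_adjoint_spectrum hN (h_dh i)) => //; last first.
- move=> u; exact: (auxiliary_upper (h_dh i) (@ip_h_sym _ _ _ (T i) k) qb (h_D i) DK DinvK
    (h_B i) BK (h_Pit i) (S_le i) (Pi_le i) c1_ge0 u).
- move=> u; exact: (auxiliary_lower (h_dh i) (@ip_h_sym _ _ _ (T i) k) qb (h_D i) DinvK
    (h_S i) SinvK (h_B i) BinvK (h_Pit i) c2_gt0 (decomp i) u).
- by rewrite invr_gt0.
- exact: (auxiliary_sym (h_dh i) (@ip_h_sym _ _ _ (T i) k) qb (h_D i) DinvK (h_S i) (h_B i) (h_Pit i)).
Qed.
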